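(* Let $(g_i)_{i\ge1},(d_i)_{i\ge1},(s_i)_{i\ge1},(a_i)_{i\ge1}$ be nonnegative real sequences and $(b_{i,j})_{i,j\ge1}$ a nonnegative array such that $a_1=0$, $a_i>0$ for $i\ge2$, $b_{i,j}=0$ for $i\ge j$, and $\sum_{i=1}^{j-1} i\,b_{i,j}=j$ for all $j\ge2$. Put $g_0=0$, $\theta_i=a_i+g_i+d_i+s_i$ and $\Delta_i^{(p)}=i^p-\sum_{j=1}^{i-1}j^p b_{j,i}$ for $i\ge2$, $p\ge0$. Suppose that for some $p_0>1$ $$\liminf_{i\to\infty}\frac{a_i}{\theta_i}\,\frac{\Delta_i^{(p_0)}}{i^{p_0}}>0 .$$ Then for every $p>1$ the operator $Y_p$ defined on $X_p$ by $$[Y_pf]_i=-\theta_if_i+g_{i-1}f_{i-1}+d_{i+1}f_{i+1}+\sum_{j=i+1}^\infty a_jb_{i,j}f_j,\quad i\ge1\ (f_0:=0),$$ with domain $D(T_p)=\{f\in X_p:\ (\theta_if_i)_{i\ge1}\in X_p\}$, generates a positive analytic $C_0$-semigroup $\{S_p(t)\}_{t\ge0}$ on $X_p$.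
   Context: For $p\ge0$, $X_p$ is the Banach space of real sequences $f=(f_i)_{i\ge1}$ with $\|f\|_p=\sum_{i\ge1}i^p|f_i|<\infty$. Positivity of the semigroup means it maps nonnegative sequences to nonnegative sequences. *)

(* Defs.v *)
From Stdlib Require Import Reals.
From Coquelicot Require Import Coquelicot.
Open Scope R_scope.

(* Sequences are functions nat -> R; index 0 is a dummy slot forced to 0,
   genuine indices are i >= 1.  Weight i^p is Rpower (INR i) p. *)

Definition inX (p : R) (f : nat -> R) : Prop :=
  f 0%nat = 0 /\ ex_series (fun k => Rpower (INR (S k)) p * Rabs (f (S k))).

Definition normX (p : R) (f : nat -> R) : R :=
  Series (fun k => Rpower (INR (S k)) p * Rabs (f (S k))).

Definition inXC (p : R) (f : nat -> C) : Prop :=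
  f 0%nat = RtoC 0 /\ ex_series (fun k => Rpower (INR (S k)) p * Cmod (f (S k))).

Definition normXC (p : R) (f : nat -> C) : R :=
  Series (fun k => Rpower (INR (S k)) p * Cmod (f (S k))).

Definition is_C0_semigroup (p : R) (T : R -> (nat -> R) -> (nat -> R)) : Prop :=
  (forall t f, 0 <= t -> inX p f -> inX p (T t f)) /\
  (forall t f g c, 0 <= t -> inX p f -> inX p g ->
     T t (fun i => f i + c * g i) = (fun i => T t f i + c * T t g i)) /\
  (forall t, 0 <= t -> exists M, forall f, inX p f -> normX p (T t f) <= M * normX p f) /\
  (forall f, inX p f -> T 0 f = f) /\
  (forall t s f, 0 <= t -> 0 <= s -> inX p f -> T (t + s) f = T t (T s f)) /\
  (forall f, inX p f -> forall eps, 0 < eps -> exists del, 0 < del /\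
     forall t, 0 < t < del -> normX p (fun i => T t f i - f i) < eps).

Definition is_generator (p : R) (T : R -> (nat -> R) -> (nat -> R))
  (A : (nat -> R) -> (nat -> R)) (DA : (nat -> R) -> Prop) : Prop :=
  (forall f, DA f -> inX p f /\ inX p (A f)) /\
  (forall f, inX p f -> forall g, inX p g ->
     ((DA f /\ A f = g) <->
      (forall eps, 0 < eps -> exists del, 0 < del /\
         forall t, 0 < t < del -> normX p (fun i => (T t f i - f i) / t - g i) < eps))).

Definition is_positive_semigroup (p : R) (T : R -> (nat -> R) -> (nat -> R)) : Prop :=
  forall t f, 0 <= t -> inX p f -> (forall i, 0 <= f i) -> forall i, 0 <= T t f i.

(** Open sector {z <> 0 : |arg z| < delta}, 0 < delta < pi/2 *)
Definition sector (delta : R) (z : C) : Prop :=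
  0 < Re z /\ Rabs (Im z) < tan delta * Re z.

(** Analytic semigroup (Pazy, Def. 2.5.1), on the complexification of X_p:
    T extends to a family TC(z) of bounded linear operators, z in a sector
    Sigma_delta together with 0, with TC(0) = I, the semigroup law, TC
    analytic in Sigma_delta (in operator norm), and TC(z) f -> f as
    z -> 0 in Sigma_delta. *)
Definition is_analytic_semigroup (p : R) (T : R -> (nat -> R) -> (nat -> R)) : Prop :=
  exists delta, 0 < delta < PI / 2 /\
  exists TC : C -> (nat -> C) -> (nat -> C),
    (forall z f, (z = RtoC 0 \/ sector delta z) -> inXC p f -> inXC p (TC z f)) /\
    (forall z f g c, (z = RtoC 0 \/ sector delta z) -> inXC p f -> inXC p g ->
       TC z (fun i => Cplus (f i) (Cmult c (g i))) =
       (fun i => Cplus (TC z f i) (Cmult c (TC z g i)))) /\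
    (forall z, (z = RtoC 0 \/ sector delta z) ->
       exists M, forall f, inXC p f -> normXC p (TC z f) <= M * normXC p f) /\
    (forall t f, 0 <= t -> inX p f ->
       TC (RtoC t) (fun i => RtoC (f i)) = (fun i => RtoC (T t f i))) /\
    (forall f, inXC p f -> TC (RtoC 0) f = f) /\
    (forall z1 z2 f, sector delta z1 -> sector delta z2 -> inXC p f ->
       TC (Cplus z1 z2) f = TC z1 (TC z2 f)) /\
    (forall z, sector delta z ->
       exists D : (nat -> C) -> (nat -> C),
         (forall f, inXC p f -> inXC p (D f)) /\
         forall eps, 0 < eps -> exists del, 0 < del /\
           forall h, h <> RtoC 0 -> Cmod h < del -> sector delta (Cplus z h) ->
           forall f, inXC p f ->
             normXC p (fun i => Cminus (Cdiv (Cminus (TC (Cplus z h) f i) (TC z f i)) h)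
                                       (D f i)) <= eps * normXC p f) /\
    (forall f, inXC p f -> forall eps, 0 < eps -> exists del, 0 < del /\
       forall z, sector delta z -> Cmod z < del ->
         normXC p (fun i => Cminus (TC z f i) (f i)) < eps).

Definition theta (a g d s : nat -> R) (i : nat) : R := a i + g i + d i + s i.

Definition Deltap (b : nat -> nat -> R) (p : R) (i : nat) : R :=
  Rpower (INR i) p - sum_f 1 (i - 1) (fun j => Rpower (INR j) p * b j i).

(* [Y f]_i for i >= 1 (f_0 = 0 as f is in X_p; the dummy slot 0 is set to 0) *)
Definition Yop (a g d s : nat -> R) (b : nat -> nat -> R) (f : nat -> R) : nat -> R :=
  fun i => match i with
  | O => 0
  | S _ => - theta a g d s i * f i + g (i - 1)%nat * f (i - 1)%nat
           + d (S i) * f (S i)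
           + Series (fun k => a (S i + k)%nat * b i (S i + k)%nat * f (S i + k)%nat)
  end.

Definition DomY (p : R) (a g d s : nat -> R) (f : nat -> R) : Prop :=
  inX p f /\ inX p (fun i => theta a g d s i * f i).

(* Main.v *)
Require Import Defs.
From Stdlib Require Import Reals Lra Lia ClassicalEpsilon FunctionalExtensionality ProofIrrelevance.
From Coquelicot Require Import Coquelicot.
Open Scope R_scope.

(** Write [A = - Theta + B] with [Theta] the diagonal part.  Mass conservation shows that
    [Delta_i^(p) / i^p] is an average of [1 - r^(p-1)] over the relative fragment sizes [r], and
    these functions of [r] are comparable for all [p > 1]; so the hypothesis for [p0] holds for
    every [p > 1].  It says that the weighted column sums of [B] are at most
    [(gamma theta_i + K) i^p] with [gamma < 1].

    On a weighted l^1 space this gives, for [h] in a small enough sector,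
    [(1 - K' |h|) |f| + c |h| |A f| <= |f - h A f|], and a Neumann series inverts [I - h A].  With
    [J_h] the inverse, the Euler products [J_(z/n)^n] converge along [n = 2^k], with no contour
    integrals: finite sequences form an [A]-invariant dense set, on which all comparisons
    telescope.  The semigroup law holds in the whole sector since [J_(a+b)] and [J_a J_b] differ by
    [O((|a| + |b|)^2)] there.

    Analyticity comes from the second term on the left of the inequality: along [u_k = J_h^k u] it
    telescopes to [sum_k |h| |A u_k| <= C |u|], while [|A u_k|] is essentially decreasing,
    whence [|z| |A T(z)| <= C]. *)

(** * Weighted spaces of complex sequences *)

(** Origin of [gamma < 1]: in column [i] of [B], growth sends mass to the weight [(i+1)^p], death to
    a smaller weight, and fragmentation contributes [a_i (i^p - Delta_i)]. The ratio of neighbouring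
    weights tends to 1, so the surplus caused by growth is at most a small multiple of [theta_i i^p]
    for large [i], while the deficit [a_i Delta_i] is at least a fixed multiple of it. The finitely
    many remaining columns go into [K].

    Origin of the sector: [|1 + h theta| >= 1 + Re h theta], and [|h| <= (1 + tau) Re h] when
    [|Im h| <= tau Re h]. So the diagonal beats the part [gamma |h| theta] of the perturbation as
    soon as [gamma (1 + tau) < 1], and what is left over pays for the term [c |h| |A f|].

    All comparisons of Euler products are of second order and are measured by [|A^2 u|]. Analyticity
    is a statement about complex sequences, so the whole construction is complex; positivity then
    shows that the semigroup maps real sequences to real ones. *)

Lemma nonneg_series_bounded (u : nat -> R) (M : R) :
  (forall n, 0 <= u n) -> (forall n, sum_n u n <= M) ->
  ex_series u /\ Series u <= M.
Proof.
  intros hu hM.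
  assert (h : ex_finite_lim_seq (sum_n u)).
  { apply ex_finite_lim_seq_incr with M; auto.
    intros n; rewrite sum_Sn; unfold plus; simpl; specialize (hu (S n)); lra. }
  assert (hs : ex_series u) by (destruct h as [l hl]; exists l; exact hl).
  split; auto.
  assert (h1 := Series_correct _ hs).
  change (Rbar_le (Series u) M).
  apply is_lim_seq_le with (sum_n u) (fun _ => M); auto.
  apply is_lim_seq_const.
Qed.

Lemma sum_n_le_Series (u : nat -> R) (n : nat) :
  (forall n, 0 <= u n) -> ex_series u -> sum_n u n <= Series u.
Proof.
  intros hu hs.
  apply (is_lim_seq_incr_compare (sum_n u) (Series u)).
  - apply Series_correct, hs.
  - intros k; rewrite sum_Sn; unfold plus; simpl; specialize (hu (S k)); lra.
Qed.

Lemma sum_n_R_le (u v : nat -> R) (n : nat) :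
  (forall k, (k <= n)%nat -> u k <= v k) -> sum_n u n <= sum_n v n.
Proof.
  induction n as [|n IH]; intros h.
  - rewrite !sum_O; auto.
  - rewrite !sum_Sn; unfold plus; simpl; apply Rplus_le_compat; auto.
Qed.

Lemma term_le_sum_n (u : nat -> R) (n k : nat) :
  (forall n, 0 <= u n) -> (k <= n)%nat -> u k <= sum_n u n.
Proof.
  intros hu; induction n as [|n IH]; intros hk.
  - replace k with 0%nat by lia; rewrite sum_O; lra.
  - rewrite sum_Sn; unfold plus; simpl.
    destruct (Nat.eq_dec k (S n)) as [->|hne].
    + assert (0 <= sum_n u n); [|lra].
      { clear IH hk; induction n; [rewrite sum_O|rewrite sum_Sn; unfold plus; simpl]; auto.
        specialize (hu (S n)); lra. }
    + specialize (IH ltac:(lia)); specialize (hu (S n)); lra.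
Qed.

Lemma sum_n_mono (u : nat -> R) (n m : nat) :
  (forall n, 0 <= u n) -> (n <= m)%nat -> sum_n u n <= sum_n u m.
Proof.
  intros hu h; induction h as [|m h IH]; [lra|].
  rewrite sum_Sn; unfold plus; simpl; specialize (hu (S m)); lra.
Qed.

Lemma term_le_Series (u : nat -> R) (k : nat) :
  (forall n, 0 <= u n) -> ex_series u -> u k <= Series u.
Proof.
  intros hu hs; apply Rle_trans with (sum_n u k).
  - apply term_le_sum_n; auto.
  - apply sum_n_le_Series; auto.
Qed.

Lemma ex_series_le_nonneg (u v : nat -> R) :
  (forall n, 0 <= u n <= v n) -> ex_series v -> ex_series u.
Proof.
  intros h hv; apply @ex_series_le with v; auto.
  intros n; unfold norm; simpl; unfold abs; simpl.
  rewrite Rabs_pos_eq; apply h.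
Qed.

Lemma Series_nonneg (u : nat -> R) :
  (forall n, 0 <= u n) -> ex_series u -> 0 <= Series u.
Proof. intros hu hs; apply Rle_trans with (u 0%nat); auto using term_le_Series. Qed.

Lemma is_lim_seq_sum_n (u : nat -> nat -> R) (l : nat -> R) (n : nat) :
  (forall k, is_lim_seq (fun m => u m k) (l k)) ->
  is_lim_seq (fun m => sum_n (u m) n) (sum_n l n).
Proof.
  intros h; induction n as [|n IH].
  - rewrite sum_O; apply is_lim_seq_ext with (fun m => u m 0%nat); auto.
    intros m; rewrite sum_O; auto.
  - rewrite sum_Sn.
    apply is_lim_seq_ext with (fun m => sum_n (u m) n + u m (S n)).
    + intros m; rewrite sum_Sn; auto.
    + apply (is_lim_seq_plus' _ _ _ _ IH (h (S n))).
Qed.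

Lemma Cmod_le_abs (z : C) : Cmod z <= Rabs (Re z) + Rabs (Im z).
Proof.
  replace z with (RtoC (Re z) + RtoC (Im z) * Ci)%C at 1.
  - eapply Rle_trans; [apply Cmod_triangle|].
    rewrite Cmod_mult, Cmod_Ci, !Cmod_R; lra.
  - destruct z as [x y]; unfold Re, Im, RtoC, Ci, Cplus, Cmult; simpl; f_equal; ring.
Qed.

Lemma im_le_Cmod (z : C) : Rabs (Im z) <= Cmod z.
Proof. exact (Rle_trans _ _ _ (Rmax_r _ _) (Rmax_Cmod z)). Qed.

Lemma is_lim_seq_Cmod (u : nat -> C) (l : C) :
  is_lim_seq (fun n => Re (u n)) (Re l) -> is_lim_seq (fun n => Im (u n)) (Im l) ->
  is_lim_seq (fun n => Cmod (u n)) (Cmod l).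
Proof.
  intros h1 h2.
  assert (hE : forall z, Cmod z = sqrt (Re z * Re z + Im z * Im z)).
  { intros z; unfold Cmod, Re, Im; f_equal; ring. }
  rewrite hE.
  apply is_lim_seq_ext with (fun n => sqrt (Re (u n) * Re (u n) + Im (u n) * Im (u n))).
  { intros n; rewrite hE; auto. }
  apply (is_lim_seq_continuous sqrt).
  - apply continuity_pt_sqrt; nra.
  - apply is_lim_seq_plus'; apply is_lim_seq_mult'; auto.
Qed.

Lemma Cauchy_R_limit (u : nat -> R) :
  (forall eps, 0 < eps -> exists N, forall n m, (N <= n)%nat -> (N <= m)%nat ->
     Rabs (u n - u m) < eps) ->
  exists l, is_lim_seq u (Finite l).
Proof.
  intros h.
  destruct (Rcomplete.R_complete u) as [l hl].
  - intros eps heps; destruct (h eps heps) as [N hN]; exists N; intros n m hn hm.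
    apply hN; lia.
  - exists l; apply is_lim_seq_Reals; exact hl.
Qed.

Section WeightedSpace.

Variable p : R.

Definition wgt (k : nat) : R := Rpower (INR (S k)) p.

Lemma wgt_pos k : 0 < wgt k.
Proof. apply exp_pos. Qed.

(** A subtype, so that operators on the space are total functions and, by proof irrelevance, vector
    identities are Leibniz equalities that [ring] settles coordinatewise. *)
Definition cvec : Type := {f : nat -> C | inXC p f}.

Definition cval (x : cvec) : nat -> C := proj1_sig x.
Coercion cval : cvec >-> Funclass.

Definition nrm (x : cvec) : R := normXC p x.

Lemma cvec_ext (x y : cvec) : (forall i, x i = y i) -> x = y.
Proof.
  destruct x as [f hf], y as [g hg]; simpl; intros h.
  assert (f = g) by (apply functional_extensionality; exact h); subst g.
  f_equal; apply proof_irrelevance.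
Qed.

Lemma cval_inX (x : cvec) : inXC p x.
Proof. apply (proj2_sig x). Qed.

Lemma cval0 (x : cvec) : x 0%nat = RtoC 0.
Proof. apply (proj2_sig x). Qed.

Lemma cval_series (x : cvec) : ex_series (fun k => wgt k * Cmod (x (S k))).
Proof. apply (proj2_sig x). Qed.

Lemma wgt_Cmod_ge0 (f : nat -> C) k : 0 <= wgt k * Cmod (f (S k)).
Proof. apply Rmult_le_pos; [apply Rlt_le, wgt_pos|apply Cmod_ge_0]. Qed.

Lemma nrm_ge0 x : 0 <= nrm x.
Proof. apply Series_nonneg; [apply wgt_Cmod_ge0 | apply cval_series]. Qed.

Lemma inXC_bounded (f : nat -> C) (M : R) :
  f 0%nat = RtoC 0 -> (forall n, sum_n (fun k => wgt k * Cmod (f (S k))) n <= M) ->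
  inXC p f /\ normXC p f <= M.
Proof.
  intros h0 h.
  destruct (nonneg_series_bounded _ M (wgt_Cmod_ge0 f) h) as [h1 h2].
  split; [split|]; auto.
Qed.

Lemma inXC_dominated (f : nat -> C) (u : nat -> R) :
  f 0%nat = RtoC 0 -> (forall k, wgt k * Cmod (f (S k)) <= u k) -> ex_series u ->
  inXC p f /\ normXC p f <= Series u.
Proof.
  intros h0 h hu.
  assert (hd : forall k, 0 <= wgt k * Cmod (f (S k)) <= u k)
    by (intros k; split; [apply wgt_Cmod_ge0|auto]).
  split; [split; auto; apply ex_series_le_nonneg with u; auto|].
  apply Series_le; auto.
Qed.

Lemma inXC_zero : inXC p (fun _ => RtoC 0).
Proof.
  apply (inXC_dominated _ (fun _ => 0)); auto.
  - intros k; rewrite Cmod_0; lra.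
  - apply (nonneg_series_bounded _ 0); intros n; [lra|rewrite sum_n_const; lra].
Qed.

Lemma cplus_dominated (x y : cvec) (k : nat) :
  wgt k * Cmod (x (S k) + y (S k))%C <= wgt k * Cmod (x (S k)) + wgt k * Cmod (y (S k)).
Proof.
  rewrite <- Rmult_plus_distr_l; apply Rmult_le_compat_l; [apply Rlt_le, wgt_pos|].
  apply Cmod_triangle.
Qed.

Lemma cplus_series (x y : cvec) :
  ex_series (fun k => wgt k * Cmod (x (S k)) + wgt k * Cmod (y (S k))).
Proof. apply (ex_series_plus (V := R_NormedModule)); apply cval_series. Qed.

Lemma cplus_inXC (x y : cvec) :
  inXC p (fun i => x i + y i)%C /\ normXC p (fun i => x i + y i)%C <= nrm x + nrm y.
Proof.
  unfold nrm, normXC; rewrite <- Series_plus by apply cval_series.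
  apply inXC_dominated.
  - rewrite !cval0; ring.
  - intros k; apply cplus_dominated.
  - apply cplus_series.
Qed.

Lemma cscal_inXC (c : C) (x : cvec) :
  inXC p (fun i => c * x i)%C /\ normXC p (fun i => c * x i)%C = Cmod c * nrm x.
Proof.
  split.
  - apply (inXC_dominated _ (fun k => Cmod c * (wgt k * Cmod (x (S k))))).
    + rewrite cval0; ring.
    + intros k; rewrite Cmod_mult; lra.
    + apply (ex_series_scal_l (V := R_NormedModule)), cval_series.
  - unfold nrm, normXC; rewrite <- Series_scal_l; apply Series_ext; intros k.
    rewrite Cmod_mult; ring.
Qed.

Definition czero : cvec := exist _ _ inXC_zero.
Definition cadd (x y : cvec) : cvec := exist _ _ (proj1 (cplus_inXC x y)).
Definition cscal (c : C) (x : cvec) : cvec := exist _ _ (proj1 (cscal_inXC c x)).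
(** Built from [cadd] and [cscal], so that every law of the form [x + c * y] specialises to
    differences by conversion. *)
Definition csub (x y : cvec) : cvec := cadd x (cscal (- RtoC 1)%C y).

Lemma cadd_val x y i : cadd x y i = (x i + y i)%C.
Proof. reflexivity. Qed.

Lemma cscal_val c x i : cscal c x i = (c * x i)%C.
Proof. reflexivity. Qed.

Lemma csub_val x y i : csub x y i = (x i - y i)%C.
Proof. unfold csub; rewrite cadd_val, cscal_val; ring. Qed.

Lemma czero_val i : czero i = RtoC 0.
Proof. reflexivity. Qed.

Lemma nrm_cadd x y : nrm (cadd x y) <= nrm x + nrm y.
Proof. apply (proj2 (cplus_inXC x y)). Qed.

Lemma nrm_cscal c x : nrm (cscal c x) = Cmod c * nrm x.
Proof. apply (proj2 (cscal_inXC c x)). Qed.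

Lemma nrm_csub x y : nrm (csub x y) <= nrm x + nrm y.
Proof.
  unfold csub; eapply Rle_trans; [apply nrm_cadd|].
  rewrite nrm_cscal, Cmod_m1; lra.
Qed.

Lemma nrm_czero : nrm czero = 0.
Proof.
  replace czero with (cscal (RtoC 0) czero).
  - rewrite nrm_cscal, Cmod_0; ring.
  - apply cvec_ext; intros i; rewrite cscal_val, czero_val; ring.
Qed.

Lemma sum_n_le_nrm (x : cvec) (n : nat) :
  sum_n (fun k => wgt k * Cmod (x (S k))) n <= nrm x.
Proof.
  apply (sum_n_le_Series (fun k => wgt k * Cmod (x (S k))));
    [apply wgt_Cmod_ge0 | apply cval_series].
Qed.

Lemma coord_le_nrm (x : cvec) (k : nat) : wgt k * Cmod (x (S k)) <= nrm x.
Proof.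
  apply (term_le_Series (fun k => wgt k * Cmod (x (S k))));
    [apply wgt_Cmod_ge0 | apply cval_series].
Qed.

Lemma nrm_eq0 x : nrm x <= 0 -> x = czero.
Proof.
  intros h; apply cvec_ext; intros [|k].
  - rewrite !cval0; auto.
  - rewrite czero_val; apply Cmod_eq_0.
    assert (h1 := coord_le_nrm x k); assert (h2 := wgt_pos k).
    assert (h3 := Cmod_ge_0 (x (S k))); nra.
Qed.

End WeightedSpace.

Arguments cval {p}.
Arguments nrm {p}.
Arguments cadd {p}.
Arguments csub {p}.
Arguments cscal {p}.
Arguments czero {p}.

Declare Scope cvec_scope.
Delimit Scope cvec_scope with V.
Notation "x + y" := (cadd x y) : cvec_scope.
Notation "x - y" := (csub x y) : cvec_scope.
Notation "c * x" := (cscal c x) : cvec_scope.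
Notation "0" := czero : cvec_scope.

Ltac cvec_ring :=
  apply cvec_ext; intros ?;
  repeat progress rewrite ?cadd_val, ?csub_val, ?cscal_val, ?czero_val;
  ring.

Lemma csub_eq0 {p} (x y : cvec p) : nrm (x - y)%V <= 0 -> x = y.
Proof.
  intros h; apply nrm_eq0 in h.
  replace x with ((x - y) + y)%V by cvec_ring.
  rewrite h; cvec_ring.
Qed.

Lemma nrm_triangle_sub {p} (x y z : cvec p) : nrm (x - z)%V <= nrm (x - y)%V + nrm (y - z)%V.
Proof.
  replace (x - z)%V with ((x - y) + (y - z))%V by cvec_ring; apply nrm_cadd.
Qed.

Lemma nrm_csub_sym {p} (x y : cvec p) : nrm (x - y)%V = nrm (y - x)%V.
Proof.
  replace (x - y)%V with ((- RtoC 1)%C * (y - x))%V by cvec_ring.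
  rewrite nrm_cscal, Cmod_m1; lra.
Qed.

Definition tends {p} (u : nat -> cvec p) (l : cvec p) : Prop :=
  forall eps, 0 < eps -> exists N, forall n, (N <= n)%nat -> nrm (u n - l)%V < eps.

(** Coordinates converge because each is bounded by the norm over its weight; convergence in norm is
    then a Fatou argument. *)
Lemma cvec_complete {p} (u : nat -> cvec p) :
  (forall eps, 0 < eps -> exists N, forall n m, (N <= n)%nat -> (N <= m)%nat ->
     nrm (u n - u m)%V < eps) ->
  exists l, tends u l.
Proof.
  intros hC.
  assert (hcoord : forall i, exists l : C,
    is_lim_seq (fun n => Re (u n i)) (Re l) /\ is_lim_seq (fun n => Im (u n i)) (Im l)).
  { intros [|k].
    - exists (RtoC 0); split;
      (eapply is_lim_seq_ext; [intros n; rewrite cval0; reflexivity|apply is_lim_seq_const]).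
    - assert (hb : forall eps, 0 < eps -> exists N, forall n m, (N <= n)%nat -> (N <= m)%nat ->
        Cmod (u n (S k) - u m (S k))%C < eps).
      { intros eps heps.
        destruct (hC (wgt p k * eps)) as [N hN].
        { apply Rmult_lt_0_compat; auto; apply wgt_pos. }
        exists N; intros n m hn hm; specialize (hN n m hn hm).
        assert (h1 := coord_le_nrm p (u n - u m)%V k); rewrite csub_val in h1.
        apply Rmult_lt_reg_l with (wgt p k); [apply wgt_pos|lra]. }
      destruct (Cauchy_R_limit (fun n => Re (u n (S k)))) as [a ha].
      { intros eps heps; destruct (hb eps heps) as [N hN]; exists N; intros n m hn hm.
        eapply Rle_lt_trans; [|apply (hN n m hn hm)].
        eapply Rle_trans; [|apply re_le_Cmod].
        right; f_equal. }
      destruct (Cauchy_R_limit (fun n => Im (u n (S k)))) as [b hb'].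
      { intros eps heps; destruct (hb eps heps) as [N hN]; exists N; intros n m hn hm.
        eapply Rle_lt_trans; [|apply (hN n m hn hm)].
        eapply Rle_trans; [|apply im_le_Cmod].
        right; f_equal. }
      exists (a, b); auto. }
  pose (l := fun i => proj1_sig (constructive_indefinite_description _ (hcoord i))).
  assert (hl : forall i, is_lim_seq (fun n => Re (u n i)) (Re (l i)) /\
                         is_lim_seq (fun n => Im (u n i)) (Im (l i)))
    by (intros i; apply (proj2_sig (constructive_indefinite_description _ (hcoord i)))).
  clearbody l; clear hcoord.
  assert (hl0 : l 0%nat = RtoC 0).
  { destruct (hl 0%nat) as [h1 h2].
    assert (e1 : is_lim_seq (fun _ : nat => 0) (Re (l 0%nat)))
      by (eapply is_lim_seq_ext; [|exact h1]; intros n; simpl; rewrite cval0; auto).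
    assert (e2 : is_lim_seq (fun _ : nat => 0) (Im (l 0%nat)))
      by (eapply is_lim_seq_ext; [|exact h2]; intros n; simpl; rewrite cval0; auto).
    apply is_lim_seq_unique in e1, e2; rewrite Lim_seq_const in e1, e2.
    injection e1; injection e2; intros e3 e4.
    destruct (l 0%nat) as [x y]; simpl in *; unfold RtoC; f_equal; auto. }
  (* Fatou: a partial sum involves finitely many coordinates, so a bound uniform in [m] survives the
     limit in [m]. *)
  assert (hF : forall N eps n, (forall m, (N <= m)%nat -> nrm (u n - u m)%V <= eps) ->
    forall K, sum_n (fun k => wgt p k * Cmod (u n (S k) - l (S k))%C) K <= eps).
  { intros N eps n h K.
    change (Rbar_le (sum_n (fun k => wgt p k * Cmod (u n (S k) - l (S k))%C) K) eps).
    apply (is_lim_seq_le_loc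
      (fun m => sum_n (fun k => wgt p k * Cmod (u n (S k) - u m (S k))%C) K) (fun _ => eps)).
    - exists N; intros m hm.
      eapply Rle_trans; [|apply (h m hm)].
      eapply Rle_trans; [|apply (sum_n_le_nrm p (u n - u m)%V K)].
      apply sum_n_R_le; intros k _; rewrite csub_val; lra.
    - apply (is_lim_seq_sum_n (fun m k => wgt p k * Cmod (u n (S k) - u m (S k))%C)
        (fun k => wgt p k * Cmod (u n (S k) - l (S k))%C)).
      intros k.
      apply (is_lim_seq_scal_l _ (wgt p k) (Finite _)).
      apply (is_lim_seq_Cmod (fun m => (u n (S k) - u m (S k))%C)).
      + apply (is_lim_seq_minus' (fun _ => Re (u n (S k)))); [apply is_lim_seq_const|apply hl].
      + apply (is_lim_seq_minus' (fun _ => Im (u n (S k)))); [apply is_lim_seq_const|apply hl].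
    - apply is_lim_seq_const. }
  (* The coordinatewise limit lies in the space because its difference from one fixed [u N0]
     does. *)
  destruct (hC 1 Rlt_0_1) as [N0 hN0].
  assert (hd : inXC p (fun i => u N0 i - l i)%C).
  { apply (inXC_bounded p _ 1).
    - rewrite hl0, cval0; ring.
    - apply (hF N0 1 N0); intros m hm; apply Rlt_le, hN0; auto. }
  set (d := exist _ _ hd : cvec p).
  exists (u N0 - d)%V.
  assert (hval : forall i, (u N0 - d)%V i = l i).
  { intros i; rewrite csub_val; unfold d; simpl; ring. }
  intros eps heps; destruct (hC (eps / 2)) as [N hN]; [lra|].
  exists N; intros n hn.
  apply Rle_lt_trans with (eps / 2); [|lra].
  apply (inXC_bounded p (u n - (u N0 - d))%V (eps / 2)).
  - apply cval0.
  - intros K.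
    eapply Rle_trans; [|apply (hF N (eps / 2) n)].
    + apply sum_n_R_le; intros k _; rewrite csub_val, hval; lra.
    + intros m hm; apply Rlt_le, hN; auto.
Qed.

(** * Limits and bounded operators *)

Section Limits.

Context {p : R}.
Implicit Types (u : nat -> cvec p) (l x y : cvec p).

Lemma tends_unique u l l' : tends u l -> tends u l' -> l = l'.
Proof.
  intros h h'; apply csub_eq0, Rnot_lt_le; intros hlt.
  destruct (h (nrm (l - l')%V / 2)) as [N hN]; [lra|].
  destruct (h' (nrm (l - l')%V / 2)) as [N' hN']; [lra|].
  specialize (hN (N + N')%nat ltac:(lia)); specialize (hN' (N + N')%nat ltac:(lia)).
  assert (h1 := nrm_triangle_sub l (u (N + N')%nat) l').
  rewrite (nrm_csub_sym l (u (N + N')%nat)) in h1; lra.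
Qed.

Lemma tends_dist_le u l y B :
  tends u l -> (exists N, forall n, (N <= n)%nat -> nrm (u n - y)%V <= B) -> nrm (l - y)%V <= B.
Proof.
  intros h [N' hN']; apply Rnot_lt_le; intros hlt.
  destruct (h (nrm (l - y)%V - B)) as [N hN]; [lra|].
  specialize (hN (N + N')%nat ltac:(lia)); specialize (hN' (N + N')%nat ltac:(lia)).
  assert (h1 := nrm_triangle_sub l (u (N + N')%nat) y).
  rewrite (nrm_csub_sym l (u (N + N')%nat)) in h1; lra.
Qed.

Lemma csub0 x : (x - 0)%V = x.
Proof. cvec_ring. Qed.

Lemma tends_nrm_le u l B :
  tends u l -> (exists N, forall n, (N <= n)%nat -> nrm (u n) <= B) -> nrm l <= B.
Proof.
  intros h [N hN]; rewrite <- (csub0 l); apply (tends_dist_le u); auto.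
  exists N; intros n hn; rewrite csub0; auto.
Qed.

Lemma tends_near u u' l :
  tends u l ->
  (forall eps, 0 < eps -> exists N, forall n, (N <= n)%nat -> nrm (u' n - u n)%V < eps) ->
  tends u' l.
Proof.
  intros h h' eps heps.
  destruct (h (eps / 2)) as [N hN]; [lra|].
  destruct (h' (eps / 2)) as [N' hN']; [lra|].
  exists (N + N')%nat; intros n hn.
  specialize (hN n ltac:(lia)); specialize (hN' n ltac:(lia)).
  assert (h1 := nrm_triangle_sub (u' n) (u n) l); lra.
Qed.

Lemma tends_const l : tends (fun _ => l) l.
Proof.
  intros eps heps; exists 0%nat; intros _ _.
  replace (l - l)%V with (0%V : cvec p) by cvec_ring; rewrite nrm_czero; auto.
Qed.

(** The Lipschitz constant does not depend on [n], so the argument may move together with the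
    operator; this is what composes two Euler limits. *)
Lemma tends_lipschitz (P : nat -> cvec p -> cvec p) (m : R) u l y :
  (exists N, forall n, (N <= n)%nat -> forall x x', nrm (P n x - P n x')%V <= m * nrm (x - x')%V) ->
  tends u l -> tends (fun n => P n l) y -> tends (fun n => P n (u n)) y.
Proof.
  intros [N0 hP] hu hy; apply tends_near with (fun n => P n l); auto.
  intros eps heps.
  (* [Rabs m + 1] is positive whatever the sign of [m]. *)
  destruct (hu (eps / (Rabs m + 1))) as [N hN].
  { assert (h := Rabs_pos m); apply Rdiv_lt_0_compat; lra. }
  exists (N0 + N)%nat; intros n hn.
  eapply Rle_lt_trans; [apply hP; lia|].
  specialize (hN n ltac:(lia)).
  assert (h := Rabs_pos m); assert (h1 := Rle_abs m).
  assert (h0 := nrm_ge0 p (u n - l)%V).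
  apply Rle_lt_trans with ((Rabs m + 1) * nrm (u n - l)%V); [nra|].
  apply Rlt_le_trans with ((Rabs m + 1) * (eps / (Rabs m + 1))).
  - apply Rmult_lt_compat_l; lra.
  - right; field; lra.
Qed.

Lemma tends_lin u u' l l' (c : C) :
  tends u l -> tends u' l' -> tends (fun n => u n + c * u' n)%V (l + c * l')%V.
Proof.
  intros h h' eps heps.
  assert (hc := Cmod_ge_0 c).
  destruct (h (eps / 2)) as [N hN]; [lra|].
  destruct (h' (eps / 2 / (Cmod c + 1))) as [N' hN']; [apply Rdiv_lt_0_compat; lra|].
  exists (N + N')%nat; intros n hn.
  specialize (hN n ltac:(lia)); specialize (hN' n ltac:(lia)).
  replace ((u n + c * u' n) - (l + c * l'))%V with ((u n - l) + c * (u' n - l'))%V by cvec_ring.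
  eapply Rle_lt_trans; [apply nrm_cadd|]; rewrite nrm_cscal.
  assert (h0 := nrm_ge0 p (u' n - l')%V).
  assert (Cmod c * nrm (u' n - l')%V <= (Cmod c + 1) * (eps / 2 / (Cmod c + 1))).
  { apply Rmult_le_compat; lra. }
  replace ((Cmod c + 1) * (eps / 2 / (Cmod c + 1))) with (eps / 2) in H by (field; lra).
  lra.
Qed.

Lemma cvec_geometric_limit u (B q : R) (k0 : nat) :
  0 <= B -> 0 <= q < 1 ->
  (forall k, (k0 <= k)%nat -> nrm (u (S k) - u k)%V <= B * q ^ k) -> exists l, tends u l.
Proof.
  intros hB hq h.
  set (D := B / (1 - q)).
  assert (hD : 0 <= D) by (apply Rle_div_r; lra).
  assert (eD : B = D * (1 - q)) by (unfold D; field; lra).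
  (* The factor [1 - q ^ m] makes the induction on [m] close exactly; it is dropped afterwards. *)
  assert (hk : forall k m, (k0 <= k)%nat -> nrm (u (k + m)%nat - u k)%V <= D * q ^ k * (1 - q ^ m)).
  { intros k m hk; induction m as [|m IH].
    - rewrite Nat.add_0_r; replace (u k - u k)%V with (0%V : cvec p) by cvec_ring.
      rewrite nrm_czero; simpl; lra.
    - eapply Rle_trans; [apply (nrm_triangle_sub _ (u (k + m)%nat))|].
      rewrite Nat.add_succ_r.
      specialize (h (k + m)%nat ltac:(lia)).
      rewrite pow_add, eD in h; simpl; lra. }
  apply cvec_complete; intros eps heps.
  destruct (pow_lt_1_zero q ltac:(rewrite Rabs_pos_eq; lra) (eps / (2 * (D + 1)))) as [N hN].
  { apply Rdiv_lt_0_compat; lra. }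
  assert (hs : forall n, (N + k0 <= n)%nat -> nrm (u n - u (N + k0)%nat)%V < eps / 2).
  { intros n hn.
    replace n with ((N + k0) + (n - (N + k0)))%nat by lia.
    eapply Rle_lt_trans; [apply hk; lia|].
    specialize (hN (N + k0)%nat ltac:(lia)).
    assert (h1 : 0 <= q ^ (N + k0)) by (apply pow_le; lra).
    assert (h2 : 0 <= q ^ (n - (N + k0))) by (apply pow_le; lra).
    rewrite Rabs_pos_eq in hN by lra.
    assert (h3 : 0 <= D * q ^ (N + k0)) by (apply Rmult_le_pos; lra).
    apply Rle_lt_trans with (D * q ^ (N + k0)); [nra|].
    apply Rle_lt_trans with ((D + 1) * q ^ (N + k0)); [lra|].
    apply Rlt_le_trans with ((D + 1) * (eps / (2 * (D + 1)))).
    - apply Rmult_lt_compat_l; lra.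
    - right; field; lra. }
  exists (N + k0)%nat; intros n m hn hm.
  eapply Rle_lt_trans; [apply (nrm_triangle_sub _ (u (N + k0)%nat))|].
  rewrite (nrm_csub_sym (u (N + k0)%nat) (u m)).
  assert (h1 := hs n hn); assert (h2 := hs m hm); lra.
Qed.

(** Banach's fixed point theorem started at zero, that is, the Neumann series. The iteration is part
    of the conclusion because positivity will be passed along the iterates. *)
Lemma affine_fixpoint (N : cvec p -> cvec p) (q : R) y :
  (forall x x', nrm (N x - N x')%V <= q * nrm (x - x')%V) -> 0 <= q < 1 ->
  exists x, tends (fun n => Nat.iter n (fun z => y + N z)%V 0%V) x /\ x = (y + N x)%V.
Proof.
  intros hN hq.
  set (F := fun z => (y + N z)%V).
  assert (hF : forall x x', nrm (F x - F x')%V <= q * nrm (x - x')%V).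
  { intros x x'; unfold F; replace (y + N x - (y + N x'))%V with (N x - N x')%V by cvec_ring; auto. }
  destruct (cvec_geometric_limit (fun n => Nat.iter n F 0%V) (nrm (F 0%V - 0)%V) q 0) as [x hx];
    auto using nrm_ge0.
  { intros k _; induction k as [|k IH]; [rewrite pow_O, Rmult_1_r; apply Rle_refl|].
    eapply Rle_trans; [apply hF|].
    replace (nrm (F 0%V - 0)%V * q ^ S k) with (q * (nrm (F 0%V - 0)%V * q ^ k)) by (simpl; ring).
    apply Rmult_le_compat_l; [lra|exact IH]. }
  exists x; split; auto.
  apply (tends_unique (fun n => F (Nat.iter n F 0%V))).
  - intros eps heps; destruct (hx eps heps) as [M hM]; exists M; intros n hn.
    apply (hM (S n)); lia.
  - apply (tends_lipschitz (fun _ => F) q _ x); auto using tends_const.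
    exists 0%nat; auto.
Qed.

End Limits.

Lemma exp_mult_INR (x : R) (n : nat) : exp x ^ n = exp (INR n * x).
Proof.
  induction n as [|n IH]; [simpl; rewrite Rmult_0_l, exp_0; auto|].
  rewrite S_INR; simpl pow; rewrite IH, <- exp_plus; f_equal; ring.
Qed.

Lemma exp_ge_1 (x : R) : 0 <= x -> 1 <= exp x.
Proof. intros h; assert (h1 := exp_ineq1_le x); lra. Qed.

Lemma exp_mono (x y : R) : x <= y -> exp x <= exp y.
Proof.
  intros [h| ->]; [apply Rlt_le, exp_increasing; auto|lra].
Qed.

Section Operators.

Context {p : R}.
Implicit Types (P Q : cvec p -> cvec p) (x y u : cvec p).

Definition bounded_linear P (m : R) : Prop :=
  (forall x y (c : C), P (x + c * y)%V = (P x + c * P y)%V) /\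
  (forall x, nrm (P x) <= m * nrm x).

Lemma bl_sub P m x y : bounded_linear P m -> P (x - y)%V = (P x - P y)%V.
Proof. intros h; apply (proj1 h). Qed.

Lemma bl_zero P m : bounded_linear P m -> P 0%V = 0%V.
Proof.
  intros h; replace (0%V : cvec p) with (0 - 0 : cvec p)%V by cvec_ring.
  rewrite (bl_sub P m) by auto; cvec_ring.
Qed.

Lemma bl_add P m x y : bounded_linear P m -> P (x + y)%V = (P x + P y)%V.
Proof.
  intros h; replace (x + y)%V with (x + RtoC 1 * y)%V by cvec_ring.
  rewrite (proj1 h); cvec_ring.
Qed.

Lemma bl_scal P m (c : C) x : bounded_linear P m -> P (c * x)%V = (c * P x)%V.
Proof.
  intros h; replace (c * x)%V with (0 + c * x)%V by cvec_ring.
  rewrite (proj1 h), (bl_zero P m) by auto; cvec_ring.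
Qed.

Lemma bl_lipschitz P m x y : bounded_linear P m -> nrm (P x - P y)%V <= m * nrm (x - y)%V.
Proof. intros h; rewrite <- (bl_sub P m) by auto; apply h. Qed.

Lemma bl_id : bounded_linear (fun x => x) 1.
Proof. split; auto; intros x; lra. Qed.

Lemma bl_comp P Q m m' :
  0 <= m -> bounded_linear P m -> bounded_linear Q m' -> bounded_linear (fun x => P (Q x)) (m * m').
Proof.
  intros hm [h1 h2] [h3 h4]; split.
  - intros; rewrite h3, h1; auto.
  - intros x; eapply Rle_trans; [apply h2|].
    rewrite Rmult_assoc; apply Rmult_le_compat_l; auto.
Qed.

Lemma bl_weaken P m m' : m <= m' -> bounded_linear P m -> bounded_linear P m'.
Proof.
  intros hm [h1 h2]; split; auto; intros x; eapply Rle_trans; [apply h2|].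
  apply Rmult_le_compat_r; auto; apply nrm_ge0.
Qed.

Lemma bl_iter P m n : 0 <= m -> bounded_linear P m -> bounded_linear (Nat.iter n P) (m ^ n).
Proof.
  intros hm h; induction n as [|n IH]; [apply bl_id|].
  apply (bl_comp P (Nat.iter n P)); auto.
Qed.

Lemma iter_commute P Q n : (forall x, P (Q x) = Q (P x)) -> forall x, P (Nat.iter n Q x) = Nat.iter n Q (P x).
Proof. intros h x; induction n as [|n IH]; auto; simpl; rewrite h, IH; auto. Qed.

Lemma iter_comp P Q n : (forall x, P (Q x) = Q (P x)) ->
  forall x, Nat.iter n (fun y => P (Q y)) x = Nat.iter n P (Nat.iter n Q x).
Proof.
  intros h x; induction n as [|n IH]; auto; simpl.
  rewrite IH; f_equal; rewrite (iter_commute Q P); auto.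
Qed.

(* Telescoping: [P^n - Q^n] is a sum of [n] terms of the form [P^i Q^j (P - Q)]. *)
Lemma iter_dist_le P Q m n u :
  1 <= m -> bounded_linear P m -> bounded_linear Q m -> (forall x, P (Q x) = Q (P x)) ->
  nrm (Nat.iter n P u - Nat.iter n Q u)%V <= INR n * m ^ n * nrm (P u - Q u)%V.
Proof.
  intros hm hP hQ hPQ; induction n as [|n IH].
  - simpl; replace (u - u)%V with (0%V : cvec p) by cvec_ring; rewrite nrm_czero; lra.
  - simpl Nat.iter.
    replace (P (Nat.iter n P u) - Q (Nat.iter n Q u))%V with
      (P (Nat.iter n P u - Nat.iter n Q u) + Nat.iter n Q (P u - Q u))%V.
    + eapply Rle_trans; [apply nrm_cadd|].
      assert (h1 := proj2 hP (Nat.iter n P u - Nat.iter n Q u)%V).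
      assert (h2 := proj2 (bl_iter Q m n ltac:(lra) hQ) (P u - Q u)%V).
      rewrite S_INR; simpl pow.
      assert (h3 : 0 < m ^ n) by (apply pow_lt; lra).
      assert (h4 := nrm_ge0 p (P u - Q u)%V).
      assert (h5 : m * nrm (Nat.iter n P u - Nat.iter n Q u)%V <= m * (INR n * m ^ n * nrm (P u - Q u)%V))
        by (apply Rmult_le_compat_l; lra).
      assert (h6 : m ^ n * nrm (P u - Q u)%V <= m * (m ^ n * nrm (P u - Q u)%V)).
      { assert (0 <= m ^ n * nrm (P u - Q u)%V) by (apply Rmult_le_pos; lra); nra. }
      nra.
    + rewrite (bl_sub P m), (bl_sub _ _ _ _ (bl_iter Q m n ltac:(lra) hQ)) by auto.
      rewrite <- (iter_commute P Q) by auto.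
      replace (Nat.iter n Q (Q u)) with (Q (Nat.iter n Q u)); [cvec_ring|].
      apply iter_commute; auto.
Qed.

End Operators.

(** * Sectorial generation by Euler products *)

Section Generation.

Variables (p tau K c : R).
(** The graph of the unbounded operator [A]: [G u v] says that [u] is in the domain and
    [A u = v]. *)
Variable G : cvec p -> cvec p -> Prop.

Hypothesis tau_pos : 0 < tau.
Hypothesis K_ge0 : 0 <= K.
Hypothesis c_pos : 0 < c.

Definition csector (h : C) : Prop := Rabs (Im h) <= tau * Re h.
(** The bound makes [1 - K |h|] at least one half, so that resolvents have norm at most 2. *)
Definition small_step (h : C) : Prop := csector h /\ 2 * K * Cmod h <= 1.

Hypothesis G_lin : forall u v u' v' (b : C), G u v -> G u' v' -> G (u + b * u')%V (v + b * v')%V.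
Hypothesis G_fun : forall u v v', G u v -> G u v' -> v = v'.
Hypothesis G_diss : forall h u v, small_step h -> G u v ->
  (1 - K * Cmod h) * nrm u + c * Cmod h * nrm v <= nrm (u - h * v)%V.
Hypothesis G_onto : forall h y, small_step h -> h <> RtoC 0 -> exists u v, G u v /\ (u - h * v)%V = y.
(** Density of the domain of [A^2]: the error between Euler products is controlled by
    [x = A^2 u]. *)
Hypothesis G_dense : forall f eps, 0 < eps -> exists u v x, G u v /\ G v x /\ nrm (f - u)%V < eps.

(** * The resolvent [J h] and its algebra *)

Lemma csector_add h k : csector h -> csector k -> csector (h + k)%C.
Proof.
  unfold csector; intros h1 h2.
  replace (Re (h + k)%C) with (Re h + Re k) by reflexivity.
  replace (Im (h + k)%C) with (Im h + Im k) by reflexivity.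
  assert (h3 := Rabs_triang (Im h) (Im k)); lra.
Qed.

Lemma csector_scale h (r : R) : 0 <= r -> csector h -> csector (h * RtoC r)%C.
Proof.
  unfold csector; intros hr h1.
  replace (Re (h * RtoC r)%C) with (Re h * r) by (unfold Re, RtoC, Cmult; simpl; ring).
  replace (Im (h * RtoC r)%C) with (Im h * r) by (unfold Im, RtoC, Cmult; simpl; ring).
  rewrite Rabs_mult, (Rabs_pos_eq r) by auto; nra.
Qed.

Lemma csector_real (t : R) : 0 <= t -> csector (RtoC t).
Proof. unfold csector; intros h; simpl; rewrite Rabs_R0; nra. Qed.

(** The inverse of [I - h A]. The value at [h = 0] is set by hand, since there [u - h * v = y] with
    [G u v] would be solvable only for [y] in the domain. *)
Definition J (h : C) (y : cvec p) : cvec p :=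
  if excluded_middle_informative (h = RtoC 0) then y
  else epsilon (inhabits y) (fun u => exists v, G u v /\ (u - h * v)%V = y).

Lemma J0 y : J (RtoC 0) y = y.
Proof. unfold J; destruct excluded_middle_informative; tauto. Qed.

Lemma J_spec h y : small_step h -> h <> RtoC 0 -> exists v, G (J h y) v /\ (J h y - h * v)%V = y.
Proof.
  intros hs h0; unfold J; destruct excluded_middle_informative as [e|_]; [tauto|].
  apply (epsilon_spec (inhabits y) (fun u => exists v, G u v /\ (u - h * v)%V = y)).
  destruct (G_onto h y hs h0) as [u [v huv]]; exists u, v; auto.
Qed.

Lemma G_sub u v u' v' : G u v -> G u' v' -> G (u - u')%V (v - v')%V.
Proof. apply G_lin. Qed.

Lemma G_scal (b : C) u v : G u v -> G (b * u)%V (b * v)%V.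
Proof.
  intros h.
  replace (b * u)%V with (u + (b - RtoC 1)%C * u)%V by cvec_ring.
  replace (b * v)%V with (v + (b - RtoC 1)%C * v)%V by cvec_ring.
  apply G_lin; auto.
Qed.

Lemma small_half h : small_step h -> K * Cmod h <= / 2.
Proof. intros [_ h']; lra. Qed.

(** Injectivity of [I - h A]: the dissipativity inequality for a difference of two solutions has
    right-hand side zero. *)
Lemma J_unique h u v : small_step h -> G u v -> J h (u - h * v)%V = u.
Proof.
  intros hs hG; destruct (excluded_middle_informative (h = RtoC 0)) as [->|h0].
  - rewrite J0; cvec_ring.
  - destruct (J_spec h (u - h * v)%V hs h0) as [v' [h1 h2]].
    set (u' := J h (u - h * v)%V) in *.
    assert (h3 := G_lin _ _ _ _ (- RtoC 1)%C h1 hG).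
    apply csub_eq0.
    assert (h4 := G_diss h _ _ hs h3).
    replace ((u' + (- RtoC 1)%C * u) - h * (v' + (- RtoC 1)%C * v))%V with (0 : cvec p)%V in h4.
    + rewrite nrm_czero in h4; fold (u' - u)%V in h4.
      assert (h5 := small_half h hs).
      assert (h6 := nrm_ge0 p (u' - u)%V).
      assert (h7 := nrm_ge0 p (v' + (- RtoC 1)%C * v)%V).
      assert (h8 : 0 <= c * Cmod h * nrm (v' + (- RtoC 1)%C * v)%V).
      { apply Rmult_le_pos; auto; apply Rmult_le_pos; [lra|apply Cmod_ge_0]. }
      nra.
    + replace ((u' + (- RtoC 1)%C * u) - h * (v' + (- RtoC 1)%C * v))%V with
        ((u' - h * v') - (u - h * v))%V by cvec_ring.
      rewrite h2; cvec_ring.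
Qed.

Lemma J_bound2 h y : small_step h -> (1 - K * Cmod h) * nrm (J h y) <= nrm y.
Proof.
  intros hs; destruct (excluded_middle_informative (h = RtoC 0)) as [->|h0].
  - rewrite J0, Cmod_0; lra.
  - destruct (J_spec h y hs h0) as [v [h1 h2]].
    assert (h4 := G_diss h _ _ hs h1); rewrite h2 in h4.
    assert (h8 : 0 <= c * Cmod h * nrm v).
    { apply Rmult_le_pos; [|apply nrm_ge0]; apply Rmult_le_pos; [lra|apply Cmod_ge_0]. }
    lra.
Qed.

Lemma J_linear h x y (b : C) : small_step h -> J h (x + b * y)%V = (J h x + b * J h y)%V.
Proof.
  intros hs; destruct (excluded_middle_informative (h = RtoC 0)) as [->|h0].
  - rewrite !J0; auto.
  - destruct (J_spec h x hs h0) as [v [h1 h2]]; destruct (J_spec h y hs h0) as [v' [h1' h2']].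
    assert (h3 := J_unique h _ _ hs (G_lin _ _ _ _ b h1 h1')).
    rewrite <- h3; f_equal.
    rewrite <- h2 at 1; rewrite <- h2' at 1; cvec_ring.
Qed.

(** From [1 / (1 - x) <= 1 + 2 x <= exp (2 x)] for [0 <= x <= 1/2]. The exponential form makes the
    bound on [n] steps of length [z / n] independent of [n]. *)
Lemma J_bl h : small_step h -> bounded_linear (J h) (exp (2 * K * Cmod h)).
Proof.
  intros hs; split; [intros; apply J_linear; auto|].
  intros x; assert (h1 := J_bound2 h x hs); assert (h2 := small_half h hs).
  assert (h3 := exp_ineq1_le (2 * K * Cmod h)); assert (h4 := nrm_ge0 p (J h x)).
  assert (h5 : 0 <= K * Cmod h) by (apply Rmult_le_pos; auto; apply Cmod_ge_0).
  apply Rle_trans with ((1 + 2 * K * Cmod h) * ((1 - K * Cmod h) * nrm (J h x))).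
  - assert (0 <= K * Cmod h * (1 - 2 * (K * Cmod h)) * nrm (J h x)).
    { repeat apply Rmult_le_pos; lra || (apply Cmod_ge_0). }
    nra.
  - apply Rmult_le_compat; try lra.
    apply Rmult_le_pos; lra.
Qed.

Lemma J_bl2 h : small_step h -> bounded_linear (J h) 2.
Proof.
  intros hs; split; [intros; apply J_linear; auto|].
  intros x; assert (h1 := J_bound2 h x hs); assert (h2 := small_half h hs).
  assert (h4 := nrm_ge0 p (J h x)); nra.
Qed.

(** [J h] commutes with [A], and [J h u = u + h * J h (A u)]: the first-order expansion from which
    all Taylor estimates are iterated. *)
Lemma J_G h u v : small_step h -> G u v ->
  G (J h u) (J h v) /\ J h u = (u + h * J h v)%V.
Proof.
  intros hs hG; destruct (excluded_middle_informative (h = RtoC 0)) as [->|h0].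
  - rewrite !J0; split; auto; cvec_ring.
  - destruct (J_spec h u hs h0) as [g [h1 h2]].
    (* [g = A (J h u)] equals [(J h u - u) / h], a combination of elements of the domain. Since
       [A g = (g - v) / h], it solves [g - h * A g = v]. *)
    assert (h3 : G g ((/ h) * (g - v))%V).
    { replace g with (/ h * (J h u - u))%V at 1.
      - apply G_scal, G_sub; auto.
      - replace (J h u - u)%V with (J h u - (J h u - h * g))%V by (rewrite h2; auto).
        apply cvec_ext; intros i; rewrite ?cscal_val, ?csub_val, ?cscal_val; field; auto. }
    assert (h4 := J_unique h _ _ hs h3).
    replace (g - h * (/ h * (g - v)))%V with v in h4.
    + rewrite h4; split; auto.
      rewrite <- h2 at 2; cvec_ring.
    + apply cvec_ext; intros i; rewrite ?csub_val, ?cscal_val, ?csub_val; field; auto.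
Qed.

Lemma J_comm a b y : small_step a -> small_step b -> J a (J b y) = J b (J a y).
Proof.
  intros ha hb; destruct (excluded_middle_informative (b = RtoC 0)) as [->|h0].
  - rewrite !J0; auto.
  - destruct (J_spec b y hb h0) as [q [h1 h2]].
    destruct (J_G a _ _ ha h1) as [h3 _].
    rewrite <- (J_unique b _ _ hb h3); f_equal.
    rewrite <- h2 at 2; rewrite (bl_sub _ _ _ _ (J_bl a ha)), (bl_scal _ _ _ _ (J_bl a ha)); auto.
Qed.

(** The unbounded relation becomes an identity between bounded operators. This form survives limits,
    which gives closedness, and commutes with the semigroup. *)
Lemma G_iff_J h u v : small_step h -> h <> RtoC 0 -> (G u v <-> J h u = (u + h * J h v)%V).
Proof.
  intros hs h0; split; [apply J_G; auto|]; intros hJ.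
  assert (h1 : u = J h (u - h * v)%V).
  { rewrite (bl_sub _ _ _ _ (J_bl h hs)), (bl_scal _ _ _ _ (J_bl h hs)), hJ; cvec_ring. }
  destruct (J_spec h (u - h * v)%V hs h0) as [g [h2 h3]]; rewrite <- h1 in h2, h3.
  replace v with g; auto.
  apply cvec_ext; intros i.
  assert (h4 : cval (u - h * g)%V i = cval (u - h * v)%V i) by (rewrite h3; auto).
  rewrite ?csub_val, ?cscal_val in h4.
  replace (g i) with (/ h * (u i - (u i - h * g i)))%C by (field; auto).
  rewrite h4; field; auto.
Qed.

(** One fixed nonzero real step, admissible also when [K = 0]. *)
Definition hstar : R := / (2 * K + 1).

Lemma hstar_pos : 0 < hstar.
Proof. apply Rinv_0_lt_compat; lra. Qed.

Lemma hstar_small : small_step (RtoC hstar).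
Proof.
  assert (hp := hstar_pos); split; [apply csector_real; lra|].
  rewrite Cmod_R, Rabs_pos_eq by lra.
  apply Rmult_le_reg_r with (2 * K + 1); [lra|].
  unfold hstar; rewrite Rmult_assoc, Rinv_l; lra.
Qed.

Lemma hstar_neq0 : RtoC hstar <> RtoC 0.
Proof. assert (hp := hstar_pos); intros e; apply RtoC_inj in e; lra. Qed.

Lemma G_iff u v : G u v <-> J (RtoC hstar) u = (u + RtoC hstar * J (RtoC hstar) v)%V.
Proof. apply G_iff_J; [apply hstar_small|apply hstar_neq0]. Qed.

Lemma G_closed (u v : nat -> cvec p) l m :
  (forall n, G (u n) (v n)) -> tends u l -> tends v m -> G l m.
Proof.
  intros hG hu hv; apply G_iff.
  assert (hJ : forall (w : nat -> cvec p) k, tends w k -> tends (fun n => J (RtoC hstar) (w n)) (J (RtoC hstar) k)).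
  { intros w k hw; apply (tends_lipschitz (fun _ => J (RtoC hstar)) 2 w k); auto using tends_const.
    exists 0%nat; intros; apply bl_lipschitz, J_bl2, hstar_small. }
  apply (tends_unique (fun n => J (RtoC hstar) (u n))); auto.
  apply tends_near with (fun n => u n + RtoC hstar * J (RtoC hstar) (v n))%V.
  - apply tends_lin; auto.
  - intros eps heps; exists 0%nat; intros n _.
    rewrite (proj1 (G_iff (u n) (v n)) (hG n)).
    match goal with |- nrm ?x < _ => replace x with (0 : cvec p)%V by cvec_ring end.
    rewrite nrm_czero; auto.
Qed.

Lemma bl_tends P m (w : nat -> cvec p) k : bounded_linear P m -> tends w k -> tends (fun n => P (w n)) (P k).
Proof.
  intros hP hw; apply (tends_lipschitz (fun _ => P) m w k); auto using tends_const.
  exists 0%nat; intros; apply bl_lipschitz; auto.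
Qed.

Lemma nrm_add_le (x y : cvec p) a b : nrm x <= a -> nrm y <= b -> nrm (x + y)%V <= a + b.
Proof. intros h h'; eapply Rle_trans; [apply nrm_cadd|lra]. Qed.

Lemma nrm_scal_le (x : cvec p) (k : C) a b : Cmod k <= a -> nrm x <= b -> nrm (k * x)%V <= a * b.
Proof.
  intros h h'; rewrite nrm_cscal; apply Rmult_le_compat; auto using nrm_ge0, Cmod_ge_0.
Qed.

Lemma J_step h v x : small_step h -> G v x -> J h v = (v + h * J h x)%V /\ nrm (J h x) <= 2 * nrm x.
Proof. intros hs hG; split; [apply J_G; auto|apply J_bl2; auto]. Qed.

(** Both sides agree up to [u + (a + b) * A u]. What remains is [(a+b)^2 J (a+b) - a (a+b) J a - b^2
    J a J b] applied to [A^2 u], and each resolvent costs a factor 2. *)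
Lemma J_add_dist a b u v x :
  small_step a -> small_step b -> small_step (a + b)%C -> G u v -> G v x ->
  nrm (J (a + b)%C u - J a (J b u))%V <= 6 * (Cmod a + Cmod b) ^ 2 * nrm x.
Proof.
  intros ha hb hab hu hv.
  assert (bla := J_bl2 a ha).
  destruct (J_G a u v ha hu) as [_ e1]; destruct (J_G b u v hb hu) as [_ e2].
  destruct (J_G _ u v hab hu) as [_ e3].
  destruct (J_step a v x ha hv) as [e4 n4]; destruct (J_step b v x hb hv) as [e5 n5].
  destruct (J_step _ v x hab hv) as [e6 n6].
  assert (n7 : nrm (J a (J b x)) <= 4 * nrm x).
  { eapply Rle_trans; [apply bla|]; lra. }
  assert (hA := Cmod_ge_0 a); assert (hB := Cmod_ge_0 b); assert (hx := nrm_ge0 p x).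
  replace (J (a + b)%C u - J a (J b u))%V with
    (a * (((a + b)%C * J (a + b)%C x) + (- a)%C * J a x) +
     b * ((((a + b)%C * J (a + b)%C x) + (- a)%C * J a x) + (- b)%C * J a (J b x)))%V.
  - apply Rle_trans with (Cmod a * (((Cmod a + Cmod b) * (2 * nrm x)) + Cmod a * (2 * nrm x)) +
      Cmod b * (((Cmod a + Cmod b) * (2 * nrm x)) + Cmod a * (2 * nrm x) + Cmod b * (4 * nrm x))).
    + assert (h2 : nrm ((a + b)%C * J (a + b)%C x + (- a)%C * J a x)%V <=
        (Cmod a + Cmod b) * (2 * nrm x) + Cmod a * (2 * nrm x)).
      { apply nrm_add_le; apply nrm_scal_le; auto; [apply Cmod_triangle|rewrite Cmod_opp; lra]. }
      apply nrm_add_le; apply nrm_scal_le; auto; try lra.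
      apply nrm_add_le; auto; apply nrm_scal_le; auto; rewrite Cmod_opp; lra.
    + assert (0 <= Cmod a * Cmod b * nrm x) by (repeat apply Rmult_le_pos; auto).
      assert (0 <= Cmod b * Cmod b * nrm x) by (repeat apply Rmult_le_pos; auto).
      assert (0 <= Cmod a * Cmod a * nrm x) by (repeat apply Rmult_le_pos; auto).
      nra.
  - rewrite e2, (bl_add _ _ _ _ bla), (bl_scal _ _ _ _ bla), e1, e3, e5,
      (bl_add _ _ _ _ bla), (bl_scal _ _ _ _ bla), e4, e6; cvec_ring.
Qed.

(** * Euler products and their convergence *)

Definition euler (n : nat) (z : C) (f : cvec p) : cvec p :=
  Nat.iter n (J (z * RtoC (/ INR n))%C) f.

Definition growth (r : R) : R := exp (2 * K * r).

Lemma growth_ge1 r : 0 <= r -> 1 <= growth r.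
Proof. intros h; apply exp_ge_1; apply Rmult_le_pos; lra. Qed.

Lemma growth_mono r s : r <= s -> growth r <= growth s.
Proof.
  intros h; apply exp_mono; apply Rmult_le_compat_l; lra.
Qed.

Definition fine (n : nat) (z : C) : Prop := (0 < n)%nat /\ 2 * K * Cmod z <= INR n.

Lemma Cmod_step n z : (0 < n)%nat -> Cmod (z * RtoC (/ INR n))%C = Cmod z / INR n.
Proof.
  intros hn; apply lt_0_INR in hn.
  rewrite Cmod_mult, Cmod_R, Rabs_pos_eq; auto.
  apply Rlt_le, Rinv_0_lt_compat; auto.
Qed.

Lemma fine_small n z : csector z -> fine n z -> small_step (z * RtoC (/ INR n))%C.
Proof.
  intros hz [hn h]; assert (hn' := lt_0_INR _ hn); split.
  - apply csector_scale; auto; apply Rlt_le, Rinv_0_lt_compat; auto.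
  - rewrite Cmod_step by auto.
    apply Rmult_le_reg_r with (INR n); auto.
    replace (2 * K * (Cmod z / INR n) * INR n) with (2 * K * Cmod z) by (field; lra); lra.
Qed.

Lemma fine_le n z w : Cmod w <= Cmod z -> fine n z -> fine n w.
Proof. intros h [h1 h2]; split; auto; assert (2 * K * Cmod w <= 2 * K * Cmod z) by (apply Rmult_le_compat_l; lra); lra. Qed.

Lemma euler_step_bl n z : csector z -> fine n z ->
  bounded_linear (J (z * RtoC (/ INR n))%C) (growth (Cmod z / INR n)).
Proof.
  intros hz hn; unfold growth; rewrite <- Cmod_step by apply hn.
  apply J_bl, fine_small; auto.
Qed.

Lemma growth_pow n r : (0 < n)%nat -> growth (r / INR n) ^ n = growth r.
Proof.
  intros hn; apply lt_0_INR in hn; unfold growth; rewrite exp_mult_INR; f_equal; field; lra.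
Qed.

Lemma growth_pow_le n r j : (0 < n)%nat -> 0 <= r -> (j <= n)%nat -> growth (r / INR n) ^ j <= growth r.
Proof.
  intros hn hr hj; rewrite <- (growth_pow n r hn); apply Rle_pow; auto.
  apply growth_ge1, Rle_div_r; [apply lt_0_INR; auto|lra].
Qed.

Lemma div_INR_ge0 n r : (0 < n)%nat -> 0 <= r -> 0 <= r / INR n.
Proof. intros hn hr; apply Rle_div_r; [apply lt_0_INR; auto|lra]. Qed.

Lemma iter_bl n z j : csector z -> fine n z -> (j <= n)%nat ->
  bounded_linear (Nat.iter j (J (z * RtoC (/ INR n))%C)) (growth (Cmod z)).
Proof.
  intros hz hn hj; apply bl_weaken with (growth (Cmod z / INR n) ^ j).
  - apply growth_pow_le; auto; [apply hn|apply Cmod_ge_0].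
  - apply bl_iter; [apply Rlt_le, exp_pos|apply euler_step_bl; auto].
Qed.

Lemma euler_bl n z : csector z -> fine n z -> bounded_linear (euler n z) (growth (Cmod z)).
Proof. intros; apply iter_bl; auto. Qed.

Lemma euler_J_comm n z h y : csector z -> fine n z -> small_step h ->
  J h (euler n z y) = euler n z (J h y).
Proof.
  intros; unfold euler; apply iter_commute; intros; apply J_comm; auto using fine_small.
Qed.

(** There are [n] steps, each with an error of order [((|z| + |w|) / n)^2], hence a total of order
    [1 / n]. *)
Lemma euler_add_dist n z w u v x :
  csector z -> csector w -> (0 < n)%nat -> 2 * K * (Cmod z + Cmod w) <= INR n ->
  G u v -> G v x ->
  nrm (euler n (z + w)%C u - euler n z (euler n w u))%V <=
    6 * growth (Cmod z + Cmod w) * (Cmod z + Cmod w) ^ 2 * nrm x / INR n.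
Proof.
  intros hz hw hn hK hu hv.
  assert (hn' := lt_0_INR _ hn).
  assert (az := Cmod_ge_0 z); assert (aw := Cmod_ge_0 w).
  assert (fz : fine n z) by (split; auto; nra).
  assert (fw : fine n w) by (split; auto; nra).
  assert (hzw : csector (z + w)%C) by (apply csector_add; auto).
  assert (azw := Cmod_triangle z w).
  assert (fzw : fine n (z + w)%C).
  { split; auto; apply Rle_trans with (2 * K * (Cmod z + Cmod w)); auto.
    apply Rmult_le_compat_l; lra. }
  assert (sz := fine_small n z hz fz); assert (sw := fine_small n w hw fw).
  assert (szw := fine_small n _ hzw fzw).
  unfold euler.
  rewrite <- (iter_comp (J (z * RtoC (/ INR n))%C) (J (w * RtoC (/ INR n))%C))
    by (intros; apply J_comm; auto).
  eapply Rle_trans.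
  - apply (iter_dist_le _ _ (growth ((Cmod z + Cmod w) / INR n)) n).
    + apply growth_ge1, div_INR_ge0; auto; lra.
    + apply bl_weaken with (growth (Cmod (z + w)%C / INR n)); [|apply euler_step_bl; auto].
      apply growth_mono, Rmult_le_compat_r; auto; apply Rlt_le, Rinv_0_lt_compat; auto.
    + replace (growth ((Cmod z + Cmod w) / INR n)) with
        (growth (Cmod z / INR n) * growth (Cmod w / INR n)).
      * apply bl_comp; [apply Rlt_le, exp_pos| |]; apply euler_step_bl; auto.
      * unfold growth; rewrite <- exp_plus; f_equal; field; lra.
    + intros y; rewrite J_comm by auto; f_equal; apply J_comm; auto.
  - rewrite growth_pow by auto.
    assert (hd := J_add_dist _ _ u v x sz sw).
    rewrite <- Cmult_plus_distr_r in hd; specialize (hd szw hu hv).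
    rewrite !Cmod_step in hd by auto.
    assert (hg : 0 < growth (Cmod z + Cmod w)) by apply exp_pos.
    apply Rle_trans with (INR n * growth (Cmod z + Cmod w) * (6 * (Cmod z / INR n + Cmod w / INR n) ^ 2 * nrm x)).
    + apply Rmult_le_compat_l; auto; apply Rmult_le_pos; lra.
    + right; field; lra.
Qed.

(** The case [w = z / 2] of the additive comparison: two Euler products of [n] steps for [z / 2]
    make up exactly the one of [2 n] steps for [z]. *)
Lemma euler_double n z u v x :
  csector z -> fine n z -> G u v -> G v x ->
  nrm (euler (n + n) z u - euler n z u)%V <= 6 * growth (Cmod z) * Cmod z ^ 2 * nrm x / INR n.
Proof.
  intros hz hn hu hv.
  assert (hn' := lt_0_INR _ (proj1 hn)).
  set (w := (z * RtoC (/ 2))%C).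
  assert (hw : csector w) by (apply csector_scale; auto; lra).
  assert (ew : (w + w)%C = z).
  { unfold w; destruct z as [a b]; unfold Cplus, Cmult, RtoC; simpl; f_equal; field. }
  assert (cw : Cmod w + Cmod w = Cmod z).
  { unfold w; rewrite Cmod_mult, Cmod_R, Rabs_pos_eq; lra. }
  assert (h := euler_add_dist n w w u v x hw hw (proj1 hn)).
  rewrite cw, ew in h; specialize (h (proj2 hn) hu hv).
  rewrite nrm_csub_sym.
  replace (euler (n + n) z u) with (euler n w (euler n w u)); auto.
  unfold euler; rewrite <- Nat.iter_add.
  replace (w * RtoC (/ INR n))%C with (z * RtoC (/ INR (n + n)))%C; auto.
  unfold w; rewrite <- Cmult_assoc, <- RtoC_mult; do 2 f_equal.
  rewrite plus_INR; field; lra.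
Qed.

Lemma fine_eventually z : exists k0, forall k, (k0 <= k)%nat -> fine (2 ^ k) z.
Proof.
  destruct (INR_unbounded (2 * K * Cmod z)) as [k0 hk0].
  exists k0; intros k hk; split.
  - assert (h := Nat.pow_nonzero 2 k ltac:(lia)); lia.
  - apply Rlt_le, Rlt_le_trans with (INR k0); auto; apply le_INR.
    assert (h := Nat.pow_gt_lin_r 2 k ltac:(lia)); lia.
Qed.

Lemma INR_pow2 k : INR (2 ^ k) = 2 ^ k.
Proof. rewrite pow_INR; auto. Qed.

(** Along powers of two only consecutive doublings are compared, so on the domain of [A^2] the
    increments are geometric. The uniform bound on the products extends convergence to the
    closure. *)
Lemma euler_converges z f : csector z -> exists l, tends (fun k => euler (2 ^ k) z f) l.
Proof.
  intros hz.
  destruct (fine_eventually z) as [k0 hk0].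
  assert (hD : forall u v x, G u v -> G v x -> exists l, tends (fun k => euler (2 ^ k) z u) l).
  { intros u v x hu hv.
    apply (cvec_geometric_limit _ (6 * growth (Cmod z) * Cmod z ^ 2 * nrm x) (/ 2) k0); [|lra|].
    - apply Rmult_le_pos; [apply Rmult_le_pos; [|apply pow2_ge_0]|apply nrm_ge0].
      assert (h : 0 < growth (Cmod z)) by apply exp_pos; lra.
    - intros k hk; assert (h := euler_double (2 ^ k) z u v x hz (hk0 k hk) hu hv).
      replace (2 ^ S k)%nat with (2 ^ k + 2 ^ k)%nat by (simpl; lia).
      rewrite INR_pow2 in h; rewrite pow_inv; exact h. }
  apply cvec_complete; intros eps heps.
  set (M := growth (Cmod z)).
  assert (hM : 1 <= M) by (apply growth_ge1, Cmod_ge_0).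
  destruct (G_dense f (eps / (4 * M))) as [u [v [x [hu [hv hf]]]]].
  { apply Rdiv_lt_0_compat; lra. }
  destruct (hD u v x hu hv) as [l hl].
  destruct (hl (eps / 4)) as [N hN]; [lra|].
  exists (k0 + N)%nat; intros n m hn hm.
  assert (hb : forall k, (k0 <= k)%nat -> nrm (euler (2 ^ k) z f - euler (2 ^ k) z u)%V < eps / 4).
  { intros k hk.
    eapply Rle_lt_trans; [apply bl_lipschitz, (euler_bl _ z hz (hk0 k hk))|].
    apply Rlt_le_trans with (M * (eps / (4 * M))).
    - apply Rmult_lt_compat_l; auto; lra.
    - right; field; lra. }
  assert (t1 := nrm_triangle_sub (euler (2 ^ n) z f) (euler (2 ^ n) z u) (euler (2 ^ m) z f)).
  assert (t2 := nrm_triangle_sub (euler (2 ^ n) z u) l (euler (2 ^ m) z f)).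
  assert (t3 := nrm_triangle_sub l (euler (2 ^ m) z u) (euler (2 ^ m) z f)).
  rewrite (nrm_csub_sym l (euler (2 ^ m) z u)) in t3.
  rewrite (nrm_csub_sym (euler (2 ^ m) z u) (euler (2 ^ m) z f)) in t3.
  assert (b1 := hb n ltac:(lia)); assert (b2 := hb m ltac:(lia)).
  assert (b3 := hN n ltac:(lia)); assert (b4 := hN m ltac:(lia)); lra.
Qed.

(** * The limit semigroup *)

Definition sgp (z : C) (f : cvec p) : cvec p :=
  epsilon (inhabits f) (fun l => tends (fun k => euler (2 ^ k) z f) l).

Lemma sgp_limit z f : csector z -> tends (fun k => euler (2 ^ k) z f) (sgp z f).
Proof.
  intros hz; apply (epsilon_spec (inhabits f) (fun l => tends (fun k => euler (2 ^ k) z f) l)).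
  apply euler_converges; auto.
Qed.

Lemma sgp_bl z : csector z -> bounded_linear (sgp z) (growth (Cmod z)).
Proof.
  intros hz; destruct (fine_eventually z) as [k0 hk0]; split.
  - intros x y b; apply (tends_unique (fun k => euler (2 ^ k) z (x + b * y)%V));
      [apply sgp_limit; auto|].
    apply tends_near with (fun k => euler (2 ^ k) z x + b * euler (2 ^ k) z y)%V.
    + apply tends_lin; apply sgp_limit; auto.
    + intros eps heps; exists k0; intros k hk.
      rewrite (proj1 (euler_bl _ z hz (hk0 k hk))).
      match goal with |- nrm ?a < _ => replace a with (0 : cvec p)%V by cvec_ring end.
      rewrite nrm_czero; auto.
  - intros x; apply (tends_nrm_le (fun k => euler (2 ^ k) z x)); [apply sgp_limit; auto|].
    exists k0; intros k hk; apply (euler_bl _ z hz (hk0 k hk)).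
Qed.

Lemma sgp_at_0 f : sgp (RtoC 0) f = f.
Proof.
  apply (tends_unique (fun k => euler (2 ^ k) (RtoC 0) f)); [apply sgp_limit, csector_real; lra|].
  apply tends_near with (fun _ => f); [apply tends_const|].
  intros eps heps; exists 0%nat; intros k _.
  replace (euler (2 ^ k) (RtoC 0) f) with f.
  - replace (f - f)%V with (0 : cvec p)%V by cvec_ring; rewrite nrm_czero; auto.
  - unfold euler; rewrite Cmult_0_l.
    induction (2 ^ k)%nat as [|n IH]; auto; simpl; rewrite J0; auto.
Qed.

Lemma sgp_J_comm z h f : csector z -> small_step h -> J h (sgp z f) = sgp z (J h f).
Proof.
  intros hz hs; destruct (fine_eventually z) as [k0 hk0].
  apply (tends_unique (fun k => J h (euler (2 ^ k) z f))).
  - apply (bl_tends _ 2); [apply J_bl2; auto|apply sgp_limit; auto].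
  - apply tends_near with (fun k => euler (2 ^ k) z (J h f)); [apply sgp_limit; auto|].
    intros eps heps; exists k0; intros k hk; rewrite euler_J_comm; auto.
    match goal with |- nrm ?a < _ => replace a with (0 : cvec p)%V by cvec_ring end.
    rewrite nrm_czero; auto.
Qed.

Lemma sgp_G z u v : csector z -> G u v -> G (sgp z u) (sgp z v).
Proof.
  intros hz hG; apply G_iff; rewrite !sgp_J_comm by auto using hstar_small.
  rewrite (proj1 (G_iff u v) hG).
  rewrite (bl_add _ _ _ _ (sgp_bl z hz)), (bl_scal _ _ _ _ (sgp_bl z hz)); auto.
Qed.

Lemma bl_eq_dense P Q m m' :
  0 <= m -> 0 <= m' -> bounded_linear P m -> bounded_linear Q m' ->
  (forall u v x, G u v -> G v x -> P u = Q u) -> forall f, P f = Q f.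
Proof.
  intros hm hm' hP hQ h f; apply csub_eq0, Rnot_lt_le; intros hlt.
  set (e := nrm (P f - Q f)%V) in *.
  destruct (G_dense f (e / (m + m' + 1))) as [u [v [x [hu [hv hf]]]]].
  { apply Rdiv_lt_0_compat; lra. }
  assert (h1 := nrm_triangle_sub (P f) (P u) (Q f)); fold e in h1.
  rewrite (h u v x hu hv) in h1 at 2.
  assert (h2 := bl_lipschitz P m f u hP); assert (h3 := bl_lipschitz Q m' u f hQ).
  rewrite (nrm_csub_sym u f) in h3.
  assert (h4 : (m + m' + 1) * nrm (f - u)%V < e).
  { apply Rlt_le_trans with ((m + m' + 1) * (e / (m + m' + 1))).
    - apply Rmult_lt_compat_l; lra.
    - right; field; lra. }
  assert (h5 := nrm_ge0 p (f - u)%V); nra.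
Qed.

Lemma sgp_add z w f : csector z -> csector w -> sgp (z + w)%C f = sgp z (sgp w f).
Proof.
  intros hz hw.
  assert (hzw : csector (z + w)%C) by (apply csector_add; auto).
  assert (az := Cmod_ge_0 z); assert (aw := Cmod_ge_0 w).
  revert f; apply (bl_eq_dense _ (fun f => sgp z (sgp w f)) (growth (Cmod (z + w)%C))
    (growth (Cmod z) * growth (Cmod w))); try (apply Rlt_le; repeat apply Rmult_lt_0_compat; apply exp_pos).
  - apply sgp_bl; auto.
  - apply bl_comp; [apply Rlt_le, exp_pos| |]; apply sgp_bl; auto.
  - intros u v x hu hv.
    (* Fineness is required for the sum of the moduli, so that one index serves [z], [w] and
       [z + w]. *)
    destruct (fine_eventually (RtoC (Cmod z + Cmod w))) as [k0 hk0].
    assert (hk1 : forall k, (k0 <= k)%nat -> 2 * K * (Cmod z + Cmod w) <= INR (2 ^ k)).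
    { intros k hk; destruct (hk0 k hk) as [_ h]; rewrite Cmod_R, Rabs_pos_eq in h; lra. }
    apply (tends_unique (fun k => euler (2 ^ k) (z + w)%C u)); [apply sgp_limit; auto|].
    apply tends_near with (fun k => euler (2 ^ k) z (euler (2 ^ k) w u)).
    + apply (tends_lipschitz (fun k => euler (2 ^ k) z) (growth (Cmod z)) _ (sgp w u)).
      * exists k0; intros k hk y y'; apply bl_lipschitz, euler_bl; auto.
        apply (fine_le _ (RtoC (Cmod z + Cmod w))); auto.
        rewrite Cmod_R, Rabs_pos_eq; lra.
      * apply sgp_limit; auto.
      * apply sgp_limit; auto.
    + intros eps heps.
      set (B := 6 * growth (Cmod z + Cmod w) * (Cmod z + Cmod w) ^ 2 * nrm x).
      destruct (INR_unbounded (B / eps)) as [N hN].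
      exists (k0 + N)%nat; intros k hk.
      assert (hp2 : INR N < INR (2 ^ k)).
      { apply lt_INR; assert (h := Nat.pow_gt_lin_r 2 k ltac:(lia)); lia. }
      eapply Rle_lt_trans; [apply (euler_add_dist (2 ^ k) z w u v x); auto|].
      * apply (hk0 k); lia.
      * apply hk1; lia.
      * fold B; assert (hN0 := pos_INR N).
        apply Rmult_lt_reg_r with (INR (2 ^ k)); [lra|].
        replace (B / INR (2 ^ k) * INR (2 ^ k)) with B by (field; lra).
        apply Rlt_trans with (eps * INR N); [|apply Rmult_lt_compat_l; auto].
        replace B with (eps * (B / eps)) by (field; lra).
        apply Rmult_lt_compat_l; auto.
Qed.

Lemma sgp_preserves (Cone : cvec p -> Prop) (t : R) f :
  (forall u l, (forall n, Cone (u n)) -> tends u l -> Cone l) ->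
  (forall h y, 0 <= h -> small_step (RtoC h) -> Cone y -> Cone (J (RtoC h) y)) ->
  0 <= t -> Cone f -> Cone (sgp (RtoC t) f).
Proof.
  intros hcl hJ ht hf.
  assert (hz := csector_real t ht).
  destruct (fine_eventually (RtoC t)) as [k0 hk0].
  (* The sequence is shifted by [k0] because an Euler product with too large a step need not stay in
     the cone. *)
  apply (hcl (fun k => euler (2 ^ (k0 + k)) (RtoC t) f)).
  - intros k; assert (hk := hk0 (k0 + k)%nat ltac:(lia)).
    assert (hs := fine_small _ _ hz hk); unfold euler.
    assert (hr : 0 < / INR (2 ^ (k0 + k))) by (apply Rinv_0_lt_compat, lt_0_INR, hk).
    revert hs hr; generalize (/ INR (2 ^ (k0 + k))); intros r hs hr.
    clear hk; induction (2 ^ (k0 + k))%nat as [|n IH]; auto; simpl.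
    rewrite <- RtoC_mult in hs |- *; rewrite <- RtoC_mult in IH; apply hJ; auto.
    apply Rmult_le_pos; lra.
  - intros eps heps; destruct (sgp_limit (RtoC t) f hz eps heps) as [N hN].
    exists N; intros n hn; apply hN; lia.
Qed.

(** * Taylor expansions and the generator *)

Lemma iter_G n h u v : small_step h -> G u v -> G (Nat.iter n (J h) u) (Nat.iter n (J h) v).
Proof.
  intros hs hG; induction n as [|n IH]; auto; simpl; apply J_G; auto.
Qed.

Lemma iter_dist_id n z j v x : csector z -> fine n z -> (j <= n)%nat -> G v x ->
  nrm (Nat.iter j (J (z * RtoC (/ INR n))%C) v - v)%V <= 2 * growth (Cmod z) * Cmod z * nrm x.
Proof.
  intros hz hn hj hG.
  assert (hs := fine_small _ _ hz hn).
  assert (hn' := lt_0_INR _ (proj1 hn)); assert (az := Cmod_ge_0 z).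
  assert (g1 : 1 <= growth (Cmod z / INR n)) by (apply growth_ge1, div_INR_ge0; [apply hn|auto]).
  (* With [v] written as a power of the identity, the telescoping bound between powers applies. *)
  replace v with (Nat.iter j (fun y : cvec p => y) v) at 2
    by (clear; induction j; simpl; auto).
  eapply Rle_trans; [apply (iter_dist_le _ _ (growth (Cmod z / INR n)))|]; auto.
  - apply euler_step_bl; auto.
  - apply bl_weaken with 1; auto; apply bl_id.
  - destruct (J_step _ v x hs hG) as [e hx]; rewrite e.
    replace (v + z * RtoC (/ INR n) * J (z * RtoC (/ INR n))%C x - v)%V with
      ((z * RtoC (/ INR n))%C * J (z * RtoC (/ INR n))%C x)%V by cvec_ring.
    rewrite nrm_cscal, Cmod_step by apply hn.
    assert (hg := growth_pow_le n (Cmod z) j (proj1 hn) az hj).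
    assert (hj' := le_INR _ _ hj); assert (hj0 := pos_INR j).
    assert (hgp : 0 < growth (Cmod z / INR n) ^ j) by (apply pow_lt; lra).
    assert (hz0 : 0 <= Cmod z / INR n) by (apply div_INR_ge0; [apply hn|auto]).
    apply Rle_trans with (INR n * growth (Cmod z) * (Cmod z / INR n * (2 * nrm x))).
    + apply Rmult_le_compat.
      * apply Rmult_le_pos; lra.
      * apply Rmult_le_pos; auto; apply nrm_ge0.
      * apply Rmult_le_compat; lra.
      * apply Rmult_le_compat_l; auto.
    + right; field; lra.
Qed.

Lemma sgp_dist_id z v x : csector z -> G v x ->
  nrm (sgp z v - v)%V <= 2 * growth (Cmod z) * Cmod z * nrm x.
Proof.
  intros hz hG; destruct (fine_eventually z) as [k0 hk0].
  apply (tends_dist_le (fun k => euler (2 ^ k) z v)); [apply sgp_limit; auto|].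
  exists k0; intros k hk; apply iter_dist_id; auto.
Qed.

(** [J^n u - u] is the sum of [h * J^j v] over [j = 1, ..., n], and each [J^j v] is within [eps] of
    [v]. *)
Lemma iter_taylor n h u v eps : small_step h -> G u v ->
  (forall j, (j <= n)%nat -> nrm (Nat.iter j (J h) v - v)%V <= eps) ->
  nrm (Nat.iter n (J h) u - (u + (RtoC (INR n) * h)%C * v))%V <= INR n * Cmod h * eps.
Proof.
  intros hs hG; induction n as [|n IH]; intros hj.
  - simpl; match goal with |- nrm ?a <= _ => replace a with (0 : cvec p)%V by cvec_ring end.
    rewrite nrm_czero; lra.
  - specialize (IH (fun j hjn => hj j (Nat.le_trans _ _ _ hjn (Nat.le_succ_diag_r n)))).
    specialize (hj _ (Nat.le_refl _)).
    destruct (J_G h _ _ hs (iter_G n h u v hs hG)) as [_ e].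
    simpl Nat.iter in hj |- *; rewrite e.
    rewrite S_INR, RtoC_plus.
    replace (Nat.iter n (J h) u + h * J h (Nat.iter n (J h) v) - (u + (RtoC (INR n) + RtoC 1) * h * v))%V
      with ((Nat.iter n (J h) u - (u + (RtoC (INR n) * h)%C * v)) + h * (J h (Nat.iter n (J h) v) - v))%V
      by cvec_ring.
    eapply Rle_trans; [apply nrm_cadd|]; rewrite nrm_cscal.
    assert (h0 := Rmult_le_compat_l _ _ _ (Cmod_ge_0 h) hj); lra.
Qed.

(* [v'] is a smoother approximation of [v = A u]; taking [v' = v] gives a quadratic remainder. *)
Lemma sgp_taylor z u v v' x' : csector z -> G u v -> G v' x' ->
  nrm (sgp z u - (u + z * v))%V <=
    Cmod z * ((growth (Cmod z) + 1) * nrm (v - v')%V + 2 * growth (Cmod z) * Cmod z * nrm x').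
Proof.
  intros hz hu hv'; destruct (fine_eventually z) as [k0 hk0].
  apply (tends_dist_le (fun k => euler (2 ^ k) z u)); [apply sgp_limit; auto|].
  exists k0; intros k hk; specialize (hk0 k hk); revert hk0; generalize (2 ^ k)%nat; intros n hn.
  assert (hn' := lt_0_INR _ (proj1 hn)).
  assert (hs := fine_small _ _ hz hn).
  eapply Rle_trans; [|eapply Rle_trans; [apply (iter_taylor n _ u v ((growth (Cmod z) + 1) * nrm (v - v')%V
     + 2 * growth (Cmod z) * Cmod z * nrm x') hs hu)|]].
  - right; unfold euler; do 4 f_equal.
    rewrite Cmult_comm, <- Cmult_assoc, <- RtoC_mult, Rinv_l, Cmult_1_r; auto; lra.
  - intros j hj.
    assert (h2 := iter_dist_id n z j v' x' hz hn hj hv').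
    assert (h3 := bl_lipschitz _ _ v v' (iter_bl n z j hz hn hj)).
    set (P := Nat.iter j (J (z * RtoC (/ INR n))%C)) in *.
    assert (t1 := nrm_triangle_sub (P v) (P v') v).
    assert (t2 := nrm_triangle_sub (P v') v' v).
    rewrite (nrm_csub_sym v' v) in t2; lra.
  - rewrite Cmod_step by apply hn; right; field; lra.
Qed.

Lemma sgp_continuous_0 f eps : 0 < eps -> exists del, 0 < del /\
  forall z, csector z -> Cmod z < del -> nrm (sgp z f - f)%V < eps.
Proof.
  intros heps; set (M := growth 1).
  assert (hM : 1 <= M) by (apply growth_ge1; lra).
  destruct (G_dense f (eps / (2 * (M + 1)))) as [u [v [x [hu [hv hf]]]]].
  { apply Rdiv_lt_0_compat; lra. }
  assert (hv0 := nrm_ge0 p v).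
  assert (hpos : 0 < 2 * M * nrm v + 1).
  { assert (0 <= M * nrm v) by (apply Rmult_le_pos; lra); lra. }
  exists (Rmin 1 (eps / 2 / (2 * M * nrm v + 1))); split.
  { apply Rmin_pos; [lra|]; apply Rdiv_lt_0_compat; lra. }
  intros z hz hd.
  assert (hd1 := Rlt_le_trans _ _ _ hd (Rmin_l _ _)); assert (hd2 := Rlt_le_trans _ _ _ hd (Rmin_r _ _)).
  assert (az := Cmod_ge_0 z).
  assert (hg : growth (Cmod z) <= M) by (apply growth_mono; lra).
  assert (t1 := nrm_triangle_sub (sgp z f) (sgp z u) f).
  assert (t2 := nrm_triangle_sub (sgp z u) u f).
  rewrite (nrm_csub_sym u f) in t2.
  assert (b1 := bl_lipschitz _ _ f u (sgp_bl z hz)).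
  assert (b2 := sgp_dist_id z u v hz hu).
  assert (hfu := nrm_ge0 p (f - u)%V).
  assert (b3 : growth (Cmod z) * nrm (f - u)%V <= M * nrm (f - u)%V) by (apply Rmult_le_compat_r; lra).
  assert (b4 : (M + 1) * nrm (f - u)%V < eps / 2).
  { apply Rlt_le_trans with ((M + 1) * (eps / (2 * (M + 1)))).
    - apply Rmult_lt_compat_l; lra.
    - right; field; lra. }
  assert (b5 : 2 * growth (Cmod z) * Cmod z * nrm v <= (2 * M * nrm v + 1) * Cmod z).
  { assert (growth (Cmod z) * (Cmod z * nrm v) <= M * (Cmod z * nrm v)).
    { apply Rmult_le_compat_r; auto; apply Rmult_le_pos; auto. }
    nra. }
  assert (b6 : (2 * M * nrm v + 1) * Cmod z <= eps / 2).
  { apply Rle_trans with ((2 * M * nrm v + 1) * (eps / 2 / (2 * M * nrm v + 1))).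
    - apply Rmult_le_compat_l; lra.
    - right; field; lra. }
  lra.
Qed.

Lemma sgp_generator f g :
  G f g <->
  (forall eps, 0 < eps -> exists del, 0 < del /\ forall t, 0 < t < del ->
     nrm (/ RtoC t * (sgp (RtoC t) f - f) - g)%V < eps).
Proof.
  assert (hfwd : forall f g, G f g -> forall eps, 0 < eps -> exists del, 0 < del /\
    forall t, 0 < t < del -> nrm (/ RtoC t * (sgp (RtoC t) f - f) - g)%V < eps).
  { clear f g; intros f g hG eps heps; set (M := growth 1).
    assert (hM : 1 <= M) by (apply growth_ge1; lra).
    destruct (G_dense g (eps / (2 * (M + 1)))) as [v' [x' [y' [hv' [_ hg]]]]].
    { apply Rdiv_lt_0_compat; lra. }
    assert (hx0 := nrm_ge0 p x').
    assert (hpos : 0 < 2 * M * nrm x' + 1).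
    { assert (0 <= M * nrm x') by (apply Rmult_le_pos; lra); lra. }
    exists (Rmin 1 (eps / 2 / (2 * M * nrm x' + 1))); split.
    { apply Rmin_pos; [lra|]; apply Rdiv_lt_0_compat; lra. }
    intros t [ht hd].
    assert (hd1 := Rlt_le_trans _ _ _ hd (Rmin_l _ _)); assert (hd2 := Rlt_le_trans _ _ _ hd (Rmin_r _ _)).
    assert (ht0 : RtoC t <> RtoC 0) by (intros e; apply RtoC_inj in e; lra).
    assert (hT := sgp_taylor (RtoC t) f g v' x' (csector_real t (Rlt_le _ _ ht)) hG hv').
    rewrite Cmod_R, Rabs_pos_eq in hT by lra.
    assert (hgr : growth t <= M) by (apply growth_mono; lra).
    replace (/ RtoC t * (sgp (RtoC t) f - f) - g)%V with
      (/ RtoC t * (sgp (RtoC t) f - (f + RtoC t * g)))%V.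
    2:{ apply cvec_ext; intros i; rewrite ?cscal_val, ?csub_val, ?cscal_val, ?csub_val, ?cadd_val, ?cscal_val;
        field; auto. }
    rewrite nrm_cscal, <- RtoC_inv, Cmod_R, Rabs_pos_eq by (try apply Rlt_le, Rinv_0_lt_compat; lra).
    apply Rmult_lt_reg_l with t; auto.
    rewrite <- Rmult_assoc, Rinv_r, Rmult_1_l by lra.
    eapply Rle_lt_trans; [apply hT|].
    apply Rmult_lt_compat_l; auto.
    assert (hn0 := nrm_ge0 p (g - v')%V).
    assert (b3 : (growth t + 1) * nrm (g - v')%V <= (M + 1) * nrm (g - v')%V) by (apply Rmult_le_compat_r; lra).
    assert (b4 : (M + 1) * nrm (g - v')%V < eps / 2).
    { apply Rlt_le_trans with ((M + 1) * (eps / (2 * (M + 1)))).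
      - apply Rmult_lt_compat_l; lra.
      - right; field; lra. }
    assert (b5 : 2 * growth t * t * nrm x' <= (2 * M * nrm x' + 1) * t).
    { assert (growth t * (t * nrm x') <= M * (t * nrm x')).
      { apply Rmult_le_compat_r; auto; apply Rmult_le_pos; lra. }
      nra. }
    assert (b6 : (2 * M * nrm x' + 1) * t <= eps / 2).
    { apply Rle_trans with ((2 * M * nrm x' + 1) * (eps / 2 / (2 * M * nrm x' + 1))).
      - apply Rmult_le_compat_l; lra.
      - right; field; lra. }
    lra. }
  (* Converse: [w = A (J f)] is the derivative at 0 of the orbit of [J f]. As [J] is bounded and
     commutes with the semigroup, this derivative is also [J g]. Then [J f = f + h * J g], which
     characterises the graph. *)
  split; [apply hfwd|]; intros hlim.
  set (Jh := J (RtoC hstar)).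
  assert (blJ : bounded_linear Jh 2) by (apply J_bl2, hstar_small).
  destruct (J_spec (RtoC hstar) f hstar_small hstar_neq0) as [w [hw ew]]; fold Jh in hw, ew.
  apply G_iff; fold Jh.
  replace (Jh g) with w.
  { rewrite <- ew at 2; cvec_ring. }
  apply csub_eq0, Rnot_lt_le; intros hlt.
  set (e := nrm (w - Jh g)%V) in *.
  destruct (hlim (e / 4)) as [d1 [hd1 hl1]]; [lra|].
  destruct (hfwd _ _ hw (e / 4)) as [d2 [hd2 hl2]]; [lra|].
  set (t := Rmin d1 d2 / 2).
  assert (hmin : 0 < Rmin d1 d2) by (apply Rmin_pos; auto).
  assert (hm1 := Rmin_l d1 d2); assert (hm2 := Rmin_r d1 d2).
  specialize (hl1 t ltac:(unfold t; lra)); specialize (hl2 t ltac:(unfold t; lra)).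
  assert (ht : csector (RtoC t)) by (apply csector_real; unfold t; lra).
  assert (b := proj2 blJ (/ RtoC t * (sgp (RtoC t) f - f) - g)%V).
  rewrite (bl_sub _ _ _ _ blJ), (bl_scal _ _ _ _ blJ), (bl_sub _ _ _ _ blJ) in b.
  unfold Jh in b; rewrite sgp_J_comm in b by auto using hstar_small; fold Jh in b.
  assert (tr := nrm_triangle_sub w (/ RtoC t * (sgp (RtoC t) (Jh f) - Jh f))%V (Jh g)); fold e in tr.
  rewrite (nrm_csub_sym w (/ RtoC t * (sgp (RtoC t) (Jh f) - Jh f))%V) in tr.
  lra.
Qed.

(* Dissipativity makes [n |-> |J^n u|] drop by [c |h| |A J^n u|] at each step, while
   [|A J^n u|] itself does not grow; summing up gives the analytic smoothing estimate. *)
Lemma euler_smoothing n z u v : csector z -> fine n z -> G u v ->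
  c * Cmod z * nrm (euler n z v) <= growth (Cmod z) * (1 + K * Cmod z * growth (Cmod z)) * nrm u.
Proof.
  intros hz hn hG; unfold euler.
  assert (hs := fine_small _ _ hz hn).
  assert (hn' := lt_0_INR _ (proj1 hn)).
  set (M := growth (Cmod z)); set (h := (z * RtoC (/ INR n))%C) in *.
  assert (az := Cmod_ge_0 z).
  assert (ah : Cmod h = Cmod z / INR n) by (apply Cmod_step, hn).
  assert (ah0 := Cmod_ge_0 h).
  assert (hM : 1 <= M) by (apply growth_ge1; auto).
  set (B := nrm (Nat.iter n (J h) v)).
  assert (hB : forall k, (k <= n)%nat -> B <= M * nrm (Nat.iter k (J h) v)).
  { intros k hk; unfold B; replace n with ((n - k) + k)%nat by lia.
    rewrite Nat.iter_add; apply iter_bl; auto; lia. }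
  assert (hU : forall k, (k <= n)%nat -> nrm (Nat.iter k (J h) u) <= M * nrm u).
  { intros k hk; apply iter_bl; auto. }
  (* [B] is the last of the norms [|A u_k|]. The inequality is multiplied by [M] so that [hB] can
     replace every [M |A u_k|] by [B]. *)
  assert (hT : forall k, (k <= n)%nat ->
    M * nrm (Nat.iter k (J h) u) + INR k * (c * Cmod h * B) <= M * nrm u + INR k * (K * Cmod h * (M * (M * nrm u)))).
  { induction k as [|k IH]; intros hk; [simpl; lra|].
    specialize (IH ltac:(lia)).
    destruct (J_G h _ _ hs (iter_G k h u v hs hG)) as [hG1 e].
    assert (d := G_diss h _ _ hs hG1).
    replace (J h (Nat.iter k (J h) u) - h * J h (Nat.iter k (J h) v))%V with (Nat.iter k (J h) u) in d
      by (rewrite e at 1; cvec_ring).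
    specialize (hB _ hk); specialize (hU _ hk).
    simpl Nat.iter in hB, hU |- *.
    rewrite S_INR.
    assert (k1 : K * Cmod h * nrm (J h (Nat.iter k (J h) u)) <= K * Cmod h * (M * nrm u)).
    { apply Rmult_le_compat_l; auto; apply Rmult_le_pos; auto. }
    assert (k2 : c * Cmod h * B <= c * Cmod h * (M * nrm (J h (Nat.iter k (J h) v)))).
    { apply Rmult_le_compat_l; auto; apply Rmult_le_pos; lra. }
    assert (k3 : M * (nrm (J h (Nat.iter k (J h) u)) + c * Cmod h * nrm (J h (Nat.iter k (J h) v))) <=
       M * (nrm (Nat.iter k (J h) u) + K * Cmod h * (M * nrm u))).
    { apply Rmult_le_compat_l; lra. }
    lra. }
  specialize (hT n (Nat.le_refl n)).
  assert (e : INR n * Cmod h = Cmod z) by (rewrite ah; field; lra).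
  replace (INR n * (c * Cmod h * B)) with (c * Cmod z * B) in hT by (rewrite <- e; ring).
  replace (INR n * (K * Cmod h * (M * (M * nrm u)))) with (K * Cmod z * (M * (M * nrm u))) in hT
    by (rewrite <- e; ring).
  assert (0 <= M * nrm (Nat.iter n (J h) u)) by (apply Rmult_le_pos; [lra|apply nrm_ge0]).
  lra.
Qed.

(** * Smoothing and complex differentiability *)

Definition smoothing (r : R) : R := growth r * (1 + K * r * growth r) / (c * r).

Lemma smoothing_ge0 r : 0 < r -> 0 <= smoothing r.
Proof.
  intros hr; apply Rle_div_r; [apply Rmult_lt_0_compat; auto|].
  assert (hg := growth_ge1 r (Rlt_le _ _ hr)).
  assert (0 <= K * r * growth r) by (repeat apply Rmult_le_pos; lra).
  rewrite Rmult_0_l; apply Rmult_le_pos; lra.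
Qed.

Lemma sgp_smoothing_dom z u v : csector z -> z <> RtoC 0 -> G u v ->
  nrm (sgp z v) <= smoothing (Cmod z) * nrm u.
Proof.
  intros hz z0 hG; apply Cmod_gt_0 in z0.
  destruct (fine_eventually z) as [k0 hk0].
  apply (tends_nrm_le (fun k => euler (2 ^ k) z v)); [apply sgp_limit; auto|].
  exists k0; intros k hk.
  assert (h := euler_smoothing _ _ u v hz (hk0 k hk) hG).
  assert (cz : 0 < c * Cmod z) by (apply Rmult_lt_0_compat; auto).
  apply Rmult_le_reg_l with (c * Cmod z); auto.
  eapply Rle_trans; [apply h|]; unfold smoothing; right; field; lra.
Qed.

(** For [u_n] in the domain with [u_n -> f], the bound applied to differences makes [A T(z) u_n] a
    Cauchy sequence, and [A] is closed. *)
Lemma sgp_smoothing z f : csector z -> z <> RtoC 0 ->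
  exists q, G (sgp z f) q /\ nrm q <= smoothing (Cmod z) * nrm f.
Proof.
  intros hz z0.
  set (C0 := smoothing (Cmod z)).
  assert (hC0 : 0 <= C0) by (apply smoothing_ge0, Cmod_gt_0; auto).
  assert (hseq : forall n : nat, exists uv, G (fst uv) (snd uv) /\ nrm (f - fst uv)%V < / (INR n + 1)).
  { intros n; destruct (G_dense f (/ (INR n + 1))) as [u [v [x [hu [_ hf]]]]].
    - apply Rinv_0_lt_compat; assert (h := pos_INR n); lra.
    - exists (u, v); auto. }
  pose (uv := fun n => proj1_sig (constructive_indefinite_description _ (hseq n))).
  assert (huv : forall n, G (fst (uv n)) (snd (uv n)) /\ nrm (f - fst (uv n))%V < / (INR n + 1))
    by (intros n; apply (proj2_sig (constructive_indefinite_description _ (hseq n)))).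
  clearbody uv; clear hseq.
  assert (hsm : forall eps, 0 < eps -> exists N, forall n, (N <= n)%nat -> / (INR n + 1) < eps).
  { intros eps heps; destruct (INR_unbounded (/ eps)) as [N hN]; exists N; intros n hn.
    assert (hn' := le_INR _ _ hn); assert (hi := Rinv_0_lt_compat _ heps).
    rewrite <- (Rinv_inv eps); apply Rinv_lt_contravar; [apply Rmult_lt_0_compat|]; lra. }
  assert (hu : tends (fun n => fst (uv n)) f).
  { intros eps heps; destruct (hsm eps heps) as [N hN]; exists N; intros n hn.
    rewrite nrm_csub_sym; eapply Rlt_trans; [apply huv|auto]. }
  destruct (cvec_complete (fun n => sgp z (snd (uv n)))) as [q hq].
  { intros eps heps; destruct (hsm (eps / (2 * (C0 + 1)))) as [N hN]; [apply Rdiv_lt_0_compat; lra|].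
    exists N; intros n m hn hm.
    rewrite <- (bl_sub _ _ _ _ (sgp_bl z hz)).
    destruct (huv n) as [g1 d1]; destruct (huv m) as [g2 d2].
    eapply Rle_lt_trans; [apply (sgp_smoothing_dom z _ _ hz z0 (G_sub _ _ _ _ g1 g2))|]; fold C0.
    assert (t := nrm_triangle_sub (fst (uv n)) f (fst (uv m))).
    rewrite (nrm_csub_sym (fst (uv n)) f) in t.
    assert (h1 := hN n hn); assert (h2 := hN m hm).
    assert (h0 := nrm_ge0 p (fst (uv n) - fst (uv m))%V).
    apply Rle_lt_trans with ((C0 + 1) * nrm (fst (uv n) - fst (uv m))%V); [lra|].
    apply Rlt_le_trans with ((C0 + 1) * (2 * (eps / (2 * (C0 + 1))))).
    - apply Rmult_lt_compat_l; lra.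
    - right; field; lra. }
  exists q; split.
  - apply (G_closed (fun n => sgp z (fst (uv n))) (fun n => sgp z (snd (uv n)))); auto.
    + intros n; apply sgp_G; auto; apply huv.
    + apply (bl_tends _ (growth (Cmod z))); auto; apply sgp_bl; auto.
  - apply Rle_plus_epsilon; intros eps heps.
    apply (tends_nrm_le _ _ _ hq).
    destruct (hu (eps / (C0 + 1))) as [N hN]; [apply Rdiv_lt_0_compat; lra|].
    exists N; intros n hn; specialize (hN n hn).
    eapply Rle_trans; [apply (sgp_smoothing_dom z _ _ hz z0 (proj1 (huv n)))|]; fold C0.
    replace (fst (uv n)) with ((fst (uv n) - f) + f)%V by cvec_ring.
    assert (t := nrm_cadd p (fst (uv n) - f)%V f).
    assert (h0 := nrm_ge0 p (fst (uv n) - f)%V).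
    assert (h3 : (C0 + 1) * nrm (fst (uv n) - f)%V <= eps).
    { apply Rle_trans with ((C0 + 1) * (eps / (C0 + 1))).
      - apply Rmult_le_compat_l; lra.
      - right; field; lra. }
    assert (h4 : C0 * nrm (fst (uv n) - f + f)%V <= C0 * (nrm (fst (uv n) - f)%V + nrm f))
      by (apply Rmult_le_compat_l; auto).
    lra.
Qed.

(** [T(z) = T(z/2) T(z/2)], and each factor gains one power of [A]. *)
Lemma sgp_smoothing_sq z f : csector z -> z <> RtoC 0 ->
  exists v x, G (sgp z f) v /\ G v x /\ nrm x <= smoothing (Cmod z / 2) ^ 2 * nrm f.
Proof.
  intros hz z0.
  set (w := (z * RtoC (/ 2))%C).
  assert (hw : csector w) by (apply csector_scale; auto; lra).
  assert (ew : (w + w)%C = z).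
  { unfold w; destruct z as [a b]; unfold Cplus, Cmult, RtoC; simpl; f_equal; field. }
  assert (cw : Cmod w = Cmod z / 2) by (unfold w; rewrite Cmod_mult, Cmod_R, Rabs_pos_eq; lra).
  assert (az : 0 < Cmod z) by (apply Cmod_gt_0; auto).
  assert (w0 : w <> RtoC 0) by (apply Cmod_gt_0; lra).
  destruct (sgp_smoothing w f hw w0) as [v [hv nv]].
  destruct (sgp_smoothing w v hw w0) as [x [hx nx]].
  exists (sgp w v), x; split; [|split]; auto.
  - rewrite <- ew, sgp_add by auto; apply sgp_G; auto.
  - rewrite cw in nv, nx.
    assert (h := smoothing_ge0 (Cmod z / 2) ltac:(lra)).
    eapply Rle_trans; [apply nx|].
    eapply Rle_trans; [apply Rmult_le_compat_l; [auto|apply nv]|]; right; ring.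
Qed.

Lemma sgp_taylor2 z u v x : csector z -> G u v -> G v x ->
  nrm (sgp z u - (u + z * v))%V <= 2 * growth (Cmod z) * Cmod z ^ 2 * nrm x.
Proof.
  intros hz hu hv; eapply Rle_trans; [apply (sgp_taylor z u v v x); auto|].
  replace (v - v)%V with (0 : cvec p)%V by cvec_ring; rewrite nrm_czero; right; ring.
Qed.

(* A displacement [h] leaving the sector is written as [(e + h) - e] with [e > 0] comparable to
   [|h|], so that only Taylor expansions inside the sector are needed. *)
Lemma sgp_derivative z : 0 < Re z -> Rabs (Im z) < tau * Re z ->
  exists L del, 0 < del /\ forall h f q, Cmod h < del -> G (sgp z f) q ->
    nrm (sgp (z + h)%C f - sgp z f - h * q)%V <= L * Cmod h ^ 2 * nrm f.
Proof.
  intros hre him.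
  assert (hit : 0 < / tau) by (apply Rinv_0_lt_compat; auto).
  (* Chosen so that [tau (e - |h|) = |h|] for [e = beta |h|], which puts [e + h] in the sector for
     every direction of [h]. *)
  set (beta := 1 + / tau).
  assert (az : 0 < Cmod z).
  { assert (h := re_le_Cmod z); rewrite Rabs_pos_eq in h; lra. }
  (* The largest [e] for which [z - e] is still in the closed sector. *)
  set (mu := (tau * Re z - Rabs (Im z)) / tau).
  assert (hmu : 0 < mu) by (apply Rdiv_lt_0_compat; lra).
  (* Makes [e + |h| = (beta + 1) |h|] at most [mu] and at most [|z| / 2]; the latter keeps [z - e]
     away from 0. *)
  set (del := Rmin mu (Cmod z / 2) / (beta + 1)).
  assert (hbeta : 1 < beta) by (unfold beta; lra).
  assert (hdel : 0 < del) by (apply Rdiv_lt_0_compat; [apply Rmin_pos|]; lra).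
  assert (hdb : (beta + 1) * del = Rmin mu (Cmod z / 2)) by (unfold del; field; lra).
  assert (hd1 := Rmin_l mu (Cmod z / 2)); assert (hd2 := Rmin_r mu (Cmod z / 2)).
  set (M := growth (Cmod z)).
  (* [smoothing] with its increasing factors frozen at [2 |z|]. It is decreasing in [r], so its
     value at [|z| / 4] bounds [smoothing (|zeta| / 2)] for all [zeta] that occur. *)
  set (sm := fun r => growth (2 * Cmod z) * (1 + K * (2 * Cmod z) * growth (2 * Cmod z)) / (c * r)).
  set (X := sm (Cmod z / 4) ^ 2).
  exists (2 * M * ((beta + 1) ^ 2 + beta ^ 2 + beta) * X), del; split; auto.
  intros h f q hh hq.
  assert (ah := Cmod_ge_0 h).
  set (e := beta * Cmod h).
  assert (he0 : 0 <= e) by (apply Rmult_le_pos; lra).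
  assert (hed : e + Cmod h <= Rmin mu (Cmod z / 2)).
  { rewrite <- hdb; unfold e; nra. }
  set (zeta := (z - RtoC e)%C).
  assert (hse : csector (RtoC e)) by (apply csector_real; auto).
  assert (hseh : csector (RtoC e + h)%C).
  { unfold csector; replace (Re (RtoC e + h)%C) with (e + Re h) by reflexivity.
    replace (Im (RtoC e + h)%C) with (0 + Im h) by reflexivity; rewrite Rplus_0_l.
    assert (h1 := re_le_Cmod h); assert (h2 := im_le_Cmod h).
    assert (h3 : - Cmod h <= Re h) by (assert (h4 := Rle_abs (- Re h)); rewrite Rabs_Ropp in h4; lra).
    apply Rle_trans with (tau * (e - Cmod h)).
    - unfold e, beta; replace (tau * ((1 + / tau) * Cmod h - Cmod h)) with (Cmod h) by (field; lra); auto.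
    - apply Rmult_le_compat_l; lra. }
  assert (hsz : csector zeta).
  { unfold csector, zeta.
    replace (Re (z - RtoC e)%C) with (Re z - e) by reflexivity.
    replace (Im (z - RtoC e)%C) with (Im z) by (unfold Im, Cminus, Cplus, Copp, RtoC; simpl; ring).
    assert (tau * e <= tau * mu) by (apply Rmult_le_compat_l; lra).
    replace (tau * mu) with (tau * Re z - Rabs (Im z)) in H by (unfold mu; field; lra); lra. }
  assert (hee : Cmod (RtoC e) = e) by (rewrite Cmod_R, Rabs_pos_eq; auto).
  assert (az1 : Cmod z / 2 <= Cmod zeta).
  { assert (t := Cmod_triangle zeta (RtoC e)).
    replace (zeta + RtoC e)%C with z in t by (unfold zeta; ring); lra. }
  assert (az2 : Cmod zeta <= 2 * Cmod z).
  { unfold zeta; apply Rle_trans with (Cmod z + e); [|lra].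
    eapply Rle_trans; [apply Cmod_triangle|]; rewrite Cmod_opp, hee; lra. }
  assert (zeta0 : zeta <> RtoC 0) by (apply Cmod_gt_0; lra).
  destruct (sgp_smoothing_sq zeta f hsz zeta0) as [v [x [hv [hx nx]]]].
  set (u := sgp zeta f) in *.
  assert (nx' : nrm x <= X * nrm f).
  { eapply Rle_trans; [apply nx|]; apply Rmult_le_compat_r; [apply nrm_ge0|].
    apply pow_incr; split; [apply smoothing_ge0; lra|].
    unfold sm, smoothing.
    assert (g1 : growth (Cmod zeta / 2) <= growth (2 * Cmod z)) by (apply growth_mono; lra).
    assert (g0 : 1 <= growth (Cmod zeta / 2)) by (apply growth_ge1; lra).
    assert (g2 : K * (Cmod zeta / 2) * growth (Cmod zeta / 2) <= K * (2 * Cmod z) * growth (2 * Cmod z)).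
    { apply Rmult_le_compat; try lra; [apply Rmult_le_pos; lra|apply Rmult_le_compat_l; lra]. }
    assert (g3 : 0 <= K * (Cmod zeta / 2) * growth (Cmod zeta / 2)).
    { repeat apply Rmult_le_pos; lra. }
    apply Rmult_le_compat.
    - apply Rmult_le_pos; lra.
    - apply Rlt_le, Rinv_0_lt_compat, Rmult_lt_0_compat; lra.
    - apply Rmult_le_compat; lra.
    - apply Rinv_le_contravar; [apply Rmult_lt_0_compat|apply Rmult_le_compat_l]; lra. }
  assert (e1 : sgp (z + h)%C f = sgp (RtoC e + h)%C u).
  { unfold u; rewrite <- sgp_add by auto; f_equal; unfold zeta; ring. }
  assert (e2 : sgp z f = sgp (RtoC e) u).
  { unfold u; rewrite <- sgp_add by auto; f_equal; unfold zeta; ring. }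
  assert (e3 : q = sgp (RtoC e) v).
  { apply (G_fun (sgp z f)); auto; rewrite e2; apply sgp_G; auto. }
  rewrite e1, e2, e3.
  (* The first-order terms in [v = A u] cancel, leaving two quadratic Taylor remainders at [u] and
     [h] times a first-order one at [v]. *)
  replace (sgp (RtoC e + h)%C u - sgp (RtoC e) u - h * sgp (RtoC e) v)%V with
    (((sgp (RtoC e + h)%C u - (u + (RtoC e + h)%C * v)) - (sgp (RtoC e) u - (u + RtoC e * v)))
     - h * (sgp (RtoC e) v - v))%V by cvec_ring.
  assert (ae : Cmod (RtoC e + h)%C <= (beta + 1) * Cmod h).
  { eapply Rle_trans; [apply Cmod_triangle|]; rewrite hee; unfold e; lra. }
  assert (b1 := sgp_taylor2 _ u v x hseh hv hx).
  assert (b2 := sgp_taylor2 _ u v x hse hv hx).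
  assert (b3 := sgp_dist_id _ v x hse hx).
  rewrite hee in b2, b3.
  assert (gM : 1 <= M) by (apply growth_ge1; lra).
  assert (ge : growth e <= M) by (apply growth_mono; lra).
  assert (geh : growth (Cmod (RtoC e + h)%C) <= M).
  { apply growth_mono; eapply Rle_trans; [apply Cmod_triangle|]; rewrite hee; lra. }
  assert (nx0 := nrm_ge0 p x).
  assert (aeh0 := Cmod_ge_0 (RtoC e + h)%C).
  set (Y := X * nrm f) in *.
  assert (Y0 : 0 <= Y) by lra.
  assert (c1 : nrm (sgp (RtoC e + h)%C u - (u + (RtoC e + h)%C * v))%V <= 2 * M * ((beta + 1) * Cmod h) ^ 2 * Y).
  { eapply Rle_trans; [apply b1|].
    assert (g0 : 0 < growth (Cmod (RtoC e + h)%C)) by apply exp_pos.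
    apply Rmult_le_compat; auto.
    - apply Rmult_le_pos; [lra|apply pow2_ge_0].
    - apply Rmult_le_compat; try lra; [apply pow2_ge_0|apply pow_incr; lra]. }
  assert (g0 : 0 < growth e) by apply exp_pos.
  assert (c2 : nrm (sgp (RtoC e) u - (u + RtoC e * v))%V <= 2 * M * e ^ 2 * Y).
  { eapply Rle_trans; [apply b2|].
    apply Rmult_le_compat; auto.
    - apply Rmult_le_pos; [lra|apply pow2_ge_0].
    - apply Rmult_le_compat; try lra; apply pow2_ge_0. }
  assert (c3 : nrm (sgp (RtoC e) v - v)%V <= 2 * M * e * Y).
  { eapply Rle_trans; [apply b3|].
    apply Rmult_le_compat; auto; [apply Rmult_le_pos; lra|apply Rmult_le_compat; lra]. }
  eapply Rle_trans; [apply nrm_csub|]; rewrite nrm_cscal.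
  assert (c4 := nrm_csub p (sgp (RtoC e + h)%C u - (u + (RtoC e + h)%C * v))%V (sgp (RtoC e) u - (u + RtoC e * v))%V).
  assert (c5 : Cmod h * nrm (sgp (RtoC e) v - v)%V <= Cmod h * (2 * M * e * Y)) by (apply Rmult_le_compat_l; auto).
  replace (2 * M * ((beta + 1) ^ 2 + beta ^ 2 + beta) * X * Cmod h ^ 2 * nrm f) with
    (2 * M * ((beta + 1) * Cmod h) ^ 2 * Y + 2 * M * e ^ 2 * Y + Cmod h * (2 * M * e * Y))
    by (unfold Y, e; ring).
  lra.
Qed.

Definition cone_closed (Cone : cvec p -> Prop) : Prop :=
  forall u l, (forall n, Cone (u n)) -> tends u l -> Cone l.

(** [Cone] stands for any closed set that resolvents with small positive real step preserve; it will
    be the set of nonnegative sequences. *)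
Theorem sectorial_generation (Cone : cvec p -> Prop) :
  cone_closed Cone ->
  (forall h y, 0 < h -> small_step (RtoC h) -> Cone y ->
     exists u v, G u v /\ (u - RtoC h * v)%V = y /\ Cone u) ->
  exists T : C -> cvec p -> cvec p,
    (forall z, csector z -> exists M, bounded_linear (T z) M) /\
    (forall f, T (RtoC 0) f = f) /\
    (forall z w f, csector z -> csector w -> T (z + w)%C f = T z (T w f)) /\
    (forall f eps, 0 < eps -> exists del, 0 < del /\
       forall z, csector z -> Cmod z < del -> nrm (T z f - f)%V < eps) /\
    (forall f g, G f g <-> (forall eps, 0 < eps -> exists del, 0 < del /\ forall t, 0 < t < del ->
       nrm (/ RtoC t * (T (RtoC t) f - f) - g)%V < eps)) /\
    (forall z, 0 < Re z -> Rabs (Im z) < tau * Re z -> exists D L del, 0 < del /\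
       forall h f, Cmod h < del ->
         nrm (T (z + h)%C f - T z f - h * D f)%V <= L * Cmod h ^ 2 * nrm f) /\
    (forall t f, 0 <= t -> Cone f -> Cone (T (RtoC t) f)).
Proof.
  intros hcl hres; exists sgp; repeat split.
  - intros z hz; exists (growth (Cmod z)); apply sgp_bl; auto.
  - apply sgp_at_0.
  - intros; apply sgp_add; auto.
  - apply sgp_continuous_0.
  - apply sgp_generator.
  - apply sgp_generator.
  - intros z hre him.
    assert (z0 : z <> RtoC 0) by (intros ->; simpl in hre; lra).
    assert (hz : csector z) by (apply Rlt_le; auto).
    pose (D := fun f => proj1_sig (constructive_indefinite_description _ (sgp_smoothing z f hz z0))).
    destruct (sgp_derivative z hre him) as [L [del [hdel hL]]].
    exists D, L, del; split; auto; intros h f hh; apply hL; auto.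
    apply (proj2_sig (constructive_indefinite_description _ (sgp_smoothing z f hz z0))).
  - intros t f ht hf; apply sgp_preserves; auto.
    intros h y [hpos|<-] hs hy; [|rewrite J0; auto].
    destruct (hres h y hpos hs hy) as [u [v [hG [e hu]]]].
    rewrite <- e, J_unique; auto.
Qed.

End Generation.

(** * Kernel operators *)

Definition CSeries (u : nat -> C) : C :=
  (Series (fun k => Re (u k)), Series (fun k => Im (u k))).

Lemma ex_series_dominated (u v : nat -> R) :
  (forall n, Rabs (u n) <= v n) -> ex_series v -> ex_series u.
Proof. intros h hv; apply (@ex_series_le _ R_CompleteNormedModule u v); auto. Qed.

Lemma ex_series_re (u : nat -> C) : ex_series (fun k => Cmod (u k)) -> ex_series (fun k => Re (u k)).
Proof. intros h; apply ex_series_dominated with (fun k => Cmod (u k)); auto using re_le_Cmod. Qed.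

Lemma ex_series_im (u : nat -> C) : ex_series (fun k => Cmod (u k)) -> ex_series (fun k => Im (u k)).
Proof. intros h; apply ex_series_dominated with (fun k => Cmod (u k)); auto using im_le_Cmod. Qed.

Lemma CSeries_lin (u v : nat -> C) (b : C) :
  ex_series (fun k => Cmod (u k)) -> ex_series (fun k => Cmod (v k)) ->
  CSeries (fun k => u k + b * v k)%C = (CSeries u + b * CSeries v)%C.
Proof.
  intros hu hv.
  assert (ru := ex_series_re u hu); assert (iu := ex_series_im u hu).
  assert (rv := ex_series_re v hv); assert (iv := ex_series_im v hv).
  assert (hs : forall r (w : nat -> R), ex_series w -> ex_series (fun k => r * w k))
    by (intros r w; apply (ex_series_scal_l (V := R_NormedModule))).
  unfold CSeries; apply injective_projections; simpl.
  - rewrite <- !Series_scal_l.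
    rewrite <- Series_minus, <- Series_plus by (auto; apply (ex_series_minus (V := R_NormedModule)); auto).
    apply Series_ext; reflexivity.
  - rewrite <- !Series_scal_l.
    rewrite <- !Series_plus by (auto; apply (ex_series_plus (V := R_NormedModule)); auto).
    apply Series_ext; reflexivity.
Qed.

Lemma CSeries_ext (u v : nat -> C) : (forall k, u k = v k) -> CSeries u = CSeries v.
Proof. intros h; unfold CSeries; f_equal; apply Series_ext; intros k; rewrite h; auto. Qed.

Lemma CSeries_scal (u : nat -> C) (b : C) : ex_series (fun k => Cmod (u k)) ->
  CSeries (fun k => b * u k)%C = (b * CSeries u)%C.
Proof.
  intros hu.
  assert (h0 : ex_series (fun _ : nat => Cmod (RtoC 0))).
  { apply (nonneg_series_bounded _ 0); intros n; rewrite Cmod_0; [lra|].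
    rewrite sum_n_const; lra. }
  assert (e : CSeries (fun _ => RtoC 0) = RtoC 0).
  { assert (z : Series (fun _ => 0) = 0).
    { rewrite (Series_ext _ (fun _ => 0 * 0)) by (intros; ring); rewrite Series_scal_l; ring. }
    unfold CSeries, RtoC; f_equal; exact z. }
  rewrite (CSeries_ext _ (fun k => RtoC 0 + b * u k)%C) by (intros; ring).
  rewrite (CSeries_lin (fun _ => RtoC 0) u b h0 hu), e; ring.
Qed.

(* The sum is rotated to the positive half-line, where its modulus is its real part. *)
Lemma Cmod_CSeries_le (u : nat -> C) :
  ex_series (fun k => Cmod (u k)) -> Cmod (CSeries u) <= Series (fun k => Cmod (u k)).
Proof.
  intros hu; set (s := CSeries u).
  destruct (excluded_middle_informative (s = RtoC 0)) as [-> | h0].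
  - rewrite Cmod_0; apply Series_nonneg; auto using Cmod_ge_0.
  - assert (hs : 0 < Cmod s) by (apply Cmod_gt_0; auto).
    set (a := (Cconj s * RtoC (/ Cmod s))%C).
    assert (ha : Cmod a = 1).
    { unfold a; rewrite Cmod_mult, Cmod_conj, Cmod_R, Rabs_pos_eq; [field; lra|].
      apply Rlt_le, Rinv_0_lt_compat; auto. }
    assert (e : (a * s)%C = RtoC (Cmod s)).
    { unfold a; rewrite <- Cmult_assoc, (Cmult_comm (RtoC _)), Cmult_assoc, (Cmult_comm (Cconj s)), <- Cmod2_conj.
      rewrite <- RtoC_mult; f_equal; field; lra. }
    apply Rle_trans with (Re (CSeries (fun k => a * u k)%C)).
    + rewrite CSeries_scal by auto; fold s; rewrite e; simpl; lra.
    + assert (hb : forall k, Re (a * u k)%C <= Cmod (u k)).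
      { intros k; eapply Rle_trans; [apply Rle_abs|]; eapply Rle_trans; [apply re_le_Cmod|].
        rewrite Cmod_mult, ha; lra. }
      assert (hr : ex_series (fun k => Re (a * u k)%C)).
      { apply ex_series_re, (ex_series_ext (fun k => Cmod (u k))); auto.
        intros k; rewrite Cmod_mult, ha, Rmult_1_l; reflexivity. }
      assert (hd : 0 <= Series (fun k => Cmod (u k) - Re (a * u k)%C)).
      { apply Series_nonneg; [intros k; specialize (hb k); lra|].
        apply (ex_series_minus (V := R_NormedModule)); auto. }
      rewrite Series_minus in hd by auto.
      change (Re (CSeries (fun k => (a * u k)%C))) with (Series (fun k => Re (a * u k)%C)); lra.
Qed.

Lemma sum_n_Series (u : nat -> nat -> R) (N : nat) :
  (forall i, ex_series (u i)) ->
  ex_series (fun k => sum_n (fun i => u i k) N) /\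
  Series (fun k => sum_n (fun i => u i k) N) = sum_n (fun i => Series (u i)) N.
Proof.
  intros h; induction N as [|N [IH1 IH2]].
  - split.
    + apply (ex_series_ext (u 0%nat)); auto; intros k; rewrite sum_O; auto.
    + rewrite sum_O; apply Series_ext; intros k; rewrite sum_O; auto.
  - split.
    + apply (ex_series_ext (fun k => sum_n (fun i => u i k) N + u (S N) k)).
      * intros k; rewrite sum_Sn; auto.
      * apply (ex_series_plus (V := R_NormedModule)); auto.
    + rewrite sum_Sn, <- IH2.
      rewrite (Series_ext _ (fun k => sum_n (fun i => u i k) N + u (S N) k))
        by (intros k; rewrite sum_Sn; auto).
      rewrite Series_plus; auto.
Qed.

Section KernelOperator.

Variable p : R.
Variable kern : nat -> nat -> R.
Variable m : nat -> R.

Hypothesis kern_ge0 : forall i j, 0 <= kern (S i) (S j).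
(** The column criterion for boundedness on weighted l^1, with [m] as a possibly unbounded
    multiplier. Stated on partial sums, it contains the summability of the columns. *)
Hypothesis kern_col : forall j N, sum_n (fun i => wgt p i * kern (S i) (S j)) N <= m (S j) * wgt p j.

Definition kapply (f : nat -> C) (i : nat) : C :=
  match i with
  | O => RtoC 0
  | S _ => CSeries (fun k => RtoC (kern i (S k)) * f (S k))%C
  end.

Definition msummable (f : nat -> C) : Prop :=
  ex_series (fun k => m (S k) * (wgt p k * Cmod (f (S k)))).

Lemma Cmod_kern i k (z : C) : Cmod (RtoC (kern (S i) (S k)) * z)%C = kern (S i) (S k) * Cmod z.
Proof. rewrite Cmod_mult, Cmod_R, Rabs_pos_eq; auto. Qed.

Lemma kern_entry i j : wgt p i * kern (S i) (S j) <= m (S j) * wgt p j.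
Proof.
  eapply Rle_trans; [|apply (kern_col j i)].
  apply (term_le_sum_n (fun i => wgt p i * kern (S i) (S j))); auto.
  intros n; apply Rmult_le_pos; auto; apply Rlt_le, wgt_pos.
Qed.

Lemma kapply_row_summable f i : msummable f ->
  ex_series (fun k => Cmod (RtoC (kern (S i) (S k)) * f (S k))%C).
Proof.
  intros hf.
  apply ex_series_dominated with (fun k => / wgt p i * (m (S k) * (wgt p k * Cmod (f (S k))))).
  - intros k; rewrite Rabs_pos_eq by apply Cmod_ge_0; rewrite Cmod_kern.
    assert (hw := wgt_pos p i).
    apply Rmult_le_reg_l with (wgt p i); auto.
    rewrite <- !Rmult_assoc, Rinv_r, Rmult_1_l by lra.
    apply Rmult_le_compat_r; [apply Cmod_ge_0|]; apply kern_entry.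
  - apply (ex_series_scal_l (V := R_NormedModule)); auto.
Qed.

(** Tonelli with finitely many rows at a time, so that only a finite sum is exchanged with a
    series. *)
Lemma kapply_bound f : msummable f ->
  inXC p (kapply f) /\ normXC p (kapply f) <= Series (fun k => m (S k) * (wgt p k * Cmod (f (S k)))).
Proof.
  intros hf.
  apply inXC_bounded; [reflexivity|]; intros N.
  set (r := fun i k => wgt p i * (kern (S i) (S k) * Cmod (f (S k)))).
  assert (hr : forall i, ex_series (r i)).
  { intros i; apply (ex_series_scal_l (V := R_NormedModule)).
    eapply ex_series_ext; [|apply (kapply_row_summable f i hf)].
    intros k; simpl; apply Cmod_kern. }
  apply Rle_trans with (sum_n (fun i => Series (r i)) N).
  - apply sum_n_R_le; intros i _; unfold r; rewrite Series_scal_l.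
    apply Rmult_le_compat_l; [apply Rlt_le, wgt_pos|].
    unfold kapply; eapply Rle_trans; [apply Cmod_CSeries_le, kapply_row_summable; auto|].
    right; apply Series_ext; intros k; apply Cmod_kern.
  - destruct (sum_n_Series r N hr) as [h1 h2]; rewrite <- h2.
    apply Series_le; auto; intros k; split.
    + eapply Rle_trans; [|apply (term_le_sum_n (fun i => r i k) N 0)]; try lia;
        intros; unfold r; repeat apply Rmult_le_pos; auto using Cmod_ge_0; apply Rlt_le, wgt_pos.
    + apply Rle_trans with (Cmod (f (S k)) * sum_n (fun i => wgt p i * kern (S i) (S k)) N).
      { right; rewrite <- (sum_n_mult_l (K := R_Ring)); apply sum_n_ext; intros i.
        unfold r, mult; simpl; ring. }
      eapply Rle_trans; [apply Rmult_le_compat_l; [apply Cmod_ge_0|apply (kern_col k N)]|].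
      right; ring.
Qed.

Lemma kapply_lin f g (b : C) i : msummable f -> msummable g ->
  kapply (fun i => f i + b * g i)%C i = (kapply f i + b * kapply g i)%C.
Proof.
  intros hf hg; destruct i as [|i]; simpl; [ring|].
  rewrite <- CSeries_lin by (apply kapply_row_summable; auto).
  apply CSeries_ext; intros k; ring.
Qed.

Lemma kapply_ext f g : (forall i, f (S i) = g (S i)) -> kapply f = kapply g.
Proof.
  intros h; apply functional_extensionality; intros [|i]; auto; simpl.
  apply CSeries_ext; intros k; rewrite h; auto.
Qed.

End KernelOperator.

(** * Relatively bounded perturbations of a diagonal operator *)

Lemma inXC_finite_support (p : R) (f : nat -> C) (N : nat) :
  f 0%nat = RtoC 0 -> (forall i, (N < i)%nat -> f i = RtoC 0) -> inXC p f.
Proof.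
  intros h0 hN; split; auto.
  apply (ex_series_incr_n _ N).
  apply (nonneg_series_bounded _ 0).
  - intros n; apply (wgt_Cmod_ge0 p f (N + n)).
  - intros n; right; rewrite <- (Rmult_0_r (INR (S n))), <- sum_n_const.
    apply sum_n_ext; intros k; rewrite hN, Cmod_0 by lia; apply Rmult_0_r.
Qed.

Definition truncate (N : nat) (f : nat -> C) (i : nat) : C := if (i <=? N)%nat then f i else RtoC 0.

Lemma truncate_inXC p (f : cvec p) N : inXC p (truncate N f).
Proof.
  apply inXC_finite_support with N.
  - unfold truncate; simpl; apply cval0.
  - intros i hi; unfold truncate; destruct (Nat.leb_spec i N); auto; lia.
Qed.

Lemma truncate_converges p (f : cvec p) eps : 0 < eps ->
  exists N, nrm (f - exist _ _ (truncate_inXC p f N))%V < eps.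
Proof.
  intros heps.
  set (a := fun k => wgt p k * Cmod (f (S k))).
  assert (ha : forall k, 0 <= a k) by apply wgt_Cmod_ge0.
  assert (hs := cval_series p f); fold a in hs.
  assert (hl : is_lim_seq (sum_n a) (Series a)) by (apply Series_correct; auto).
  apply is_lim_seq_spec in hl.
  destruct (hl (mkposreal (eps / 2) ltac:(lra))) as [N hN]; simpl in hN.
  specialize (hN N (Nat.le_refl N)).
  exists (S N); set (u := exist _ _ (truncate_inXC p f (S N)) : cvec p).
  assert (hu : forall i, u i = truncate (S N) f i) by reflexivity.
  apply Rle_lt_trans with (eps / 2); [|lra].
  apply (inXC_bounded p (f - u)%V (eps / 2)); [apply cval0|]; intros n.
  set (t := fun k => wgt p k * Cmod ((f - u)%V (S k))).
  assert (ht : forall k, (k <= N)%nat -> t k = 0).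
  { intros k hk; unfold t; rewrite csub_val, hu; unfold truncate.
    destruct (Nat.leb_spec (S k) (S N)); [|lia].
    replace (f (S k) - f (S k))%C with (RtoC 0) by ring; rewrite Cmod_0; ring. }
  assert (ht' : forall k, (N < k)%nat -> t k = a k).
  { intros k hk; unfold t, a; rewrite csub_val, hu; unfold truncate.
    destruct (Nat.leb_spec (S k) (S N)); [lia|].
    do 2 f_equal; ring. }
  assert (htp : forall k, 0 <= t k) by apply wgt_Cmod_ge0.
  assert (e : forall j, sum_n t (N + j) + sum_n a N = sum_n a (N + j)).
  { induction j as [|j IH].
    - rewrite Nat.add_0_r.
      assert (sum_n t N = 0); [|lra].
      rewrite <- (Rmult_0_r (INR (S N))), <- sum_n_const.
      apply sum_n_ext_loc; intros k hk; apply ht; auto.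
    - rewrite Nat.add_succ_r, !sum_Sn, <- IH, ht' by lia; unfold plus; simpl; ring. }
  assert (h1 : sum_n t n <= sum_n t (N + n)) by (apply sum_n_mono; auto; lia).
  assert (h2 := sum_n_le_Series a (N + n) ha hs).
  rewrite <- e in h2; apply Rabs_lt_between in hN; change (sum_n t n <= eps / 2); lra.
Qed.

(** The vanishing imaginary part is included, so that preservation of this cone also yields reality
    of the semigroup. *)
Definition nonneg_cvec {p} (x : cvec p) : Prop := forall i, 0 <= Re (x i) /\ Im (x i) = 0.

Lemma nonneg_cvec_closed p : @cone_closed p nonneg_cvec.
Proof.
  intros u l hu hl [|k]; [rewrite cval0; simpl; lra|].
  assert (hw := wgt_pos p k).
  assert (hc : forall eps, 0 < eps -> exists n, Cmod (u n (S k) - l (S k))%C < eps).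
  { intros eps heps; destruct (hl (wgt p k * eps)) as [N hN]; [apply Rmult_lt_0_compat; auto|].
    exists N; specialize (hN N (Nat.le_refl N)).
    assert (h := coord_le_nrm p (u N - l)%V k); rewrite csub_val in h.
    apply Rmult_lt_reg_l with (wgt p k); lra. }
  split.
  - apply Rle_plus_epsilon; intros eps heps; destruct (hc eps heps) as [n hn].
    assert (h1 := re_le_Cmod (u n (S k) - l (S k))%C).
    replace (Re (u n (S k) - l (S k))%C) with (Re (u n (S k)) - Re (l (S k))) in h1 by reflexivity.
    assert (h2 := Rle_abs (Re (u n (S k)) - Re (l (S k)))).
    destruct (hu n (S k)) as [h3 _]; lra.
  - assert (h : Rabs (Im (l (S k))) <= 0).
    { apply Rle_plus_epsilon; intros eps heps; destruct (hc eps heps) as [n hn].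
      assert (h1 := im_le_Cmod (u n (S k) - l (S k))%C).
      replace (Im (u n (S k) - l (S k))%C) with (Im (u n (S k)) - Im (l (S k))) in h1 by reflexivity.
      destruct (hu n (S k)) as [_ h3]; rewrite h3 in h1.
      replace (0 - Im (l (S k))) with (- Im (l (S k))) in h1 by ring.
      rewrite Rabs_Ropp in h1; lra. }
    assert (h' := Rabs_pos (Im (l (S k)))).
    apply Rabs_eq_0; lra.
Qed.

Section PerturbedDiagonal.

Variable p : R.
Variables (th : nat -> R) (kern : nat -> nat -> R) (gam K : R).

Hypothesis th_ge0 : forall i, 0 <= th (S i).
Hypothesis kern_ge0 : forall i j, 0 <= kern (S i) (S j).
Hypothesis gam_bounds : 0 <= gam < 1.
Hypothesis K_ge0 : 0 <= K.
Hypothesis kern_col : forall j N,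
  sum_n (fun i => wgt p i * kern (S i) (S j)) N <= (gam * th (S j) + K) * wgt p j.
(** The kernel raises the support by at most one index. Hence finite sequences are mapped to finite
    sequences and lie in the domain of [A^2]. *)
Hypothesis kern_band : forall i j, (S (S j) < i)%nat -> kern i (S j) = 0.

Definition diag (f : nat -> C) (i : nat) : C := (RtoC (th i) * f i)%C.

(** The domain is that of the diagonal part alone; the relative bound then makes the kernel part
    well defined on it. *)
Definition opgraph (u v : cvec p) : Prop :=
  inXC p (diag u) /\ forall i, v (S i) = (- diag u (S i) + kapply kern u (S i))%C.

Let m (j : nat) : R := gam * th j + K.

Lemma domain_series (u : nat -> C) : inXC p u -> inXC p (diag u) ->
  is_series (fun k => m (S k) * (wgt p k * Cmod (u (S k))))
    (gam * normXC p (diag u) + K * normXC p u).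
Proof.
  intros hu hd.
  apply is_series_ext with (fun k => gam * (wgt p k * Cmod (diag u (S k))) + K * (wgt p k * Cmod (u (S k)))).
  - intros k; unfold m, diag; rewrite Cmod_mult, Cmod_R, Rabs_pos_eq by auto.
    change (gam * (wgt p k * (th (S k) * Cmod (u (S k)))) + K * (wgt p k * Cmod (u (S k))) =
      (gam * th (S k) + K) * (wgt p k * Cmod (u (S k)))); ring.
  - apply (is_series_plus (V := R_NormedModule)); apply (is_series_scal_l (V := R_NormedModule));
      apply Series_correct; [apply hd|apply hu].
Qed.

Lemma domain_msummable (u : nat -> C) : inXC p u -> inXC p (diag u) -> msummable p m u.
Proof. intros hu hd; eexists; apply domain_series; auto. Qed.

Lemma kapply_domain (u : nat -> C) : inXC p u -> inXC p (diag u) ->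
  inXC p (kapply kern u) /\ normXC p (kapply kern u) <= gam * normXC p (diag u) + K * normXC p u.
Proof.
  intros hu hd.
  rewrite <- (is_series_unique _ _ (domain_series u hu hd)).
  apply kapply_bound; auto; apply domain_msummable; auto.
Qed.

Lemma opgraph_lin u v u' v' (b : C) :
  opgraph u v -> opgraph u' v' -> opgraph (u + b * u')%V (v + b * v')%V.
Proof.
  intros [hd h] [hd' h']; split.
  - set (x := exist _ _ hd : cvec p); set (x' := exist _ _ hd' : cvec p).
    replace (diag (u + b * u')%V) with (cval (x + b * x')%V); [apply (proj2_sig (x + b * x')%V)|].
    apply functional_extensionality; intros i; unfold diag.
    rewrite !cadd_val, !cscal_val.
    change (x i) with (diag u i); change (x' i) with (diag u' i); unfold diag; ring.
  - intros i; rewrite cadd_val, cscal_val, h, h'.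
    replace (kapply kern (u + b * u')%V) with (kapply kern (fun i => u i + b * u' i)%C) by reflexivity.
    rewrite (kapply_lin p kern m) by
      (auto; apply domain_msummable; auto; apply cval_inX).
    unfold diag; rewrite cadd_val, cscal_val; ring.
Qed.

Lemma opgraph_fun u v v' : opgraph u v -> opgraph u v' -> v = v'.
Proof.
  intros [_ h] [_ h']; apply cvec_ext; intros [|i]; [rewrite !cval0; auto|rewrite h, h'; auto].
Qed.

Lemma opgraph_finite_support (u : cvec p) (N : nat) : (forall i, (N < i)%nat -> u i = RtoC 0) ->
  exists v : cvec p, opgraph u v /\ forall i, (S N < i)%nat -> v i = RtoC 0.
Proof.
  intros hN.
  assert (hd : inXC p (diag u)).
  { apply inXC_finite_support with N.
    - unfold diag; rewrite cval0; ring.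
    - intros i hi; unfold diag; rewrite hN by auto; ring. }
  assert (hk : forall i, (S N < i)%nat -> kapply kern u i = RtoC 0).
  { intros [|i] hi; [lia|]; unfold kapply.
    rewrite (CSeries_ext _ (fun k => RtoC 0 * RtoC 0)%C).
    - rewrite CSeries_scal; [ring|].
      apply (nonneg_series_bounded _ 0); intros n; rewrite Cmod_0; [lra|rewrite sum_n_const; lra].
    - intros k; destruct (Nat.le_gt_cases (S k) N).
      + rewrite kern_band by lia; ring.
      + rewrite hN by lia; ring. }
  set (w := fun i => match i with O => RtoC 0 | S _ => (- diag u i + kapply kern u i)%C end).
  assert (hw : forall i, (S N < i)%nat -> w i = RtoC 0).
  { intros [|i] hi; unfold w; auto; rewrite hk by auto; unfold diag; rewrite hN by lia; ring. }
  exists (exist _ w (inXC_finite_support p w (S N) eq_refl hw)); split; auto.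
  split; auto.
Qed.

Lemma opgraph_dense f eps : 0 < eps ->
  exists u v x, opgraph u v /\ opgraph v x /\ nrm (f - u)%V < eps.
Proof.
  intros heps; destruct (truncate_converges p f eps heps) as [N hN].
  destruct (opgraph_finite_support (exist _ _ (truncate_inXC p f N)) N) as [v [hv hvN]].
  { intros i hi; change (truncate N f i = RtoC 0); unfold truncate.
    destruct (Nat.leb_spec i N); auto; lia. }
  destruct (opgraph_finite_support v (S N) hvN) as [x [hx _]].
  exists (exist _ _ (truncate_inXC p f N)), v, x; auto.
Qed.

(** With this choice [gam (1 + slope) = gam (3 - gam) / 2 < 1], while [|h| <= (1 + slope) Re h] in
    the sector. *)
Definition slope : R := (1 - gam) / 2.
(** Half the gap, so that [|h| (gam + 2 margin) <= Re h]. The 2 pays for both parts of [A u], as [|A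
    u| <= |Theta u| + |B u| <= 2 |Theta u| + K |u|]. *)
Definition margin : R := (/ (1 + slope) - gam) / 2.

Lemma slope_pos : 0 < slope.
Proof. unfold slope; lra. Qed.

Lemma gam_slope : gam * (1 + slope) < 1.
Proof. unfold slope; nra. Qed.

Lemma margin_pos : 0 < margin.
Proof.
  assert (hs := slope_pos); assert (hg := gam_slope).
  unfold margin; assert (gam < / (1 + slope)); [|lra].
  apply Rmult_lt_reg_r with (1 + slope); [lra|]; rewrite Rinv_l; lra.
Qed.

Lemma csector_Cmod h : csector slope h -> Cmod h <= (1 + slope) * Re h.
Proof.
  intros hs; assert (h1 := Cmod_le_abs h); assert (sp := slope_pos).
  assert (0 <= Re h).
  { assert (h2 := Rabs_pos (Im h)); unfold csector in hs.
    apply Rmult_le_reg_l with slope; lra. }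
  rewrite (Rabs_pos_eq (Re h)) in h1 by auto; unfold csector in hs; lra.
Qed.

Lemma csector_Re h : csector slope h -> 0 <= Re h.
Proof.
  intros hs; assert (h1 := csector_Cmod h hs); assert (sp := slope_pos); assert (h2 := Cmod_ge_0 h).
  apply Rmult_le_reg_l with (1 + slope); lra.
Qed.

Lemma one_add_diag_ge h t : 0 <= t -> 1 + Re h * t <= Cmod (RtoC 1 + h * RtoC t)%C.
Proof.
  intros ht; eapply Rle_trans; [|apply re_le_Cmod]; eapply Rle_trans; [|apply Rle_abs].
  rewrite re_plus, re_scal_r; simpl; lra.
Qed.

(** Coordinatewise [(1 + h theta) u = y + h B u] with [y = u - h v]; taking moduli and summing
    bounds [|u| + Re h |Theta u|]. One [K] comes from [B u] there, the other from estimating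
    [margin |h| |v|], whence [2 * K]. *)
Lemma opgraph_dissipative h u v :
  small_step slope (2 * K) h -> opgraph u v ->
  (1 - 2 * K * Cmod h) * nrm u + margin * Cmod h * nrm v <= nrm (u - h * v)%V.
Proof.
  intros [hs hsm] [hd hv].
  destruct (kapply_domain u (proj2_sig u) hd) as [hB nB].
  set (D := exist _ _ hd : cvec p); set (B := exist _ _ hB : cvec p).
  change (nrm B <= gam * nrm D + K * nrm u) in nB.
  set (y := (u - h * v)%V).
  assert (hre := csector_Re h hs); assert (hc := csector_Cmod h hs).
  assert (ah := Cmod_ge_0 h).
  assert (sum1 : nrm u + Re h * nrm D <= nrm y + Cmod h * nrm B).
  { unfold nrm, normXC.
    rewrite <- !Series_scal_l.
    rewrite <- !Series_plus by (try apply (ex_series_scal_l (V := R_NormedModule)); apply cval_series).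
    apply Series_le.
    - intros k; assert (hw := wgt_pos p k); fold (wgt p k).
      assert (e : ((RtoC 1 + h * RtoC (th (S k))) * u (S k))%C = (y (S k) + h * B (S k))%C).
      { unfold y; rewrite csub_val, cscal_val, hv; unfold B, diag; simpl; ring. }
      assert (h1 : (1 + Re h * th (S k)) * Cmod (u (S k)) <= Cmod (y (S k)) + Cmod h * Cmod (B (S k))).
      { eapply Rle_trans; [apply Rmult_le_compat_r; [apply Cmod_ge_0|apply one_add_diag_ge; auto]|].
        rewrite <- Cmod_mult, e, <- Cmod_mult; apply Cmod_triangle. }
      assert (e2 : Cmod (D (S k)) = th (S k) * Cmod (u (S k))).
      { unfold D; simpl; unfold diag; rewrite Cmod_mult, Cmod_R, Rabs_pos_eq; auto. }
      assert (a1 := Cmod_ge_0 (u (S k))); assert (a2 := Cmod_ge_0 (D (S k))).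
      split.
      + apply Rplus_le_le_0_compat; repeat apply Rmult_le_pos; lra.
      + rewrite e2; apply (Rmult_le_compat_l (wgt p k)) in h1; lra.
    - apply (ex_series_plus (V := R_NormedModule));
        try apply (ex_series_scal_l (V := R_NormedModule)); apply cval_series. }
  assert (nv : nrm v <= nrm D + nrm B).
  { replace v with (B - D)%V.
    - rewrite Rplus_comm; apply nrm_csub.
    - apply cvec_ext; intros [|i]; [rewrite !cval0; auto|].
      rewrite csub_val, hv; unfold B, D; simpl; ring. }
  assert (nu0 := nrm_ge0 p u); assert (nD0 := nrm_ge0 p D).
  assert (mp := margin_pos); assert (sp := slope_pos).
  assert (m2 : 2 * margin + gam = / (1 + slope)) by (unfold margin; field; lra).
  assert (i1 : / (1 + slope) <= 1) by (rewrite <- Rinv_1; apply Rinv_le_contravar; lra).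
  assert (hr : Cmod h * (2 * margin + gam) <= Re h).
  { rewrite m2; apply Rmult_le_reg_r with (1 + slope); [lra|].
    rewrite Rmult_assoc, Rinv_l by lra; lra. }
  assert (k1 : Cmod h * (2 * margin + gam) * nrm D <= Re h * nrm D) by (apply Rmult_le_compat_r; auto).
  assert (k2 : Cmod h * nrm B <= Cmod h * (gam * nrm D + K * nrm u)) by (apply Rmult_le_compat_l; auto).
  assert (k3 : margin * Cmod h * nrm v <= margin * Cmod h * (2 * nrm D + K * nrm u)).
  { apply Rmult_le_compat_l; [apply Rmult_le_pos; lra|].
    assert (gam * nrm D <= 1 * nrm D) by (apply Rmult_le_compat_r; lra); lra. }
  assert (k4 : margin * (Cmod h * (K * nrm u)) <= 1 * (Cmod h * (K * nrm u))).
  { apply Rmult_le_compat_r; [repeat apply Rmult_le_pos; auto|lra]. }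
  lra.
Qed.

Definition divdiag (h : C) (f : nat -> C) (i : nat) : C := (f i / (RtoC 1 + h * RtoC (th i)))%C.

Lemma one_add_diag_neq0 h i : csector slope h -> (RtoC 1 + h * RtoC (th (S i)))%C <> RtoC 0.
Proof.
  intros hs; apply Cmod_gt_0.
  assert (h1 := one_add_diag_ge h _ (th_ge0 i)).
  assert (h2 := Rmult_le_pos _ _ (csector_Re h hs) (th_ge0 i)); lra.
Qed.

(** The first entry controls the [theta] part of a column. The second controls the constant part,
    since [small_step] with [2 * K] gives [K |h| <= 1/4]. *)
Definition contraction : R := Rmax (gam * (1 + slope)) (/ 2).

Lemma contraction_bounds : 0 <= contraction < 1.
Proof.
  unfold contraction; split.
  - eapply Rle_trans; [|apply Rmax_r]; lra.
  - apply Rmax_lub_lt; [apply gam_slope|lra].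
Qed.

Lemma divdiag_Cmod h f k : csector slope h ->
  Cmod (divdiag h f (S k)) = Cmod (f (S k)) / Cmod (RtoC 1 + h * RtoC (th (S k)))%C.
Proof. intros hs; apply Cmod_div, one_add_diag_neq0; auto. Qed.

(** Columnwise bound for [h B (1 + h Theta)^{-1}]: it comes down to [|h| (gam theta + K) <=
    contraction (1 + Re h theta)]. *)
Lemma divdiag_le h (f : nat -> C) k : small_step slope (2 * K) h ->
  Cmod h * (m (S k) * (wgt p k * Cmod (divdiag h f (S k)))) <= contraction * (wgt p k * Cmod (f (S k))).
Proof.
  intros [hs hsm].
  rewrite divdiag_Cmod by auto.
  assert (h1 := one_add_diag_ge h _ (th_ge0 k)).
  assert (hre := csector_Re h hs); assert (hc := csector_Cmod h hs); assert (ah := Cmod_ge_0 h).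
  assert (h2 := Rmult_le_pos _ _ hre (th_ge0 k)).
  set (a := Cmod (RtoC 1 + h * RtoC (th (S k)))%C) in *.
  assert (h3 : Cmod h * m (S k) <= contraction * a).
  { assert (c1 := Rmax_l (gam * (1 + slope)) (/ 2)); assert (c2 := Rmax_r (gam * (1 + slope)) (/ 2)).
    fold contraction in c1, c2; unfold m.
    assert (cb := contraction_bounds).
    apply Rle_trans with (contraction * (1 + Re h * th (S k))); [|apply Rmult_le_compat_l; lra].
    assert (d1 : Cmod h * (gam * th (S k)) <= (1 + slope) * Re h * (gam * th (S k))).
    { apply Rmult_le_compat_r; auto; apply Rmult_le_pos; auto; lra. }
    assert (d2 : gam * (1 + slope) * (Re h * th (S k)) <= contraction * (Re h * th (S k)))
      by (apply Rmult_le_compat_r; auto).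
    lra. }
  assert (hw := wgt_pos p k); assert (hf := Cmod_ge_0 (f (S k))).
  apply Rmult_le_reg_r with a; [lra|].
  replace (Cmod h * (m (S k) * (wgt p k * (Cmod (f (S k)) / a))) * a) with
    (Cmod h * m (S k) * (wgt p k * Cmod (f (S k)))) by (field; lra).
  replace (contraction * (wgt p k * Cmod (f (S k))) * a) with
    (contraction * a * (wgt p k * Cmod (f (S k)))) by ring.
  apply Rmult_le_compat_r; auto; apply Rmult_le_pos; lra.
Qed.

Lemma divdiag_msummable h (f : cvec p) : small_step slope (2 * K) h -> h <> RtoC 0 ->
  msummable p m (divdiag h f).
Proof.
  intros hs h0; assert (ah : 0 < Cmod h) by (apply Cmod_gt_0; auto).
  apply ex_series_le_nonneg with (fun k => / Cmod h * (contraction * (wgt p k * Cmod (f (S k))))).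
  - intros k; split.
    + unfold m; repeat apply Rmult_le_pos; try apply Cmod_ge_0; [|apply Rlt_le, wgt_pos].
      apply Rplus_le_le_0_compat; auto; apply Rmult_le_pos; auto; lra.
    + apply Rmult_le_reg_l with (Cmod h); auto.
      rewrite <- (Rmult_assoc (Cmod h) (/ Cmod h)), Rinv_r, Rmult_1_l by lra.
      apply divdiag_le; auto.
  - do 2 apply (ex_series_scal_l (V := R_NormedModule)); apply cval_series.
Qed.

Lemma neumann_bound h (f : cvec p) : small_step slope (2 * K) h -> h <> RtoC 0 ->
  inXC p (fun i => h * kapply kern (divdiag h f) i)%C /\
  normXC p (fun i => h * kapply kern (divdiag h f) i)%C <= contraction * nrm f.
Proof.
  intros hs h0.
  assert (hm := divdiag_msummable h f hs h0).
  destruct (kapply_bound p kern m kern_ge0 kern_col _ hm) as [hB nB].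
  set (B := exist _ _ hB : cvec p).
  split; [apply (proj2_sig (h * B)%V)|].
  change (nrm (h * B)%V <= contraction * nrm f); rewrite nrm_cscal.
  eapply Rle_trans; [apply Rmult_le_compat_l; [apply Cmod_ge_0|apply nB]|].
  unfold nrm, normXC; rewrite <- !Series_scal_l.
  apply Series_le.
  - intros k; split; [|apply divdiag_le; auto].
    unfold m; repeat apply Rmult_le_pos; try apply Cmod_ge_0; [|apply Rlt_le, wgt_pos].
    apply Rplus_le_le_0_compat; auto; apply Rmult_le_pos; auto; lra.
  - apply (ex_series_scal_l (V := R_NormedModule)); apply cval_series.
Qed.

(* [phi = (1 + h Theta) u] turns [u - h (- Theta + B) u = y] into the contractive equation
   [phi = y + h B (1 + h Theta)^{-1} phi]. *)
Lemma opgraph_onto h y : small_step slope (2 * K) h -> h <> RtoC 0 ->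
  exists u v, opgraph u v /\ (u - h * v)%V = y /\
    (Im h = 0 -> nonneg_cvec y -> nonneg_cvec u).
Proof.
  intros hs h0.
  assert (hsec := proj1 hs); assert (hre := csector_Re h hsec).
  pose (Nm := fun f : cvec p => exist _ _ (proj1 (neumann_bound h f hs h0)) : cvec p).
  assert (Nval : forall f i, Nm f i = (h * kapply kern (divdiag h f) i)%C) by reflexivity.
  assert (Nlin : forall f g (b : C), Nm (f + b * g)%V = (Nm f + b * Nm g)%V).
  { intros f g b; apply cvec_ext; intros i; rewrite cadd_val, cscal_val, !Nval.
    rewrite (kapply_ext kern (divdiag h (f + b * g)%V) (fun i => divdiag h f i + b * divdiag h g i)%C).
    - rewrite (kapply_lin p kern m kern_ge0 kern_col) by (apply divdiag_msummable; auto); ring.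
    - intros j; unfold divdiag; rewrite cadd_val, cscal_val; field.
      apply one_add_diag_neq0; auto. }
  assert (Nbl : bounded_linear Nm contraction).
  { split; auto; intros f; apply (neumann_bound h f hs h0). }
  destruct (affine_fixpoint Nm contraction y) as [phi [hlim hphi]].
  { intros; apply bl_lipschitz; auto. }
  { apply contraction_bounds. }
  assert (dle : forall k, Cmod (divdiag h phi (S k)) <= Cmod (phi (S k))).
  { intros k; rewrite divdiag_Cmod by auto.
    assert (h1 := one_add_diag_ge h _ (th_ge0 k)).
    assert (h2 := Rmult_le_pos _ _ hre (th_ge0 k)).
    assert (a := Cmod_ge_0 (phi (S k))).
    apply Rle_div_l; [lra|]; nra. }
  assert (hu : inXC p (divdiag h phi)).
  { apply (inXC_dominated p _ (fun k => wgt p k * Cmod (phi (S k)))).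
    - unfold divdiag; rewrite cval0; unfold Cdiv; ring.
    - intros k; apply Rmult_le_compat_l; [apply Rlt_le, wgt_pos|auto].
    - apply cval_series. }
  set (u := exist _ _ hu : cvec p).
  assert (uval : forall i, u i = divdiag h phi i) by reflexivity.
  assert (eqn : forall i, phi (S i) = (u (S i) + h * diag u (S i))%C).
  { intros i; rewrite uval; unfold diag; rewrite uval; unfold divdiag; field.
    apply one_add_diag_neq0; auto. }
  (* [Theta u = (phi - u) / h] is a difference of elements of the space, so [u] lies in the
     domain. *)
  assert (hd : inXC p (diag u)).
  { set (x := (/ h * (phi - u))%V).
    replace (diag u) with (cval x); [apply (proj2_sig x)|].
    apply functional_extensionality; intros [|i]; unfold x.
    - rewrite cval0; unfold diag; rewrite cval0; ring.
    - rewrite cscal_val, csub_val, eqn; field; auto. }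
  set (v := (/ h * (u - y))%V).
  assert (hyu : (u - h * v)%V = y).
  { unfold v; apply cvec_ext; intros i; rewrite csub_val, cscal_val, cscal_val, csub_val; field; auto. }
  exists u, v; split; [|split]; auto.
  - split; auto; intros i; unfold v; rewrite cscal_val, csub_val.
    assert (e : phi (S i) = (y (S i) + h * kapply kern u (S i))%C).
    { rewrite hphi at 1; rewrite cadd_val, Nval; auto. }
    rewrite eqn in e.
    replace (y (S i)) with (u (S i) + h * diag u (S i) - h * kapply kern u (S i))%C by (rewrite e; ring).
    field; auto.
  - intros hreal hy.
    assert (hh : h = RtoC (Re h)) by (destruct h as [a b]; simpl in hreal; subst b; reflexivity).
    assert (dpos : forall x : cvec p, nonneg_cvec x -> forall k, 
      divdiag h x (S k) = RtoC (Re (x (S k)) / (1 + Re h * th (S k)))).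
    { intros x hx k; destruct (hx (S k)) as [_ him].
      assert (h2 := Rmult_le_pos _ _ hre (th_ge0 k)).
      unfold divdiag; rewrite RtoC_div by lra.
      rewrite RtoC_plus, RtoC_mult, <- hh; f_equal.
      destruct (x (S k)) as [a b]; simpl in him |- *; subst b; reflexivity. }
    assert (dpos2 : forall (x : cvec p) k, nonneg_cvec x -> 0 <= Re (x (S k)) / (1 + Re h * th (S k))).
    { intros x k hx; assert (h2 := Rmult_le_pos _ _ hre (th_ge0 k)).
      apply Rle_div_r; [lra|]; rewrite Rmult_0_l; apply hx. }
    (* For real [h], both [(1 + h Theta)^{-1}] and [h B] preserve nonnegativity. So every Neumann
       iterate from zero is nonnegative, and so is the limit. *)
    assert (hphi0 : nonneg_cvec phi).
    { apply (nonneg_cvec_closed p _ _) with (2 := hlim); intros n.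
      induction n as [|n IH]; [intros i; simpl; lra|].
      set (x := Nat.iter n (fun z => y + Nm z)%V 0%V) in *.
      change (nonneg_cvec (y + Nm x)%V); intros [|i]; [rewrite cval0; simpl; lra|].
      rewrite cadd_val, Nval, hh, re_plus, re_scal_l.
      assert (e : kapply kern (divdiag h x) (S i) =
        (Series (fun k => kern (S i) (S k) * (Re (x (S k)) / (1 + Re h * th (S k)))), 0)).
      { unfold kapply, CSeries; f_equal.
        - apply Series_ext; intros k; rewrite dpos by auto; simpl; ring.
        - rewrite (Series_ext _ (fun _ => 0 * 0)) by (intros k; rewrite dpos by auto; simpl; ring).
          rewrite Series_scal_l; ring. }
      rewrite <- hh, e.
      destruct (hy (S i)) as [y1 y2].
      assert (sp : 0 <= Series (fun k => kern (S i) (S k) * (Re (x (S k)) / (1 + Re h * th (S k))))).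
      { apply Series_nonneg; [intros k; apply Rmult_le_pos; auto|].
        eapply ex_series_ext; [|apply ex_series_re,
          (kapply_row_summable p kern m kern_ge0 kern_col _ i (divdiag_msummable h x hs h0))].
        intros k; cbv beta; rewrite dpos by auto; simpl; ring. }
      split.
      - apply Rplus_le_le_0_compat; auto; apply Rmult_le_pos; auto.
      - change (Im (y (S i)) + (Re h * 0 + Im h * Series (fun k => kern (S i) (S k) * (Re (x (S k)) / (1 + Re h * th (S k))))) = 0).
        rewrite hreal, y2; ring. }
    intros [|k]; [rewrite cval0; simpl; lra|].
    rewrite uval, dpos by auto; simpl; split; auto.
Qed.

Theorem perturbed_diagonal_generation : exists T : C -> cvec p -> cvec p,
    (forall z, csector slope z -> exists M, bounded_linear (T z) M) /\
    (forall f, T (RtoC 0) f = f) /\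
    (forall z w f, csector slope z -> csector slope w -> T (z + w)%C f = T z (T w f)) /\
    (forall f eps, 0 < eps -> exists del, 0 < del /\
       forall z, csector slope z -> Cmod z < del -> nrm (T z f - f)%V < eps) /\
    (forall f g, opgraph f g <-> (forall eps, 0 < eps -> exists del, 0 < del /\ forall t, 0 < t < del ->
       nrm (/ RtoC t * (T (RtoC t) f - f) - g)%V < eps)) /\
    (forall z, 0 < Re z -> Rabs (Im z) < slope * Re z -> exists D L del, 0 < del /\
       forall h f, Cmod h < del ->
         nrm (T (z + h)%C f - T z f - h * D f)%V <= L * Cmod h ^ 2 * nrm f) /\
    (forall t f, 0 <= t -> nonneg_cvec f -> nonneg_cvec (T (RtoC t) f)).
Proof.
  apply (sectorial_generation p slope (2 * K) margin opgraph).
  - apply slope_pos.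
  - lra.
  - apply margin_pos.
  - apply opgraph_lin.
  - apply opgraph_fun.
  - apply opgraph_dissipative.
  - intros h y hs h0; destruct (opgraph_onto h y hs h0) as [u [v [h1 [h2 _]]]]; eauto.
  - apply opgraph_dense.
  - apply nonneg_cvec_closed.
  - intros h y hpos hs hy.
    destruct (opgraph_onto (RtoC h) y hs) as [u [v [h1 [h2 h3]]]].
    + intros e; apply RtoC_inj in e; lra.
    + exists u, v; auto.
Qed.

End PerturbedDiagonal.

(** * Restriction to real sequences *)

Lemma RtoC_Re (z : C) : Im z = 0 -> RtoC (Re z) = z.
Proof. destruct z as [x y]; simpl; intros ->; reflexivity. Qed.

Lemma inX_inXC p f : inX p f <-> inXC p (fun i => RtoC (f i)).
Proof.
  split; intros [h0 h]; split; try (rewrite h0; auto); try (apply RtoC_inj; auto);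
    (eapply ex_series_ext; [|apply h]); intros k; cbv beta; rewrite Cmod_R; auto.
Qed.

Lemma normX_normXC p f : normX p f = normXC p (fun i => RtoC (f i)).
Proof. apply Series_ext; intros k; rewrite Cmod_R; auto. Qed.

Section RealPart.

Variables (p tau : R) (T : C -> cvec p -> cvec p) (G : cvec p -> cvec p -> Prop).

Hypothesis tau_pos : 0 < tau.
Hypothesis T_bl : forall z, csector tau z -> exists M, bounded_linear (T z) M.
Hypothesis T_0 : forall f, T (RtoC 0) f = f.
Hypothesis T_add : forall z w f, csector tau z -> csector tau w -> T (z + w)%C f = T z (T w f).
Hypothesis T_cont : forall f eps, 0 < eps -> exists del, 0 < del /\
  forall z, csector tau z -> Cmod z < del -> nrm (T z f - f)%V < eps.
Hypothesis T_gen : forall f g, G f g <-> (forall eps, 0 < eps -> exists del, 0 < del /\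
  forall t, 0 < t < del -> nrm (/ RtoC t * (T (RtoC t) f - f) - g)%V < eps).
Hypothesis T_diff : forall z, 0 < Re z -> Rabs (Im z) < tau * Re z -> exists D L del, 0 < del /\
  forall h f, Cmod h < del -> nrm (T (z + h)%C f - T z f - h * D f)%V <= L * Cmod h ^ 2 * nrm f.
Hypothesis T_pos : forall t f, 0 <= t -> nonneg_cvec f -> nonneg_cvec (T (RtoC t) f).

(** The semigroup of the statement acts on all functions; those outside the space are sent to
    zero. *)
Definition pack (f : nat -> C) : cvec p :=
  match excluded_middle_informative (inXC p f) with
  | left H => exist _ f H
  | right _ => czero
  end.

Lemma pack_val f : inXC p f -> cval (pack f) = f.
Proof. intros h; unfold pack; destruct excluded_middle_informative; tauto. Qed.

Lemma pack_eq (x : cvec p) f : (forall i, x i = f i) -> pack f = x.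
Proof.
  intros h; assert (e : f = cval x) by (apply functional_extensionality; auto); subst f.
  apply cvec_ext; intros i; rewrite pack_val; auto using cval_inX.
Qed.

Lemma nrm_pack f : inXC p f -> nrm (pack f) = normXC p f.
Proof. intros h; unfold nrm; rewrite pack_val; auto. Qed.

Lemma pack_lin f g (c : C) : inXC p f -> inXC p g ->
  pack (fun i => f i + c * g i)%C = (pack f + c * pack g)%V.
Proof.
  intros hf hg; apply pack_eq; intros i; rewrite cadd_val, cscal_val, !pack_val; auto.
Qed.

Definition embed (f : nat -> R) : cvec p := pack (fun i => RtoC (f i)).

Lemma embed_val f i : inX p f -> embed f i = RtoC (f i).
Proof. intros h; unfold embed; rewrite pack_val; auto; apply inX_inXC; auto. Qed.

Lemma embed_eq (x : cvec p) f : (forall i, x i = RtoC (f i)) -> embed f = x.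
Proof. apply pack_eq. Qed.

Lemma real_inX (x : cvec p) f : (forall i, x i = RtoC (f i)) -> inX p f.
Proof.
  intros h; apply inX_inXC.
  replace (fun i => RtoC (f i)) with (cval x) by (apply functional_extensionality; auto).
  apply cval_inX.
Qed.

Lemma real_nrm (x : cvec p) f : (forall i, x i = RtoC (f i)) -> normX p f = nrm x.
Proof.
  intros h; rewrite normX_normXC; unfold nrm; f_equal; apply functional_extensionality; auto.
Qed.

Definition TC (z : C) (f : nat -> C) : nat -> C := T z (pack f).

Definition TR (t : R) (f : nat -> R) (i : nat) : R := Re (T (RtoC t) (embed f) i).

(* [f = |f| - (|f| - f)] reduces reality of [T t f] to positivity. *)
Lemma TR_val t f i : 0 <= t -> inX p f -> T (RtoC t) (embed f) i = RtoC (TR t f i).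
Proof.
  intros ht hf.
  assert (habs : inX p (fun i => Rabs (f i))).
  { destruct hf as [h0 hs]; split; [rewrite h0; apply Rabs_R0|].
    eapply ex_series_ext; [|apply hs]; intros k; simpl; rewrite Rabs_Rabsolu; auto. }
  set (P := embed (fun i => Rabs (f i))); set (Q := (P - embed f)%V).
  assert (hP : forall i, P i = RtoC (Rabs (f i))) by (intros; apply embed_val; auto).
  assert (hPp : nonneg_cvec P).
  { intros k; rewrite hP; simpl; split; auto; apply Rabs_pos. }
  assert (hQp : nonneg_cvec Q).
  { intros k; unfold Q; rewrite csub_val, hP, embed_val by auto; simpl.
    assert (h := Rle_abs (f k)); split; lra. }
  unfold TR; rewrite RtoC_Re; auto.
  replace (embed f) with (P - Q)%V by (unfold Q; cvec_ring).
  destruct (T_bl (RtoC t) (csector_real tau tau_pos t ht)) as [M hM].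
  rewrite (bl_sub _ M) by auto; rewrite csub_val.
  destruct (T_pos t P ht hPp i) as [_ h1]; destruct (T_pos t Q ht hQp i) as [_ h2].
  change (Im (T (RtoC t) P i) + - Im (T (RtoC t) Q i) = 0); rewrite h1, h2; ring.
Qed.

Lemma TR_inX t f : 0 <= t -> inX p f -> inX p (TR t f).
Proof. intros ht hf; apply (real_inX (T (RtoC t) (embed f))); intros i; apply TR_val; auto. Qed.

Lemma embed_TR t f : 0 <= t -> inX p f -> embed (TR t f) = T (RtoC t) (embed f).
Proof. intros ht hf; apply embed_eq; intros i; apply TR_val; auto. Qed.

Lemma TR_C0 : is_C0_semigroup p TR.
Proof.
  repeat split.
  - apply TR_inX; auto.
  - apply TR_inX; auto.
  - intros t f g c ht hf hg; apply functional_extensionality; intros i.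
    apply RtoC_inj; unfold TR at 1.
    replace (embed (fun i => f i + c * g i)) with (embed f + RtoC c * embed g)%V.
    + destruct (T_bl (RtoC t) (csector_real tau tau_pos t ht)) as [M hM].
      rewrite (proj1 hM), cadd_val, cscal_val, !TR_val by auto.
      rewrite RtoC_plus, RtoC_mult; simpl; unfold RtoC, Cplus, Cmult; simpl; f_equal; ring.
    + symmetry; apply embed_eq; intros j.
      rewrite cadd_val, cscal_val, !embed_val, RtoC_plus, RtoC_mult; auto.
  - intros t ht; destruct (T_bl (RtoC t) (csector_real tau tau_pos t ht)) as [M hM].
    exists M; intros f hf.
    rewrite (real_nrm (T (RtoC t) (embed f))) by (intros; apply TR_val; auto).
    rewrite (real_nrm (embed f) f) by (intros; apply embed_val; auto).
    apply hM.
  - intros f hf; apply functional_extensionality; intros i; unfold TR.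
    rewrite T_0, embed_val; auto.
  - intros t s f ht hs hf; apply functional_extensionality; intros i.
    unfold TR at 1 2; rewrite embed_TR, RtoC_plus, T_add by auto using csector_real; auto.
  - intros f hf eps heps; destruct (T_cont (embed f) eps heps) as [del [hdel h]].
    exists del; split; auto; intros t ht.
    rewrite (real_nrm (T (RtoC t) (embed f) - embed f)%V).
    + apply h; [apply csector_real; lra|rewrite Cmod_R, Rabs_pos_eq; lra].
    + intros i; rewrite csub_val, TR_val, embed_val, RtoC_minus by (auto; lra); auto.
Qed.

Lemma TR_generator (A : (nat -> R) -> nat -> R) (DA : (nat -> R) -> Prop) :
  (forall f, DA f -> inX p f /\ inX p (A f)) ->
  (forall f g, inX p f -> inX p g -> (DA f /\ A f = g <-> G (embed f) (embed g))) ->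
  is_generator p TR A DA.
Proof.
  intros hA hG; split; auto; intros f hf g hg.
  rewrite hG, T_gen by auto.
  assert (e : forall t, 0 < t -> normX p (fun i => (TR t f i - f i) / t - g i) =
    nrm (/ RtoC t * (T (RtoC t) (embed f) - embed f) - embed g)%V).
  { intros t ht; apply real_nrm; intros i.
    rewrite csub_val, cscal_val, csub_val, TR_val, !embed_val by (auto; lra).
    rewrite RtoC_minus, RtoC_div, RtoC_minus by lra.
    field; intros e; apply RtoC_inj in e; lra. }
  split; intros h eps heps; destruct (h eps heps) as [del [hdel h']]; exists del; split; auto;
    intros t ht; specialize (h' t ht); rewrite e in * by apply ht; auto.
Qed.

Lemma TR_positive : is_positive_semigroup p TR.
Proof.
  intros t f ht hf hpos i; apply T_pos; auto.
  intros k; rewrite embed_val by auto; simpl; auto.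
Qed.

Lemma TR_analytic : is_analytic_semigroup p TR.
Proof.
  assert (tan_tau : tan (atan tau) = tau) by apply tan_atan.
  assert (hsec : forall z, sector (atan tau) z -> csector tau z).
  { intros z [_ h]; rewrite tan_tau in h; apply Rlt_le; auto. }
  assert (hsec0 : forall z, z = RtoC 0 \/ sector (atan tau) z -> csector tau z).
  { intros z [->|h]; auto; apply csector_real; auto; lra. }
  (* The half-angle whose tangent is [tau]: the open sector of the statement then lies in
     [csector tau]. *)
  exists (atan tau); split.
  { split; [|apply atan_bound]; rewrite <- atan_0; apply atan_increasing; auto. }
  exists TC; repeat split.
  - apply cval0.
  - apply cval_inX.
  - intros z f g c hz hf hg; apply functional_extensionality; intros i.
    destruct (T_bl z (hsec0 z hz)) as [M hM].
    unfold TC; rewrite pack_lin, (proj1 hM) by auto; auto.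
  - intros z hz; destruct (T_bl z (hsec0 z hz)) as [M hM]; exists M; intros f hf.
    rewrite <- (nrm_pack f hf); apply hM.
  - intros t f ht hf; apply functional_extensionality; intros i; apply TR_val; auto.
  - intros f hf; unfold TC; rewrite T_0, pack_val; auto.
  - intros z w f hz hw hf; unfold TC; rewrite T_add by auto.
    do 2 f_equal; symmetry; apply pack_eq; auto.
  - intros z [hre him]; rewrite tan_tau in him.
    destruct (T_diff z hre him) as [D [L [del [hdel h]]]].
    exists (fun f => cval (D (pack f))); split; [intros; apply cval_inX|].
    intros eps heps.
    assert (hL := Rabs_pos L).
    (* After division by [|k|] the quadratic remainder is [L |k|] times the norm of [f]. *)
    exists (Rmin del (eps / (Rabs L + 1))); split.
    { apply Rmin_pos; auto; apply Rdiv_lt_0_compat; lra. }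
    intros k k0 hk _ f hf.
    assert (hk1 := Rlt_le_trans _ _ _ hk (Rmin_l _ _)); assert (hk2 := Rlt_le_trans _ _ _ hk (Rmin_r _ _)).
    specialize (h k (pack f) hk1).
    assert (ak : 0 < Cmod k) by (apply Cmod_gt_0; auto).
    rewrite <- (nrm_pack f hf).
    set (x := (/ k * (T (z + k)%C (pack f) - T z (pack f) - k * D (pack f)))%V).
    replace (normXC p _) with (nrm x).
    + unfold x; rewrite nrm_cscal, Cmod_inv by auto.
      apply Rmult_le_reg_l with (Cmod k); auto.
      rewrite <- Rmult_assoc, Rinv_r, Rmult_1_l by lra.
      eapply Rle_trans; [apply h|].
      replace (L * Cmod k ^ 2 * nrm (pack f)) with (Cmod k * (L * Cmod k * nrm (pack f))) by ring.
      apply Rmult_le_compat_l; [lra|]; apply Rmult_le_compat_r; [apply nrm_ge0|].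
      apply Rle_trans with ((Rabs L + 1) * (eps / (Rabs L + 1))).
      * assert (l1 := Rle_abs L); apply Rle_trans with ((Rabs L + 1) * Cmod k).
        -- apply Rmult_le_compat_r; lra.
        -- apply Rmult_le_compat_l; lra.
      * right; field; lra.
    + unfold nrm; f_equal; apply functional_extensionality; intros i; unfold x, TC.
      rewrite cscal_val, csub_val, csub_val, cscal_val; field; auto.
  - intros f hf eps heps; destruct (T_cont (pack f) eps heps) as [del [hdel h]].
    exists del; split; auto; intros z hz hzd.
    specialize (h z (hsec z hz) hzd).
    replace (normXC p _) with (nrm (T z (pack f) - pack f)%V); auto.
    unfold nrm; f_equal; apply functional_extensionality; intros i.
    rewrite csub_val, (pack_val f hf); auto.
Qed.

End RealPart.

(** * The growth-fragmentation operator *)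

(** Bernoulli's inequality. *)
Lemma one_sub_pow_le (y : R) (n : nat) : 0 <= y <= 1 -> 1 - y ^ n <= INR n * (1 - y).
Proof.
  intros hy; induction n as [|n IH]; [simpl; lra|].
  rewrite S_INR; simpl pow.
  assert (h : 0 <= y ^ n <= 1).
  { split; [apply pow_le; lra|]; rewrite <- (pow1 n); apply pow_incr; auto. }
  nra.
Qed.

Lemma ln_nonpos (x : R) : 0 < x <= 1 -> ln x <= 0.
Proof.
  intros [h0 [h1| ->]]; [|rewrite ln_1; lra].
  rewrite <- ln_1; apply Rlt_le, ln_increasing; lra.
Qed.

(** As [x <= 1], [1 - x^q0 <= 1 - (x^q)^n], and Bernoulli applies to [x^q]. The constant [n] is
    uniform in [x]; this transfers the hypothesis from [p0] to [p]. *)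
Lemma one_sub_Rpower_compare (q q0 : R) (n : nat) (x : R) :
  0 < q -> q0 <= INR n * q -> 0 < x <= 1 ->
  1 - Rpower x q0 <= INR n * (1 - Rpower x q).
Proof.
  intros hq hn hx.
  assert (hl := ln_nonpos x hx).
  assert (hb : 0 <= Rpower x q <= 1).
  { split; [apply Rlt_le, exp_pos|]; unfold Rpower; rewrite <- exp_0; apply exp_mono; nra. }
  eapply Rle_trans; [|apply one_sub_pow_le; auto].
  unfold Rpower; rewrite exp_mult_INR.
  assert (h : exp (INR n * (q * ln x)) <= exp (q0 * ln x)); [|lra].
  apply exp_mono; nra.
Qed.

Lemma wgt_ge1 p k : 0 < p -> 1 <= wgt p k.
Proof.
  intros hp; unfold wgt, Rpower; rewrite <- exp_0; apply exp_mono.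
  apply Rmult_le_pos; [lra|].
  rewrite <- ln_1; destruct k as [|k]; [simpl; lra|].
  apply Rlt_le, ln_increasing; [lra|]; rewrite S_INR, S_INR; assert (h := pos_INR k); lra.
Qed.

Lemma wgt_mono p k : 0 < p -> wgt p k <= wgt p (S k).
Proof.
  intros hp; apply Rle_Rpower_l; [lra|]; split; [apply lt_0_INR; lia|apply le_INR; lia].
Qed.

(** The ratio of consecutive weights is at most [exp (p / (k+1))], by [ln (1 + t) <= t]; so growth
    by one unit is almost free at large sizes. *)
Lemma wgt_succ_le p eps k : 0 < p -> 0 < eps -> p / ln (1 + eps) <= INR (S k) ->
  wgt p (S k) <= (1 + eps) * wgt p k.
Proof.
  intros hp heps hk.
  assert (hl : 0 < ln (1 + eps)) by (rewrite <- ln_1; apply ln_increasing; lra).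
  assert (hi : 0 < INR (S k)) by (apply lt_0_INR; lia).
  assert (h1 : p * / INR (S k) <= ln (1 + eps)).
  { apply Rle_div_l in hk; auto; apply Rle_div_l; auto; lra. }
  unfold wgt, Rpower.
  rewrite <- (exp_ln (1 + eps)) at 1 by lra; rewrite <- exp_plus; apply exp_mono.
  assert (h2 : ln (INR (S (S k))) <= ln (INR (S k)) + / INR (S k)).
  { replace (INR (S (S k))) with (INR (S k) * (1 + / INR (S k))) by (rewrite (S_INR (S k)); field; lra).
    assert (h3 : 0 < / INR (S k)) by (apply Rinv_0_lt_compat; auto).
    rewrite ln_mult by lra.
    assert (h4 : ln (1 + / INR (S k)) <= / INR (S k)).
    { rewrite <- (ln_exp (/ INR (S k))) at 2; apply ln_le; [lra|apply exp_ineq1_le]. }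
    lra. }
  apply (Rmult_le_compat_l p) in h2; lra.
Qed.

Lemma sum_n_support_le (u : nat -> R) (M N : nat) :
  (forall k, 0 <= u k) -> (forall k, (M < k)%nat -> u k = 0) -> sum_n u N <= sum_n u M.
Proof.
  intros hu h0.
  apply Rle_trans with (sum_n u (M + N)); [apply sum_n_mono; auto; lia|].
  induction N as [|N IH]; [rewrite Nat.add_0_r; lra|].
  rewrite Nat.add_succ_r, sum_Sn, h0 by lia; unfold plus; simpl; lra.
Qed.

Lemma sum_n_single (u : nat -> R) (k : nat) : (forall i, i <> k -> u i = 0) -> sum_n u k = u k.
Proof.
  intros h; destruct k as [|k]; [apply sum_O|].
  rewrite sum_Sn.
  replace (sum_n u k) with (sum_n (fun _ => 0) k).
  - rewrite sum_n_const; unfold plus; simpl; ring.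
  - apply sum_n_ext_loc; intros i hi; symmetry; apply h; lia.
Qed.

Lemma sum_n_single_le (u : nat -> R) (k N : nat) :
  (forall i, i <> k -> u i = 0) -> 0 <= u k -> sum_n u N <= u k.
Proof.
  intros h hk; rewrite <- (sum_n_single u k h) at 1.
  apply sum_n_support_le; [|intros i hi; apply h; lia].
  intros i; destruct (Nat.eq_dec i k) as [->|hne]; auto; rewrite h; auto; lra.
Qed.

Lemma sum_f_1 (j : nat) (F : nat -> R) : sum_f 1 (S (S j) - 1) F = sum_n (fun i => F (S i)) j.
Proof.
  unfold sum_f; replace (S (S j) - 1 - 1)%nat with j by lia.
  rewrite <- sum_n_Reals; apply sum_n_ext; intros i; f_equal; lia.
Qed.

Section Fragmentation.

Variables (g d s a : nat -> R) (b : nat -> nat -> R).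
Hypothesis hg : forall i, (1 <= i)%nat -> 0 <= g i.
Hypothesis hd : forall i, (1 <= i)%nat -> 0 <= d i.
Hypothesis hs : forall i, (1 <= i)%nat -> 0 <= s i.
Hypothesis ha : forall i, (1 <= i)%nat -> 0 <= a i.
Hypothesis hb : forall i j, (1 <= i)%nat -> (1 <= j)%nat -> 0 <= b i j.
Hypothesis ha2 : forall i, (2 <= i)%nat -> 0 < a i.
Hypothesis hbij : forall i j, (1 <= i)%nat -> (1 <= j)%nat -> (j <= i)%nat -> b i j = 0.
Hypothesis hmass : forall j, (2 <= j)%nat -> sum_f 1 (j - 1) (fun i => INR i * b i j) = INR j.

(* The ratio is an average of [1 - r^(p-1)] over the relative fragment sizes [r = i/j],
   weighted by the mass fractions [i b_ij / j]. *)
Lemma Deltap_ratio p j :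
  Deltap b p (S (S j)) / wgt p (S j) =
  sum_n (fun i => (1 - Rpower (INR (S i) / INR (S (S j))) (p - 1)) *
                  (INR (S i) * b (S i) (S (S j)) / INR (S (S j)))) j.
Proof.
  assert (hJ : 0 < INR (S (S j))) by (apply lt_0_INR; lia).
  assert (hw := wgt_pos p (S j)).
  assert (hm := hmass (S (S j)) ltac:(lia)); rewrite sum_f_1 in hm.
  unfold Deltap; rewrite sum_f_1; fold (wgt p (S j)).
  (* Mass conservation writes the leading 1 of the ratio as the sum of the mass fractions. *)
  transitivity (sum_n (fun i => INR (S i) * b (S i) (S (S j))) j * / INR (S (S j)) +
    (-1) * (sum_n (fun i => Rpower (INR (S i)) p * b (S i) (S (S j))) j * / wgt p (S j))).
  { rewrite hm; field; lra. }
  rewrite <- !(sum_n_mult_r (K := R_Ring)).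
  rewrite <- (sum_n_mult_l (K := R_Ring)).
  change Rplus with (@plus R_AbelianMonoid); rewrite <- sum_n_plus.
  apply sum_n_ext; intros i; unfold plus, mult; cbn -[INR Rpower wgt].
  assert (hI : 0 < INR (S i)) by (apply lt_0_INR; lia).
  assert (e : Rpower (INR (S i) / INR (S (S j))) (p - 1) * INR (S i) / INR (S (S j)) =
              Rpower (INR (S i)) p / wgt p (S j)).
  { assert (hr : 0 < INR (S i) / INR (S (S j))) by (apply Rdiv_lt_0_compat; auto).
    transitivity (Rpower (INR (S i) / INR (S (S j))) (p - 1) * Rpower (INR (S i) / INR (S (S j))) 1);
      [rewrite Rpower_1 by auto; field; lra|].
    rewrite <- Rpower_plus; replace (p - 1 + 1) with p by ring.
    unfold Rdiv; rewrite <- Rpower_mult_distr; auto using Rinv_0_lt_compat.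
    f_equal; unfold wgt, Rpower; rewrite ln_Rinv, <- exp_Ropp by auto; f_equal; ring. }
  unfold Rdiv in e |- *.
  transitivity (INR (S i) * b (S i) (S (S j)) * / INR (S (S j)) -
     (Rpower (INR (S i)) p * / wgt p (S j)) * b (S i) (S (S j))); [ring|].
  rewrite <- e; ring.
Qed.

Lemma Deltap_compare p p0 n j : 1 < p -> p0 - 1 <= INR n * (p - 1) ->
  Deltap b p0 (S (S j)) / wgt p0 (S j) <= INR n * (Deltap b p (S (S j)) / wgt p (S j)).
Proof.
  intros hp hn; rewrite !Deltap_ratio.
  rewrite <- (sum_n_mult_l (K := R_Ring)); apply sum_n_R_le; intros i hi.
  unfold mult; cbn -[INR Rpower].
  rewrite <- Rmult_assoc.
  assert (hJ : 0 < INR (S (S j))) by (apply lt_0_INR; lia).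
  assert (hI : 0 < INR (S i)) by (apply lt_0_INR; lia).
  apply Rmult_le_compat_r.
  - apply Rmult_le_pos; [|apply Rlt_le, Rinv_0_lt_compat; auto].
    apply Rmult_le_pos; [lra|apply hb; lia].
  - apply one_sub_Rpower_compare; auto; try lra; split.
    + apply Rdiv_lt_0_compat; auto.
    + apply Rle_div_l; auto; rewrite Rmult_1_l; apply le_INR; lia.
Qed.

(** Column [j] lists where clusters of size [j] go: growth to [j + 1], death to [j - 1],
    fragmentation to the sizes [i < j]. *)
Definition fkern (i j : nat) : R :=
  (if (i =? S j)%nat then g j else 0) + (if (S i =? j)%nat then d j else 0) + a j * b i j.

Lemma fkern_ge0 i j : 0 <= fkern (S i) (S j).
Proof.
  unfold fkern.
  assert (h1 := hg (S j) ltac:(lia)); assert (h2 := hd (S j) ltac:(lia)).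
  assert (h3 := Rmult_le_pos _ _ (ha (S j) ltac:(lia)) (hb (S i) (S j) ltac:(lia) ltac:(lia))).
  destruct (_ =? _)%nat; destruct (_ =? _)%nat; lra.
Qed.

Lemma theta_ge0 i : 0 <= theta a g d s (S i).
Proof.
  unfold theta.
  assert (h1 := hg (S i) ltac:(lia)); assert (h2 := hd (S i) ltac:(lia)).
  assert (h3 := hs (S i) ltac:(lia)); assert (h4 := ha (S i) ltac:(lia)); lra.
Qed.

Lemma fkern_band i j : (S (S j) < i)%nat -> fkern i (S j) = 0.
Proof.
  intros h; unfold fkern.
  destruct (Nat.eqb_spec i (S (S j))); [lia|].
  destruct (Nat.eqb_spec (S i) (S j)); [lia|].
  rewrite hbij by lia; ring.
Qed.

(** An upper bound for the column of size [S j]: clusters that die are counted with their old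
    weight, which also covers size 1, where nothing arrives. *)
Definition colsum (p : R) (j : nat) : R :=
  g (S j) * wgt p (S j) + d (S j) * wgt p j +
  a (S j) * sum_n (fun i => wgt p i * b (S i) (S j)) j.

Lemma fkern_col_le p j N : 0 < p -> sum_n (fun i => wgt p i * fkern (S i) (S j)) N <= colsum p j.
Proof.
  intros hp.
  assert (h1 := hg (S j) ltac:(lia)); assert (h2 := hd (S j) ltac:(lia)).
  set (u1 := fun i => if (S i =? S (S j))%nat then g (S j) * wgt p i else 0).
  set (u2 := fun i => if (S (S i) =? S j)%nat then d (S j) * wgt p i else 0).
  set (u3 := fun i => wgt p i * b (S i) (S j)).
  apply Rle_trans with (sum_n u1 N + sum_n u2 N + a (S j) * sum_n u3 N).
  - right; rewrite <- (sum_n_mult_l (K := R_Ring)).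
    change Rplus with (@plus R_AbelianMonoid); rewrite <- !sum_n_plus.
    apply sum_n_ext; intros i; unfold fkern, u1, u2, u3.
    destruct (S i =? S (S j))%nat; destruct (S (S i) =? S j)%nat; unfold plus, mult; cbn -[wgt]; ring.
  - unfold colsum; apply Rplus_le_compat; [apply Rplus_le_compat|].
    + replace (g (S j) * wgt p (S j)) with (u1 (S j)) by (unfold u1; rewrite Nat.eqb_refl; auto).
      apply sum_n_single_le.
      * intros i hi; unfold u1; destruct (Nat.eqb_spec (S i) (S (S j))); auto; lia.
      * unfold u1; rewrite Nat.eqb_refl; apply Rmult_le_pos; auto; apply Rlt_le, wgt_pos.
    + destruct j as [|j].
      * apply Rle_trans with 0; [|apply Rmult_le_pos; auto; apply Rlt_le, wgt_pos].
        right; rewrite <- (Rmult_0_r (INR (S N))), <- sum_n_const; apply sum_n_ext; auto.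
      * apply Rle_trans with (d (S (S j)) * wgt p j);
          [|apply Rmult_le_compat_l; auto; apply wgt_mono; auto].
        replace (d (S (S j)) * wgt p j) with (u2 j) by (unfold u2; rewrite Nat.eqb_refl; auto).
        apply sum_n_single_le.
        -- intros i hi; unfold u2; destruct (Nat.eqb_spec (S (S i)) (S (S j))); auto; lia.
        -- unfold u2; rewrite Nat.eqb_refl; apply Rmult_le_pos; auto; apply Rlt_le, wgt_pos.
    + apply Rmult_le_compat_l; [apply ha; lia|].
      apply sum_n_support_le.
      * intros k; apply Rmult_le_pos; [apply Rlt_le, wgt_pos|apply hb; lia].
      * intros k hk; unfold u3; rewrite hbij by lia; ring.
Qed.

Lemma colsum_Deltap p j : sum_n (fun i => wgt p i * b (S i) (S (S j))) (S j) =
  wgt p (S j) - Deltap b p (S (S j)).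
Proof.
  unfold Deltap, wgt; rewrite sum_f_1, sum_Sn, (hbij (S (S j)) (S (S j))) by lia.
  unfold plus; cbn -[INR Rpower sum_n]; ring.
Qed.

Variable p0 : R.
Hypothesis hp0 : 1 < p0.
Hypothesis hliminf : Rbar_lt 0 (LimInf_seq (fun i =>
       (a i / theta a g d s i) * (Deltap b p0 i / Rpower (INR i) p0))).

Lemma liminf_lower_bound : exists c0 N, 0 < c0 /\ forall j, (N <= j)%nat ->
  c0 * theta a g d s (S (S j)) <= a (S (S j)) * (Deltap b p0 (S (S j)) / wgt p0 (S j)).
Proof.
  set (u := fun i => (a i / theta a g d s i) * (Deltap b p0 i / Rpower (INR i) p0)) in *.
  assert (h : exists c0 N, 0 < c0 /\ forall n, (N <= n)%nat -> c0 <= u n).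
  { assert (hu : is_LimInf_seq u (LimInf_seq u)) by (unfold LimInf_seq; apply (proj2_sig (ex_LimInf_seq u))).
    destruct (LimInf_seq u) as [l| |]; simpl in hliminf; [| |tauto].
    - destruct (hu (mkposreal (l / 2) ltac:(lra))) as [_ [N hN]]; simpl in hN.
      exists (l / 2), N; split; [lra|]; intros n hn; specialize (hN n hn); lra.
    - destruct (hu 1) as [N hN]; exists 1, N; split; [lra|]; intros n hn; apply Rlt_le, hN; auto. }
  destruct h as [c0 [N [hc0 hN]]].
  exists c0, N; split; auto; intros j hj.
  specialize (hN (S (S j)) ltac:(lia)).
  assert (ht : 0 < theta a g d s (S (S j))).
  { unfold theta.
    assert (h1 := hg (S (S j)) ltac:(lia)); assert (h2 := hd (S (S j)) ltac:(lia)).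
    assert (h3 := hs (S (S j)) ltac:(lia)); assert (h4 := ha2 (S (S j)) ltac:(lia)); lra. }
  apply (Rmult_le_compat_r (theta a g d s (S (S j)))) in hN; [|lra].
  eapply Rle_trans; [apply hN|]; unfold u, wgt.
  right; field; split; [|lra]; apply Rgt_not_eq, exp_pos.
Qed.

Lemma finite_upper_bound (u : nat -> R) (N : nat) : exists M, 0 <= M /\ forall j, (j < N)%nat -> u j <= M.
Proof.
  induction N as [|N [M [hM h]]]; [exists 0; split; [lra|]; intros; lia|].
  exists (Rmax M (u N)); split; [eapply Rle_trans; [apply hM|apply Rmax_l]|].
  intros j hj; destruct (Nat.eq_dec j N) as [->|hne]; [apply Rmax_r|].
  eapply Rle_trans; [apply h; lia|apply Rmax_l].
Qed.

(** For large sizes a column is at most [(theta + (c1/2) g - s) w - a Delta], and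
    [a Delta >= c1 theta w]. Half of this gain absorbs the growth surplus, leaving [1 - c1/2]. *)
Lemma relative_bound p : 1 < p -> exists gam K, 0 <= gam < 1 /\ 0 <= K /\
  forall j N, sum_n (fun i => wgt p i * fkern (S i) (S j)) N <= (gam * theta a g d s (S j) + K) * wgt p j.
Proof.
  intros hp.
  destruct liminf_lower_bound as [c0 [N0 [hc0 hN0]]].
  destruct (INR_unbounded ((p0 - 1) / (p - 1))) as [n hn].
  assert (hn0 : 0 < INR n).
  { eapply Rlt_trans; [|apply hn]; apply Rdiv_lt_0_compat; lra. }
  assert (hnp : p0 - 1 <= INR n * (p - 1)) by (apply Rlt_le, Rlt_div_l; [lra|auto]).
  (* Division by [n] is the price of passing from [p0] to [p]; the cap at 1 keeps [1 - c1/2]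
     nonnegative. *)
  set (c1 := Rmin (c0 / INR n) 1).
  assert (hc1 : 0 < c1) by (apply Rmin_pos; [apply Rdiv_lt_0_compat|]; lra).
  assert (hc1' : c1 <= 1) by apply Rmin_r.
  assert (hc1n : INR n * c1 <= c0).
  { assert (h := Rmin_l (c0 / INR n) 1); fold c1 in h.
    apply (Rmult_le_compat_l (INR n)) in h; [|lra].
    replace (INR n * (c0 / INR n)) with c0 in h by (field; lra); auto. }
  destruct (INR_unbounded (p / ln (1 + c1 / 2))) as [N1 hN1].
  (* The successor makes large indices of the form [S j] with [j >= N0], as [hN0] is stated for
     sizes [S (S j)]. *)
  set (N := (S N0 + N1)%nat).
  (* The finitely many small columns go into [K], because all weights are at least 1. *)
  destruct (finite_upper_bound (colsum p) N) as [K [hK hKj]].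
  exists (1 - c1 / 2), K; split; [lra|]; split; auto.
  intros j M; eapply Rle_trans; [apply fkern_col_le; lra|].
  assert (th0 := theta_ge0 j); assert (w1 := wgt_ge1 p j ltac:(lra)).
  destruct (Nat.lt_ge_cases j N) as [hj|hj].
  - eapply Rle_trans; [apply hKj; auto|].
    assert (0 <= (1 - c1 / 2) * theta a g d s (S j)) by (apply Rmult_le_pos; lra).
    apply Rle_trans with (((1 - c1 / 2) * theta a g d s (S j) + K) * 1); [lra|].
    apply Rmult_le_compat_l; lra.
  - destruct j as [|j]; [unfold N in hj; lia|].
    unfold colsum; rewrite colsum_Deltap.
    set (w := wgt p (S j)) in *; set (D := Deltap b p (S (S j))); set (th := theta a g d s (S (S j))) in *.
    assert (hD : c1 * th * w <= a (S (S j)) * D).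
    { assert (h0 := hN0 j ltac:(unfold N in hj; lia)); fold th in h0.
      assert (h1 := Deltap_compare p p0 n j hp hnp); fold w D in h1.
      apply (Rmult_le_compat_l (a (S (S j)))) in h1; [|apply ha; lia].
      assert (h2 : INR n * c1 * th <= c0 * th) by (apply Rmult_le_compat_r; auto).
      assert (h3 : INR n * (c1 * th) <= INR n * (a (S (S j)) * (D / w))) by lra.
      apply Rmult_le_reg_l in h3; auto.
      apply (Rmult_le_compat_r w) in h3; [|lra].
      replace (a (S (S j)) * (D / w) * w) with (a (S (S j)) * D) in h3 by (field; lra); auto. }
    assert (hG : wgt p (S (S j)) <= (1 + c1 / 2) * w).
    { apply wgt_succ_le; try lra.
      apply Rlt_le, Rlt_le_trans with (INR N1); auto; apply le_INR; unfold N in hj; lia. }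
    assert (gj := hg (S (S j)) ltac:(lia)); assert (sj := hs (S (S j)) ltac:(lia)).
    assert (dj := hd (S (S j)) ltac:(lia)); assert (aj := ha (S (S j)) ltac:(lia)).
    apply (Rmult_le_compat_l (g (S (S j)))) in hG; auto.
    assert (hth : th = a (S (S j)) + g (S (S j)) + d (S (S j)) + s (S (S j))) by reflexivity.
    assert (hgt : c1 / 2 * (g (S (S j)) * w) <= c1 / 2 * (th * w)).
    { apply Rmult_le_compat_l; [lra|]; apply Rmult_le_compat_r; lra. }
    assert (hsw : 0 <= s (S (S j)) * w) by (apply Rmult_le_pos; lra).
    assert (hKw : 0 <= K * w) by (apply Rmult_le_pos; lra).
    assert (hthw : th * w = a (S (S j)) * w + g (S (S j)) * w + d (S (S j)) * w + s (S (S j)) * w)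
      by (rewrite hth; ring).
    lra.
Qed.

(** * Identification of the abstract operator with [Yop] *)

Lemma Series_single (u : nat -> R) (k : nat) : (forall i, i <> k -> u i = 0) -> is_series u (u k).
Proof.
  intros h; change (is_lim_seq (sum_n u) (u k)).
  apply is_lim_seq_ext_loc with (fun _ => u k); [|apply is_lim_seq_const].
  exists k; intros n hn; rewrite <- (sum_n_single u k h) at 1.
  induction hn as [|n hn IH]; auto.
  rewrite sum_Sn, <- IH, (h (S n)) by lia; unfold plus; simpl; rewrite Rplus_0_r; reflexivity.
Qed.

Lemma fkern_row (f : nat -> R) (i : nat) : f 0%nat = 0 ->
  ex_series (fun k => Rabs (fkern (S i) (S k) * f (S k))) ->
  Series (fun k => fkern (S i) (S k) * f (S k)) =
    g i * f i + d (S (S i)) * f (S (S i)) +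
    Series (fun k => a (S (S i) + k)%nat * b (S i) (S (S i) + k)%nat * f (S (S i) + k)%nat).
Proof.
  intros f0 hex.
  set (u1 := fun k => (if (S i =? S (S k))%nat then g (S k) else 0) * f (S k)).
  set (u2 := fun k => (if (S (S i) =? S k)%nat then d (S k) else 0) * f (S k)).
  set (u3 := fun k => a (S k) * b (S i) (S k) * f (S k)).
  assert (h1 : is_series u1 (g i * f i)).
  { destruct i as [|i].
    (* Nothing grows into size 1: the dummy value [f 0 = 0] removes the term. *)
    - rewrite f0; replace (g 0%nat * 0) with (u1 0%nat) by (unfold u1; simpl; ring).
      apply Series_single; intros k _; unfold u1; simpl; ring.
    - replace (g (S i) * f (S i)) with (u1 i) by (unfold u1; rewrite Nat.eqb_refl; auto).
      apply Series_single; intros k hk; unfold u1.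
      destruct (Nat.eqb_spec (S (S i)) (S (S k))); [lia|ring]. }
  assert (h2 : is_series u2 (d (S (S i)) * f (S (S i)))).
  { replace (d (S (S i)) * f (S (S i))) with (u2 (S i)) by (unfold u2; rewrite Nat.eqb_refl; auto).
    apply Series_single; intros k hk; unfold u2.
    destruct (Nat.eqb_spec (S (S i)) (S k)); [lia|ring]. }
  assert (h3 : ex_series u3).
  { eapply ex_series_dominated; [|apply hex]; intros k; unfold u3.
    assert (p1 := hg (S k) ltac:(lia)); assert (p2 := hd (S k) ltac:(lia)).
    assert (p3 := Rmult_le_pos _ _ (ha (S k) ltac:(lia)) (hb (S i) (S k) ltac:(lia) ltac:(lia))).
    rewrite !Rabs_mult; apply Rmult_le_compat_r; [apply Rabs_pos|].
    rewrite <- Rabs_mult, !Rabs_pos_eq by (auto using fkern_ge0).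
    unfold fkern; destruct (_ =? _)%nat; destruct (_ =? _)%nat; lra. }
  rewrite (Series_ext _ (fun k => u1 k + u2 k + u3 k))
    by (intros k; unfold fkern, u1, u2, u3; ring).
  assert (h12 : ex_series (fun k => u1 k + u2 k))
    by (apply (ex_series_plus (V := R_NormedModule)); eexists; eauto).
  rewrite (Series_plus (fun k => u1 k + u2 k)), Series_plus by (auto; eexists; eauto).
  rewrite (is_series_unique _ _ h1), (is_series_unique _ _ h2).
  (* Fragments are strictly smaller than their parent, so the first [S i] terms vanish and the
     series may start at size [S (S i)]. *)
  f_equal; apply (Series_incr_n_aux u3 (S i)).
  intros k hk; unfold u3; rewrite hbij by lia; ring.
Qed.

Section Operator.

Variables (p gam K : R).
Hypothesis gam_bounds : 0 <= gam < 1.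
Hypothesis K_ge0 : 0 <= K.
Hypothesis fkern_col : forall j N,
  sum_n (fun i => wgt p i * fkern (S i) (S j)) N <= (gam * theta a g d s (S j) + K) * wgt p j.

Lemma diag_real (f : nat -> R) : inX p (fun i => theta a g d s i * f i) <->
  inXC p (diag (theta a g d s) (fun i => RtoC (f i))).
Proof.
  rewrite inX_inXC.
  replace (diag (theta a g d s) (fun i => RtoC (f i))) with (fun i => RtoC (theta a g d s i * f i));
    [tauto|].
  apply functional_extensionality; intros i; apply RtoC_mult.
Qed.

Lemma Yop_kapply (f : nat -> R) i : DomY p a g d s f ->
  RtoC (Yop a g d s b f (S i)) =
    (- diag (theta a g d s) (fun i => RtoC (f i)) (S i) + kapply fkern (fun i => RtoC (f i)) (S i))%C.
Proof.
  intros [hf hdf].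
  assert (hsum : msummable p (fun j => gam * theta a g d s j + K) (fun i => RtoC (f i))).
  { apply domain_msummable; auto using theta_ge0; [apply inX_inXC|apply diag_real]; auto. }
  assert (hrow := kapply_row_summable p fkern _ fkern_ge0 fkern_col _ i hsum).
  assert (e : kapply fkern (fun i => RtoC (f i)) (S i) = RtoC (Series (fun k => fkern (S i) (S k) * f (S k)))).
  { unfold kapply, CSeries, RtoC; f_equal.
    - apply Series_ext; intros k; simpl; ring.
    - rewrite (Series_ext _ (fun _ => 0 * 0)) by (intros k; simpl; ring).
      rewrite Series_scal_l; ring. }
  rewrite e, fkern_row.
  - unfold diag; rewrite <- RtoC_mult, <- RtoC_opp, <- RtoC_plus; f_equal.
    unfold Yop; replace (S i - 1)%nat with i by lia.
    ring.
  - apply hf.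
  - eapply ex_series_ext; [|apply hrow]; intros k; cbv beta.
    rewrite <- RtoC_mult, Cmod_R; auto.
Qed.

Lemma Yop_inX f : DomY p a g d s f -> inX p f /\ inX p (Yop a g d s b f).
Proof.
  intros hD; assert (hD' := hD); destruct hD' as [hf hdf]; split; auto.
  assert (hfc := proj1 (inX_inXC p f) hf); assert (hdc := proj1 (diag_real f) hdf).
  destruct (kapply_domain p (theta a g d s) fkern gam K theta_ge0 fkern_ge0 fkern_col _ hfc hdc) as [hB _].
  set (B := exist _ _ hB : cvec p); set (D := exist _ _ hdc : cvec p).
  apply (real_inX p (B - D)%V); intros [|i]; [apply cval0|].
  rewrite csub_val, Yop_kapply by auto; unfold B, D; simpl cval.
  apply Cplus_comm.
Qed.

Lemma opgraph_Yop f h : inX p f -> inX p h ->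
  ((DomY p a g d s f /\ Yop a g d s b f = h) <-> opgraph p (theta a g d s) fkern (embed p f) (embed p h)).
Proof.
  intros hf hh.
  assert (ef : cval (embed p f) = (fun i => RtoC (f i)))
    by (apply functional_extensionality; intros; apply embed_val; auto).
  unfold opgraph; rewrite ef, <- diag_real; split.
  - intros [hD <-]; split; [apply hD|]; intros i.
    rewrite embed_val by auto; apply Yop_kapply; auto.
  - intros [hdf heq]; assert (hD : DomY p a g d s f) by (split; auto); split; auto.
    apply functional_extensionality; intros [|i]; [symmetry; apply hh|].
    apply RtoC_inj; rewrite Yop_kapply, <- heq, embed_val; auto.
Qed.

End Operator.

End Fragmentation.

Theorem theorem2p1
  (g d s a : nat -> R) (b : nat -> nat -> R)
  (hg : forall i, (1 <= i)%nat -> 0 <= g i)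
  (hd : forall i, (1 <= i)%nat -> 0 <= d i)
  (hs : forall i, (1 <= i)%nat -> 0 <= s i)
  (ha : forall i, (1 <= i)%nat -> 0 <= a i)
  (hb : forall i j, (1 <= i)%nat -> (1 <= j)%nat -> 0 <= b i j)
  (ha1 : a 1%nat = 0)
  (ha2 : forall i, (2 <= i)%nat -> 0 < a i)
  (hbij : forall i j, (1 <= i)%nat -> (1 <= j)%nat -> (j <= i)%nat -> b i j = 0)
  (hmass : forall j, (2 <= j)%nat -> sum_f 1 (j - 1) (fun i => INR i * b i j) = INR j)
  (p0 : R) (hp0 : 1 < p0)
  (hliminf : Rbar_lt 0 (LimInf_seq (fun i =>
       (a i / theta a g d s i) * (Deltap b p0 i / Rpower (INR i) p0)))) :
  forall p : R, 1 < p ->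
  exists T : R -> (nat -> R) -> (nat -> R),
    is_C0_semigroup p T /\
    is_generator p T (Yop a g d s b) (DomY p a g d s) /\
    is_positive_semigroup p T /\
    is_analytic_semigroup p T.
Proof.
  intros p hp.
  destruct (relative_bound g d s a b hg hd hs ha hb ha2 hbij hmass p0 hp0 hliminf p hp)
    as [gam [K [hgam [hK hcol]]]].
  assert (hth := theta_ge0 g d s a hg hd hs ha).
  assert (hk := fkern_ge0 g d a b hg hd ha hb).
  destruct (perturbed_diagonal_generation p (theta a g d s) (fkern g d a b) gam K hth hk hgam hK hcol
    (fkern_band g d a b hbij)) as [T [h1 [h2 [h3 [h4 [h5 [h6 h7]]]]]]].
  assert (hslope := slope_pos gam hgam).
  exists (TR p T); split; [|split; [|split]].
  - apply (TR_C0 p (slope gam)); auto.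
  - apply (TR_generator p (slope gam) T (opgraph p (theta a g d s) (fkern g d a b))); auto.
    + intros f; apply (Yop_inX g d s a b) with gam K; auto.
    + intros f h; apply (opgraph_Yop g d s a b) with gam K; auto.
  - apply TR_positive; auto.
  - apply (TR_analytic p (slope gam)); auto.
Qed.
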